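(* Let $A\in\mathbb{R}^{d\times n}_{\geq 0}$ be a nonnegative matrix of rank $d$ with no zero column, and $B\in\mathbb{R}^{n\times(n-d)}$ a matrix whose columns form a basis of $\ker A$. Let $Q_{b_0}=B^T\cdot P_{b_0}$ for $b_0\in C\cap\mathrm{pos}(A)$, where $C\in\mathcal{C}_A$ is a cell in the chamber complex of $A$ (with $Q_{b_0}$ simple, so that its Wachspress model is defined). The complex critical points of the log-likelihood function $L_u(y)$ for the Wachspress model $M_{\mathbb{C}}(Q_{b_0})$ with data $u=(u_v)_{v\in\mathcal{V}(Q_{b_0})}$ are in one-to-one correspondence with the complex critical points of $$V_{C,u'}(x)=\frac{\alpha_C(x)^{u_0'}}{\prod_{i\in\mathcal{F}_C}x_i^{u_i'}}$$ on $\{Ax=b_0\}$, where $u'=(u_0',(u_i')_{i\in\mathcal{F}_C})$ has entries $$u_0'=-\sum_{v\in\mathcal{V}(Q_{b_0})}u_v,\qquad u_i'=-\sum_{v:\,i\notin I(v)}u_v,\quad i\in\mathcal{F}_C.$$ More precisely, the critical points $y_{\rm crit}\in\mathbb{C}^{n-d}\setminus D(Q_{b_0})$ of $L_u(y)$ are the points $B^T\cdot x_{\rm crit}$, where $x_{\rm crit}$ ranges over the points in the intersection $\mathscr{X}_{C,u'}^\circ\cap\{Ax=b_0\}$.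
   Context: $\mathrm{pos}(A)$ is the image of $\mathbb{R}^n_{>0}$ under $A:\mathbb{R}^n\to\mathbb{R}^d$, the interior of $\mathrm{cone}(A)$, the convex cone generated by the columns of $A$. For $b\in\mathrm{pos}(A)$, $P_b=\{x\in\mathbb{R}^n_{\geq0}:Ax=b\}$ is an $(n-d)$-dimensional polytope and $Q_b=B^T\cdot P_b$ is a full-dimensional polytope in $\mathbb{R}^{n-d}$. A polytope of dimension $m$ is simple if each vertex lies on exactly $m$ facets. $\mathcal{V}(Q)$ is the set of vertices of a polytope $Q$. Chamber complex: for nonempty $\sigma\subset[n]=\{1,\dots,n\}$ let $A_\sigma$ be the submatrix of $A$ with columns indexed by $\sigma$. For $b\in\mathrm{cone}(A)$, $C_b=\bigcap_{\sigma:\,b\in\mathrm{cone}(A_\sigma)}\mathrm{cone}(A_\sigma)$, and $\mathcal{C}_A=\{C_b:b\in\mathrm{cone}(A)\}$. A cell is a full-dimensional chamber. Notation for a cell $C$: for $b\in\mathrm{int}(C)$ the polytope $P_b$ is simple, and the following data do not depend on $b\in\mathrm{int}(C)$. $\mathcal{F}_C\subset[n]$ is the set of $i$ such that $P_b\cap\{x_i=0\}$ is a facet of $P_b$; $n_C=|\mathcal{F}_C|$. For a vertex $v$, $I(v)\subset\mathcal{F}_C$ is the $(n-d)$-element set of indices of the facets containing $v$; $\mathcal{V}_C$ is the set of all these $I(v)$. With $x_I=\prod_{i\in I}x_i$, set $\alpha_C(x)=\sum_{I(v)\in\mathcal{V}_C}|\det A_{[n]\setminus I(v)}|\cdot x_{\mathcal{F}_C\setminus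 I(v)}$. $B_C$ is the submatrix of $B$ with rows indexed by $\mathcal{F}_C$. For $u'\in\mathbb{C}^{n_C+1}$, $\mathscr{X}_{C,u'}^\circ=\{x\in\mathbb{C}^n:\alpha_C(x)\prod_{i\in\mathcal{F}_C}x_i\neq0,\ B_C^T\cdot(\frac{u_0'\partial_{x_i}\alpha_C}{\alpha_C}-\frac{u_i'}{x_i})_{i\in\mathcal{F}_C}=0\}$. Critical points of $V_{C,u'}$ on $\{Ax=b_0\}$ are understood as critical points of $\log V_{C,u'}$ in the locus where $\alpha_C(x)\prod_{i\in\mathcal{F}_C}x_i\neq0$. Wachspress models: let $Q\subset\mathbb{R}^m$ be a full-dimensional simple polytope with minimal facet representation $Q=\{y:\langle w_i,y\rangle+c_i\geq0,\ i\in\mathcal{F}\}$. For a vertex $v\in\mathcal{V}(Q)$ let $I(v)=\{i\in\mathcal{F}:\langle w_i,v\rangle+c_i=0\}$ ($m$ elements) and let $W_{I(v)}$ be the $m\times m$ matrix with columns $w_i$, $i\in I(v)$. Put $\alpha_Q(y)=\sum_{v\in\mathcal{V}(Q)}|\det W_{I(v)}|\prod_{i\in\mathcal{F}\setminus I(v)}(\langle w_i,y\rangle+c_i)$ and $$p_v(y)=\frac{|\det W_{I(v)}|\prod_{i\in\mathcal{F}\setminus I(v)}(\langle w_i,y\rangle+c_i)}{\alpha_Q(y)},\quad v\in\mathcal{V}(Q),$$ so that $\sum_vp_v=1$. The Wachspress variety (model) $M_{\mathbb{C}}(Q)\subset\mathbb{P}^{|\mathcal{V}(Q)|-1}$ is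 the Zariski closure of the image of $y\mapsto(p_v(y))_v$. $D(Q)\subset\mathbb{C}^m$ is the union of $\{\alpha_Q=0\}$ and the facet hyperplanes $\{\langle w_i,y\rangle+c_i=0\}$. The log-likelihood function is $L_u(y)=\sum_{v}u_v\log p_v(y)$, and its complex critical points are the $y\in\mathbb{C}^m\setminus D(Q)$ with $\sum_vu_v\,\partial_{y_j}p_v(y)/p_v(y)=0$ for $j=1,\dots,m$. For $Q=Q_{b_0}$ (so $m=n-d$) the facet inequalities are among the inequalities $x_i\geq0$, $i\in\mathcal{F}_C$, where $x=\begin{pmatrix} A \\ B^T \end{pmatrix}^{-1}\begin{pmatrix} b_0 \\ y \end{pmatrix}$, i.e. $x_i=c_i(b_0)+\langle w_i,y\rangle$; the facets, and hence the sets $I(v)$, $v\in\mathcal{V}(Q_{b_0})$, are indexed accordingly by elements of $\mathcal{F}_C$.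
   Formalization: Critical points of L_u lying on a hyperplane x_i=0 with i in F_C that defines no facet of Q_{b0} are excluded; such hyperplanes occur only for b0 on the boundary of C, where the claim as stated fails for some u. For b0 in int(C) nothing is excluded. *)

(* Defs.v *)
(* The reals are an abstract [R : realType], the complex numbers [R[i]].  We
   write n = d + m, so that m = n - d and col_mx A B^T is square; since A has
   rank d, hence d <= n, no generality is lost. *)
From HB Require Import structures.
From mathcomp Require Export all_boot all_order all_algebra complex.
From mathcomp Require Export all_classical all_reals all_analysis.
Set Implicit Arguments.
Unset Strict Implicit.
Unset Printing Implicit Defensive.
Export Order.TTheory GRing.Theory Num.Theory numFieldNormedType.Exports.
#[global] Open Scope classical_set_scope.
#[global] Open Scope ring_scope.

Section Polytopes.
Context {R : realType} {p : nat}.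
Implicit Types (P F : set 'cV[R]_p) (v w : 'cV[R]_p).

Definition dotv w v : R := (w^T *m v) 0 0.

Definition aff_independent k (x : 'I_k.+1 -> 'cV[R]_p) : bool :=
  row_free (\matrix_(i < k) (x (lift ord0 i) - x ord0)^T).

(* The affine hull of P has dimension k; in particular P is nonempty. *)
Definition has_dim P (k : nat) : Prop :=
  (exists2 x : 'I_k.+1 -> 'cV[R]_p, forall i, P (x i) & aff_independent x) /\
  ~ (exists2 x : 'I_k.+2 -> 'cV[R]_p, forall i, P (x i) & aff_independent x).

Definition is_face P F : Prop :=
  exists w (c : R), (forall x, P x -> 0 <= dotv w x + c) /\
                    F = P `&` [set x | dotv w x + c = 0].

(* Since has_dim excludes the empty set, a 0-dimensional polytope has no
   facets. *)
Definition is_facet P F : Prop :=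
  is_face P F /\ exists2 k, has_dim P k.+1 & has_dim F k.

Definition vertices P : set 'cV[R]_p := [set v | is_face P [set v]].

Definition is_simple P (k : nat) : Prop :=
  has_dim P k /\
  forall v, vertices P v -> ([set F | is_facet P F /\ F v] #= `I_k)%card.

End Polytopes.

Definition col_submx (T : Type) p q (M : 'M[T]_(p, q)) (s : {set 'I_q}) :
    'M[T]_(p, #|s|) := colsub (fun k : 'I_#|s| => enum_val k) M.

Definition row_submx (T : Type) p q (M : 'M[T]_(p, q)) (s : {set 'I_p}) :
    'M[T]_(#|s|, q) := rowsub (fun k : 'I_#|s| => enum_val k) M.

(* det M_s, meaningful when #|s| = p: conform_mx then only transports M_s along
   this equality. *)
Definition col_minor (T : comNzRingType) p q (M : 'M[T]_(p, q))
    (s : {set 'I_q}) : T :=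
  \det (conform_mx (0 : 'M[T]_p) (col_submx M s)).

(* kermx is a row kernel, whence the transpositions. *)
Definition kernel_basis (K : fieldType) p q r (A : 'M[K]_(p, q))
    (B : 'M[K]_(q, r)) : Prop :=
  row_free B^T /\ (B^T :=: kermx A^T)%MS.

Definition cplx {R : realType} p q (M : 'M[R]_(p, q)) : 'M[R[i]]_(p, q) :=
  map_mx (real_complex R) M.

Definition partial {R : realType} p (f : 'cV[R[i]]_p -> R[i]) (j : 'I_p)
    (x : 'cV[R[i]]_p) : R[i] :=
  derive (f : 'cV[R[i]]_p -> R[i]^o) x (delta_mx j 0).

Definition dlog {R : realType} p (f : 'cV[R[i]]_p -> R[i]) (j : 'I_p)
    (x : 'cV[R[i]]_p) : R[i] := partial f j x / f x.

Section Chambers.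
Context {R : realType} {d n : nat}.
Implicit Types (A : 'M[R]_(d, n)) (b : 'cV[R]_d).

Definition cone k (M : 'M[R]_(d, k)) : set 'cV[R]_d :=
  [set M *m t | t in [set t : 'cV[R]_k | forall i, 0 <= t i 0]].

Definition pos k (M : 'M[R]_(d, k)) : set 'cV[R]_d :=
  [set M *m t | t in [set t : 'cV[R]_k | forall i, 0 < t i 0]].

Definition chamber A b : set 'cV[R]_d :=
  [set z | forall s : {set 'I_n}, s != finset.set0 ->
    cone (col_submx A s) b -> cone (col_submx A s) z].

Definition chamber_complex A : set (set 'cV[R]_d) := chamber A @` cone A.

Definition is_cell A (C : set 'cV[R]_d) : Prop :=
  chamber_complex A C /\ has_dim C d.

Definition Ppoly A b : set 'cV[R]_n :=
  [set x : 'cV[R]_n | (forall i, 0 <= x i 0) /\ A *m x = b].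

Definition facet_ix A b : {set 'I_n} :=
  [set i | `[< is_facet (Ppoly A b)
                 (Ppoly A b `&` [set x : 'cV[R]_n | x i 0 = 0]) >]]%SET.

(* The data F_C and V_C are the same for all b in the interior of a cell C, so
   collecting them over all such b is the same as using any single one. *)
Definition cell_facets A (C : set 'cV[R]_d) : {set 'I_n} :=
  [set i | `[< exists2 b, C° b & i \in facet_ix A b >]]%SET.

Definition cell_vertices A (C : set 'cV[R]_d) : {set {set 'I_n}} :=
  [set I | `[< exists b v, [/\ C° b, vertices (Ppoly A b) v &
                 I = [set i in facet_ix A b | v i 0 == 0]%SET] >]]%SET.

Definition alphaC A (C : set 'cV[R]_d) (x : 'cV[R[i]]_n) : R[i] :=
  \sum_(I in cell_vertices A C)
     (`|col_minor A (finset.setC I)|%:C)%C *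
     \prod_(i in (cell_facets A C :\: I)%SET) x i 0.

Definition cell_locus A (C : set 'cV[R]_d) : set 'cV[R[i]]_n :=
  [set x | alphaC A C x * \prod_(i in cell_facets A C) x i 0 != 0].

(* X°_{C,u'}, with u' = (u0, (u1 i)_{i in F_C}); the values of u1 outside F_C
   are not used. *)
Definition XC m A (B : 'M[R]_(n, m)) (C : set 'cV[R]_d) (u0 : R[i])
    (u1 : 'I_n -> R[i]) : set 'cV[R[i]]_n :=
  [set x | cell_locus A C x /\
    (cplx (row_submx B (cell_facets A C)))^T *m
      (\col_(k < #|cell_facets A C|)
         let i := enum_val k in
         u0 * partial (alphaC A C) i x / alphaC A C x - u1 i / x i 0) = 0].

Definition affine_fiber A b : set 'cV[R[i]]_n := [set x | cplx A *m x = cplx b].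

(* i-th partial derivative of log V, V = alpha_C^u0 / prod_{k in F_C} x_k^{u1 k}:
   the exponents are complex, so V itself is multivalued but dlog V is not. *)
Definition dlogV A (C : set 'cV[R]_d) (u0 : R[i]) (u1 : 'I_n -> R[i])
    (i : 'I_n) (x : 'cV[R[i]]_n) : R[i] :=
  u0 * dlog (alphaC A C) i x -
  \sum_(k in cell_facets A C) u1 k * dlog (fun z => z k 0) i x.

(* Critical points of log V restricted to {A x = b}: its differential vanishes
   on the tangent space ker A. *)
Definition critV A (C : set 'cV[R]_d) (b : 'cV[R]_d) (u0 : R[i])
    (u1 : 'I_n -> R[i]) : set 'cV[R[i]]_n :=
  [set x | [/\ cell_locus A C x, affine_fiber A b x &
    forall t : 'cV[R[i]]_n, cplx A *m t = 0 ->
      \sum_i t i 0 * dlogV A C u0 u1 i x = 0]].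

End Chambers.

(* The affine functions <w_i, y> + c_i, the w_i being the rows of W. *)
Definition ell (T : pzRingType) N m (W : 'M[T]_(N, m)) (c : 'cV[T]_N)
    (y : 'cV[T]_m) (i : 'I_N) : T := (W *m y + c) i 0.

Section Wachspress.
(* Q is meant to be a full-dimensional simple polytope in R^m with minimal
   facet representation {y | <w_i, y> + c_i >= 0, i in F}. *)
Context {R : realType} {N m : nat}.
Variables (W : 'M[R]_(N, m)) (c : 'cV[R]_N) (F : {set 'I_N}).
Variable Q : set 'cV[R]_m.

Definition ellC (y : 'cV[R[i]]_m) (i : 'I_N) : R[i] :=
  ell (cplx W) (cplx c) y i.

Definition vert_ix (v : 'cV[R]_m) : {set 'I_N} :=
  [set i in F | ell W c v i == 0]%SET.

Definition wachs_num (v : 'cV[R]_m) (y : 'cV[R[i]]_m) : R[i] :=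
  (`|col_minor W^T (vert_ix v)|%:C)%C *
  \prod_(i in (F :\: vert_ix v)%SET) ellC y i.

Definition alphaQ (y : 'cV[R[i]]_m) : R[i] :=
  \sum_(v \in vertices Q) wachs_num v y.

Definition wachs_coord (v : 'cV[R]_m) (y : 'cV[R[i]]_m) : R[i] :=
  wachs_num v y / alphaQ y.

Definition DQ : set 'cV[R[i]]_m :=
  [set y | alphaQ y = 0 \/ exists2 i, i \in F & ellC y i = 0].

(* Complex critical points of L_u = sum_v u_v log p_v; only the values of u at
   the vertices of Q are used. *)
Definition critL (u : 'cV[R]_m -> R[i]) : set 'cV[R[i]]_m :=
  [set y | ~ DQ y /\ forall j : 'I_m,
    \sum_(v \in vertices Q)
       u v * (partial (wachs_coord v) j y / wachs_coord v y) = 0].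

End Wachspress.

Section Qb.
Context {R : realType} {d m : nat}.
Variables (A : 'M[R]_(d, d + m)) (B : 'M[R]_(d + m, m)).

Definition Qpoly (b : 'cV[R]_d) : set 'cV[R]_m :=
  (fun x => B^T *m x) @` Ppoly A b.

(* (A ; B^T)^-1 (b ; y) = Qcst b + Qnormals y, so that x_i = c_i(b) + <w_i, y>. *)
Definition Qinv : 'M[R]_(d + m) := invmx (col_mx A B^T).
Definition Qnormals : 'M[R]_(d + m, m) := rsubmx Qinv.
Definition Qcst (b : 'cV[R]_d) : 'cV[R]_(d + m) := lsubmx Qinv *m b.

(* The i in F_C such that x_i >= 0 defines a facet of Q_b.  For b in the
   interior of C this is F_C; on the boundary of C it may be smaller. *)
Definition Qfacets (C : set 'cV[R]_d) (b : 'cV[R]_d) : {set 'I_(d + m)} :=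
  [set i in cell_facets A C |
     `[< is_facet (Qpoly b)
           (Qpoly b `&` [set y | ell Qnormals (Qcst b) y i = 0]) >]]%SET.

Definition Qvert_ix (C : set 'cV[R]_d) (b : 'cV[R]_d) (v : 'cV[R]_m) :
    {set 'I_(d + m)} := vert_ix Qnormals (Qcst b) (Qfacets C b) v.

Definition critLQ (C : set 'cV[R]_d) (b : 'cV[R]_d) (u : 'cV[R]_m -> R[i]) :
    set 'cV[R[i]]_m :=
  critL Qnormals (Qcst b) (Qfacets C b) (Qpoly b) u.

(* The hyperplanes x_i = 0, i in F_C, that are redundant for Q_b. They exist
   only when b is on the boundary of C; they are not part of D(Q_b), but their
   preimages are excluded from the locus where V_C is considered. *)
Definition redundant_hyperplanes (C : set 'cV[R]_d) (b : 'cV[R]_d) :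
    set 'cV[R[i]]_m :=
  [set y | exists2 i, i \in (cell_facets A C :\: Qfacets C b)%SET &
                      ellC Qnormals (Qcst b) y i = 0].

Definition u'0 (b : 'cV[R]_d) (u : 'cV[R]_m -> R[i]) : R[i] :=
  - \sum_(v \in vertices (Qpoly b)) u v.

Definition u'1 (C : set 'cV[R]_d) (b : 'cV[R]_d) (u : 'cV[R]_m -> R[i])
    (i : 'I_(d + m)) : R[i] :=
  - \sum_(v \in vertices (Qpoly b) `&` [set v | i \notin Qvert_ix C b v]) u v.

End Qb.

(* Main.v *)
Require Import Defs.
From mathcomp Require Import all_boot all_order all_algebra complex.
From mathcomp Require Import perm zify ring lra.
From mathcomp Require Import all_classical all_reals all_analysis.
Set Implicit Arguments.
Unset Strict Implicit.
Unset Printing Implicit Defensive.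
Import Order.TTheory GRing.Theory Num.Theory numFieldNormedType.Exports.
Local Open Scope classical_set_scope.
Local Open Scope ring_scope.

(* In the coordinate y = B^T x, the fiber {A x = b} is {W y + c(b)}, so that the
   chamber C is a range of right-hand sides c for which the system W y + c >= 0
   keeps the same feasible bases I (complements of the bases of A).  The theorem
   rests on an identity of polynomials, valid for every b0 in C:
     alpha_C (W y + c(b0)) = |det (A; B^T)| * prod_(i in F_C \ F_Q) x_i * alpha_Q(y),
   which makes d log V_(C,u') along the fiber equal to d L_u.

   By Jacobi's complementary minor formula, |det A_(~I)| is a constant multiple
   of |det W_I|, so after division by prod_(i in F_C) x_i the identity can be
   checked at each vertex v of Q_b0 separately:
     sum_I |det W_I| / prod_(i in I) z_i = |det W_I(v)| / prod_(i in I(v)) z_i,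
   where z = W (y - v) and I runs over the feasible bases that collapse to v.
   These I triangulate the normal cone of v, spanned by the rows in I(v) because
   Q_b0 is simple.  For a generic right-hand side the sum over the feasible
   bases does not change when the inequalities tight at v are added to those of
   I(v) one by one: a new inequality cuts off some vertices and creates one on
   each edge that it crosses, and Cramer's rule expands the terms of the former
   over edges, on which they cancel except on the crossed ones. *)

(** * Bases and feasible bases of a system of linear inequalities *)

(** The point [b0] may lie on the boundary of [C], and the obstacles come from there: several cell
    bases can collapse to one vertex, and some [x i] with [i] in [F_C] may no longer define facets
    of [Q_b0]. Against the first, [b0] is replaced by a generic [b] over which all cell bases stay
    feasible: since [b0 + t (b - b0)] with small [t > 0] leaves every inequality that is not tight
    at [v] slack, the bases collapsing to [v] are exactly the feasible bases of the system of
    inequalities tight at [v]. The second accounts for the extra product over [F_C \ F_Q]: such an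
    index belongs to no [I(v)], so [u'_i = u'_0] and the logarithmic derivative of the product
    cancels. Its zeros are still excluded from the locus of [V], so the critical points of [L_u] are
    compared off these hyperplanes. Inequalities outside [F_C] can be tight at [v] too, although
    they occur in no product. A positivity argument shows that dropping them does not change the
    feasible bases at [v]. *)

Lemma col_minorE (T : comNzRingType) p q (M : 'M[T]_(p, q)) (s : {set 'I_q})
    (h : #|s| = p) :
  col_minor M s = \det (colsub (fun k => enum_val (cast_ord (esym h) k)) M).
Proof.
rewrite /col_minor /col_submx; move: M; case: _ / h => M.
by rewrite conform_mx_id; congr (\det (colsub _ M)); apply/funext => k; rewrite cast_ord_id.
Qed.

(** The two selections differ by a permutation; the absolute value removes its sign, and with it the
    dependence of a minor on how its index set is enumerated. *)
Lemma normr_det_rowsub (R : realFieldType) p q (M : 'M[R]_(q, p))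
    (f g : 'I_p -> 'I_q) : injective f -> injective g ->
  (forall k, exists l, g k = f l) ->
  `|\det (rowsub g M)| = `|\det (rowsub f M)|.
Proof.
move=> fI gI /choice[s gs].
have sI : injective s by move=> k l kl; apply: gI; rewrite !gs kl.
have -> : rowsub g M = row_perm (perm sI) (rowsub f M).
  by apply/matrixP => i j; rewrite !mxE permE gs.
by rewrite row_permE det_mulmx det_perm normrM normrX normrN1 expr1n mul1r.
Qed.

Lemma normr_col_minor (R : realFieldType) p q (M : 'M[R]_(q, p))
    (s : {set 'I_q}) (f : 'I_p -> 'I_q) : injective f -> #|s| = p ->
  (forall k, f k \in s) ->
  `|col_minor M^T s| = `|\det (rowsub f M)|.
Proof.
move=> fI sp fs; rewrite (col_minorE _ sp).
pose g := fun k => enum_val (cast_ord (esym sp) k).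
rewrite -/g (_ : colsub g M^T = (rowsub g M)^T); last by apply/matrixP => i j; rewrite !mxE.
have gI : injective g by move=> k l /enum_val_inj/cast_ord_inj.
rewrite det_tr; apply: normr_det_rowsub => // k.
have imf : [set f l | l : 'I_p]%SET = s.
  apply/eqP; rewrite eqEcard; apply/andP; split.
    by apply/fintype.subsetP => i /imsetP[l _ ->].
  by rewrite card_imset // card_ord sp.
have : g k \in s by apply: enum_valP.
by rewrite -imf => /imsetP[l _ ->]; exists l.
Qed.

(* [D] is the generalised cross product of the rows indexed by [J]. *)
Lemma edge_direction (R : realFieldType) N m (W : 'M[R]_(N, m))
    (J : {set 'I_N}) : #|J|.+1 = m ->
  exists D : 'cV[R]_m, (forall j, j \in J -> (W *m D) j 0 = 0) /\
    forall k, k \notin J -> `|col_minor W^T (k |: J)%SET| = `|(W *m D) k 0|.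
Proof.
move=> h; subst m.
pose f (k : 'I_N) (i : 'I_#|J|.+1) : 'I_N :=
  if unlift ord0 i is Some j then enum_val j else k.
pose M k := rowsub (f k) W.
pose D : 'cV[R]_#|J|.+1 := \col_l \det (rowsub (fun j : 'I_#|J| => enum_val j) (col' l W)).
pose D' : 'cV[R]_#|J|.+1 := \col_l ((-1) ^+ l * D l 0).
have WD k : (W *m D') k 0 = \det (M k).
  (* Only the first row of [M k] depends on [k], so the cofactors along it are the fixed entries of
     [D']. *)
  rewrite (expand_det_row _ ord0) !mxE; apply: eq_bigr => l _.
  rewrite !mxE /f unlift_none /cofactor add0n; congr (_ * (_ * \det _)).
  by apply/matrixP => i j; rewrite !mxE /f liftK.
exists D'; split=> [j jJ|k kJ]; rewrite WD.
  apply: (determinant_alternate (i1 := ord0) (i2 := lift ord0 (enum_rank_in jJ j))).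
    by rewrite neq_lift.
  by move=> l; rewrite !mxE /f unlift_none liftK enum_rankK_in.
apply: normr_col_minor.
- move=> i j; rewrite /f.
  case: unliftP => [i' ->|->]; case: unliftP => [j' ->|->] //.
  + by move/enum_val_inj ->.
  + by move=> E; move: kJ; rewrite -E enum_valP.
  + by move=> E; move: kJ; rewrite E enum_valP.
- by rewrite cardsU1 kJ.
- by move=> i; rewrite /f; case: unlift => [a|]; rewrite !inE ?eqxx // enum_valP orbT.
Qed.

Section Bases.
Context {R : realFieldType} {N m : nat}.
Variable W : 'M[R]_(N, m).
Implicit Types (I S : {set 'I_N}) (y : 'cV[R]_m) (eta : 'rV[R]_m).

Definition is_basis I : bool := (#|I| == m) && (col_minor W^T I != 0).

Lemma card_basis I : is_basis I -> #|I| = m.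
Proof. by case/andP => /eqP. Qed.

(** The rows in [S] span the dual space, said through their common kernel: this is the form that
    gives uniqueness of a point with prescribed tight inequalities. *)
Definition spans S : Prop :=
  forall y, (forall i, i \in S -> (W *m y) i 0 = 0) -> y = 0.

Lemma basis_unitmx I (h : #|I| = m) :
  (col_minor W^T I != 0) =
  (rowsub (fun k => enum_val (cast_ord (esym h) k)) W \in unitmx).
Proof.
rewrite (col_minorE _ h) unitmxE unitfE -det_tr.
by congr (\det _ != 0); apply/matrixP => i j; rewrite !mxE.
Qed.

Lemma basis_solve I (e : 'I_N -> R) : is_basis I ->
  exists y, forall i, i \in I -> (W *m y) i 0 = e i.
Proof.
case/andP => /eqP h; rewrite (basis_unitmx h).
set f := fun k => _; set M := rowsub f W => Mu.
exists (invmx M *m \col_k e (f k)) => i iI.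
have -> : i = f (cast_ord h (enum_rank_in iI i)).
  by rewrite /f cast_ordK enum_rankK_in.
set k := cast_ord _ _.
transitivity ((M *m (invmx M *m \col_k e (f k))) k 0).
  by rewrite !mxE; apply: eq_bigr => l _; rewrite !mxE.
by rewrite mulKVmx // mxE.
Qed.

Lemma basis_spans I : is_basis I -> spans I.
Proof.
case/andP => /eqP h; rewrite (basis_unitmx h).
set f := fun k => _; set M := rowsub f W => Mu y y0.
rewrite -[y](mulKmx Mu) (_ : M *m y = 0) ?mulmx0 //.
apply/matrixP => k j; rewrite ord1 [RHS]mxE -(y0 (f k)); last exact: enum_valP.
by rewrite !mxE; apply: eq_bigr => l _; rewrite !mxE.
Qed.

Lemma spans_basis I : #|I| = m -> spans I -> is_basis I.
Proof.
move=> h sI; rewrite /is_basis h eqxx (basis_unitmx h) /=.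
set f := fun k => _; set M := rowsub f W.
rewrite -unitmx_tr -row_free_unit -kermx_eq0; apply/eqP/row_matrixP => k.
rewrite row0; set z := row k _.
have zM : z *m M^T = 0 by rewrite -row_mul mulmx_ker row0.
apply: trmx_inj; rewrite trmx0; apply: sI => i iI.
have -> : i = f (cast_ord h (enum_rank_in iI i)).
  by rewrite /f cast_ordK enum_rankK_in.
set l := cast_ord _ _.
transitivity ((M *m z^T) l 0).
  by rewrite !mxE; apply: eq_bigr => a _; rewrite !mxE.
by rewrite -[M *m _]trmxK trmx_mul trmxK zM trmx0 mxE.
Qed.

Lemma spans_card S : spans S -> (m <= #|S|)%N.
Proof.
move=> sS; pose M := rowsub (fun k : 'I_#|S| => enum_val k) W.
suff : row_free M^T by move/eqP <-; rewrite rank_leq_col.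
rewrite -kermx_eq0; apply/eqP/row_matrixP => k.
rewrite row0; set z := row k _.
have zM : z *m M^T = 0 by rewrite -row_mul mulmx_ker row0.
apply: trmx_inj; rewrite trmx0; apply: sS => i iS.
have -> : i = enum_val (enum_rank_in iS i) by rewrite enum_rankK_in.
set l := enum_rank_in _ _.
transitivity ((M *m z^T) l 0).
  by rewrite !mxE; apply: eq_bigr => a _; rewrite !mxE.
by rewrite -[M *m _]trmxK trmx_mul trmxK zM trmx0 mxE.
Qed.

(** Coefficients are kept on all [N] rows and vanish outside [S], so that cones over different index
    sets compare without reindexing. *)
Definition in_cone S eta : Prop := exists mu : 'rV[R]_N,
  [/\ forall i, 0 <= mu 0 i, forall i, i \notin S -> mu 0 i = 0 & eta = mu *m W].

Lemma basis_coord I eta : is_basis I ->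
  exists2 mu : 'rV[R]_N, (forall i, i \notin I -> mu 0 i = 0) & eta = mu *m W.
Proof.
case/andP => /eqP h; rewrite (basis_unitmx h).
set f := fun k => _; set M := rowsub f W => Mu.
pose E : 'M[R]_(m, N) := \matrix_(k, i) (i == f k)%:R.
have EW : E *m W = M.
  apply/matrixP => k l; rewrite !mxE (bigD1 (f k)) //= mxE eqxx mul1r big1 ?addr0 //.
  by move=> i /negPf ne; rewrite mxE ne mul0r.
exists (eta *m invmx M *m E); last by rewrite -mulmxA EW mulmxKV.
move=> i iI; rewrite mxE big1 // => k _; rewrite [E _ _]mxE.
case: eqP => [E1|_]; last by rewrite mulr0.
by case/negP: iI; rewrite E1 enum_valP.
Qed.

Lemma row_mulE (mu : 'rV[R]_N) y : (mu *m W *m y) 0 0 = \sum_i mu 0 i * (W *m y) i 0.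
Proof. by rewrite -mulmxA mxE. Qed.

(** One direction is fixed for each edge [J]: the Cramer expansions at both ends of an edge must use
    the same vector for their terms to cancel. *)
Lemma exists_directions : exists D : {set 'I_N} -> 'cV[R]_m,
  forall J : {set 'I_N}, #|J|.+1 = m ->
    (forall j, j \in J -> (W *m D J) j 0 = 0) /\
    forall k, k \notin J -> `|col_minor W^T (k |: J)%SET| = `|(W *m D J) k 0|.
Proof.
suff /choice[D HD] : forall J : {set 'I_N}, exists D : 'cV[R]_m, #|J|.+1 = m ->
    (forall j, j \in J -> (W *m D) j 0 = 0) /\
    forall k, k \notin J -> `|col_minor W^T (k |: J)%SET| = `|(W *m D) k 0|.
  by exists D.
move=> J; have [h|h] := EM (#|J|.+1 = m); last by exists 0.
by have [D HD] := edge_direction W h; exists D.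
Qed.

End Bases.

Section Systems.
Context {R : realFieldType} {N m : nat}.
Variables (W : 'M[R]_(N, m)).
Implicit Types (I S : {set 'I_N}) (y : 'cV[R]_m) (eta : 'rV[R]_m) (c : 'cV[R]_N).

(** The basic solution of [I], unique when [I] is a basis; [0] is a default for inconsistent
    systems. *)
Definition bpoint c I : 'cV[R]_m :=
  xget 0 [set y | forall i, i \in I -> ell W c y i = 0].

Definition slack c I k : R := ell W c (bpoint c I) k.

Lemma ellE c y i : ell W c y i = (W *m y) i 0 + c i 0.
Proof. by rewrite /ell mxE. Qed.

Lemma ellD c y y' i : ell W c (y + y') i = ell W c y i + (W *m y') i 0.
Proof. by rewrite !ellE mulmxDr mxE addrAC. Qed.

Lemma mulmxZ_ent (p : nat) (M : 'M[R]_(N, p)) (t : R) (z : 'cV[R]_p) i :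
  (M *m (t *: z)) i 0 = t * (M *m z) i 0.
Proof. by rewrite -scalemxAr mxE. Qed.

Lemma mulmxN_ent (p : nat) (M : 'M[R]_(N, p)) (z : 'cV[R]_p) i :
  (M *m - z) i 0 = - (M *m z) i 0.
Proof. by rewrite mulmxN mxE. Qed.

Lemma slack_basis c I i : is_basis W I -> i \in I -> slack c I i = 0.
Proof.
move=> bI iI; rewrite /slack /bpoint.
have [y Hy] := basis_solve (fun i => - c i 0) bI.
case: xgetP => [z _ /(_ i iI) //|/(_ y) []] j jI /=.
by rewrite ellE Hy // addNr.
Qed.

Lemma bpoint_unique c I y : is_basis W I ->
  (forall i, i \in I -> ell W c y i = 0) -> y = bpoint c I.
Proof.
move=> bI y0; apply/eqP; rewrite -subr_eq0; apply/eqP.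
apply: (basis_spans bI) => i iI; apply/eqP.
have := slack_basis c bI iI; have := y0 i iI; rewrite /slack !ellE mulmxBr !mxE => *.
by apply/eqP; lra.
Qed.

Lemma slack_lin c c' t I k : is_basis W I ->
  slack (c + t *: c') I k = slack c I k + t * slack c' I k.
Proof.
move=> bI; rewrite /slack -(@bpoint_unique (c + t *: c') I (bpoint c I + t *: bpoint c' I)) //.
  by rewrite !ellE mulmxDr -scalemxAr !mxE; ring.
move=> i iI; rewrite ellE mulmxDr -scalemxAr [(c + _) i 0]mxE.
rewrite [X in X + _]mxE [X in _ + X + _]mxE [X in _ + (_ + X)]mxE.
transitivity ((W *m bpoint c I) i 0 + c i 0 + t * ((W *m bpoint c' I) i 0 + c' i 0)).
  by rewrite !mxE; ring.
by rewrite -[(W *m bpoint c I) i 0 + _]ellE -[(W *m bpoint c' I) i 0 + _]ellE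
  -!/(slack _ I i) !slack_basis // mulr0 addr0.
Qed.

(** Strictness makes the basis nondegenerate as well as feasible: the inequalities of [S] tight at
    its basic solution are exactly those of [I]. *)
Definition feasible S c I : bool :=
  [&& I \subset S, is_basis W I & [forall k in S :\: I, 0 < slack c I k]].

Lemma feasibleP S c I : reflect
  [/\ I \subset S, is_basis W I & forall k, k \in S -> k \notin I -> 0 < slack c I k]
  (feasible S c I).
Proof.
apply: (iffP and3P) => -[-> ->] h; split=> //.
  by move=> k kS kI; apply: (forall_inP h); rewrite inE kI.
by apply/forall_inP => k; rewrite inE => /andP[kI kS]; apply: h.
Qed.

Definition sat S c y : Prop := forall i, i \in S -> 0 <= ell W c y i.

(** Nondegeneracy of the feasible bases only. The base point [b1] of a cell has this property
    ([base_feasibly_simple]), while its infeasible bases may be degenerate. *)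
Definition feasibly_simple S c : Prop := forall I, I \subset S -> is_basis W I ->
  sat S c (bpoint c I) -> feasible S c I.

(** The ratio test of the simplex method: [t] is the least ratio at which a decreasing inequality
    becomes tight. *)
Lemma ratio_test S c y z : sat S c y -> (exists2 k, k \in S & (W *m z) k 0 < 0) ->
  exists k t, [/\ k \in S, (W *m z) k 0 < 0, ell W c (y + t *: z) k = 0,
    0 <= t & sat S c (y + t *: z)].
Proof.
move=> sy [k0 k0S k0z].
pose r k := ell W c y k / - (W *m z) k 0.
pose P k := (k \in S) && ((W *m z) k 0 < 0).
have Pk0 : P k0 by apply/andP.
case: (arg_minP r Pk0) => k /andP[kS kz] kmin.
have nz : (W *m z) k 0 != 0 by rewrite lt_eqF.
have rge : 0 <= r k by apply: divr_ge0; [exact: (sy _ kS)|rewrite oppr_ge0 ltW].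
exists k, (r k); split=> //.
  by rewrite ellD mulmxZ_ent /r invrN mulrN mulNr mulfVK // subrr.
move=> i iS; rewrite ellD mulmxZ_ent.
case: (ltP ((W *m z) i 0) 0) => iz; last exact: addr_ge0 (sy _ iS) (mulr_ge0 rge iz).
have : r k <= r i by apply: kmin; apply/andP.
by rewrite {2}/r ler_pdivlMr ?oppr_gt0 // mulrN lerNl -subr_ge0 opprK addrC.
Qed.

(** In a minimal spanning subset, removing an index leaves a nonzero common kernel vector, which can
    be scaled to be dual to that index. These vectors form a right inverse of the selected rows, so
    there are at most [m] of them. *)
Lemma spans_sub_basis S : spans W S -> exists2 I : {set 'I_N}, I \subset S & is_basis W I.
Proof.
pose P (G : {set 'I_N}) := `[< spans W G >].
move=> sS; have [G] := minset_exists (P := P) (introT (asboolP _) sS).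
case/minsetP => /asboolP sG Gmin GS; exists G => //.
apply: spans_basis (sG); apply/eqP; rewrite eqn_leq (spans_card sG) andbT.
have H (k : 'I_#|G|) : exists y, (W *m y) (enum_val k) 0 = 1 /\
    forall i, i \in G -> i != enum_val k -> (W *m y) i 0 = 0.
  set i0 := enum_val k; have i0G : i0 \in G := enum_valP k.
  have /existsNP[y] : ~ spans W (G :\ i0)%SET.
    move=> sp; have := Gmin _ (introT (asboolP _) sp) (finset.subsetDl _ _).
    by move/setP/(_ i0); rewrite !inE eqxx i0G.
  move=> /not_implyP[y0 yn0].
  have nz : (W *m y) i0 0 != 0.
    apply/eqP => z0; apply: yn0; apply: sG => i iG.
    by have [->//|ne] := eqVneq i i0; apply: y0; rewrite !inE ne.
  exists (((W *m y) i0 0)^-1 *: y); rewrite mulmxZ_ent mulVf //; split=> // i iG ne.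
  have iG' : i \in (G :\ i0)%SET by rewrite !inE ne.
  by rewrite mulmxZ_ent (y0 i iG') mulr0.
have [Y HY] := choice H.
pose M := rowsub (fun k : 'I_#|G| => enum_val k) W.
have : M *m (\matrix_(l, k) Y k l 0) = 1%:M.
  apply/matrixP => k l; rewrite [RHS]mxE.
  have -> : (M *m \matrix_(l0, k0) Y k0 l0 0) k l = (W *m Y l) (enum_val k) 0.
    by rewrite !mxE; apply: eq_bigr => a _; rewrite !mxE.
  have [<-|ne] := eqVneq k l; first by case: (HY k).
  by case: (HY l) => _; apply; [exact: enum_valP|rewrite (inj_eq enum_val_inj)].
move=> MY; have : row_free M by apply/row_freeP; exists (\matrix_(l, k) Y k l 0).
rewrite /row_free => /eqP <-; exact: rank_leq_col.
Qed.

(** As long as the tight inequalities do not span, a direction on which they vanish can be followed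
    until one more becomes tight; their number grows until the point is a basic solution. *)
Lemma exists_feasible S c y : feasibly_simple S c -> spans W S -> sat S c y ->
  exists I, feasible S c I.
Proof.
move=> nd spS.
pose T y := [set i in S | ell W c y i == 0]%SET.
have fin z : sat S c z -> spans W (T z) -> exists I, feasible S c I.
  move=> sz /spans_sub_basis[I IT bI]; exists I.
  have zE : z = bpoint c I.
    apply: bpoint_unique => // i /(fintype.subsetP IT).
    by rewrite inE => /andP[_ /eqP].
  apply: nd => //; last by rewrite -zE.
  by apply: fintype.subset_trans IT _; apply/fintype.subsetP => i; rewrite inE => /andP[].
move: {2}(#|S| - #|T y|)%N (leqnn (#|S| - #|T y|)%N) => n.
elim: n y => [|n IH] y Hn sy.
  apply: (fin y) => //.
  suff -> : T y = S by [].
  apply/eqP; rewrite eqEcard; move: Hn; rewrite leqn0 subn_eq0 => ->; rewrite andbT.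
  by apply/fintype.subsetP => i; rewrite inE => /andP[].
have [|/existsNP[z /not_implyP[z0 zn0]]] := EM (spans W (T y)); first exact: fin.
have /existsNP[k /not_implyP[kS /eqP kz]] : ~ forall k, k \in S -> (W *m z) k 0 = 0.
  by move=> h; apply: zn0; apply: spS.
wlog kneg : z z0 zn0 kz / (W *m z) k 0 < 0.
  move=> wl; case: (ltgtP ((W *m z) k 0) 0) => [|zp|/eqP]; last by rewrite (negPf kz).
    exact: wl.
  apply: (wl (- z)); rewrite ?mulmxN_ent ?oppr_eq0 ?oppr_lt0 //.
    by move=> i iT; rewrite mulmxN_ent z0 // oppr0.
  by apply/eqP; rewrite oppr_eq0; apply/eqP.
have [l [t [lS lz lt0 t0 st]]] := ratio_test sy (ex_intro2 _ _ k kS kneg).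
apply: IH st.
have lT : l \notin T y by apply: contraL lz => /z0 ->; rewrite ltxx.
have sub : (l |: T y)%SET \subset T (y + t *: z).
  apply/fintype.subsetP => i; rewrite in_setU1 => /orP[/eqP ->|iT].
    by rewrite inE lS lt0 eqxx.
  move: (iT); rewrite !inE => /andP[-> /eqP yi].
  by rewrite ellD mulmxZ_ent z0 // mulr0 addr0 yi eqxx.
have := subset_leq_card sub; rewrite cardsU1 lT /= => le1.
set y' := y + t *: z in sub le1 *; have le2 : (#|T y'| <= #|S|)%N.
  by apply: subset_leq_card; apply/fintype.subsetP => i; rewrite inE => /andP[].
by move: Hn le1 le2; rewrite add1n; move: #|S| #|T y| #|T y'|; lia.
Qed.

Lemma exchange_basis I i k (d : 'cV[R]_m) : is_basis W I -> i \in I -> k \notin I ->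
  (forall j, j \in I -> (W *m d) j 0 = (j == i)%:R) -> (W *m d) k 0 != 0 ->
  is_basis W (k |: (I :\ i))%SET.
Proof.
move=> bI iI kI dI dk; apply: spans_basis.
  have := cardsD1 i I; rewrite iI (card_basis bI) cardsU1 !inE (negPf kI) andbF /=.
  by move=> ->.
move=> u u0.
have uE : u = (W *m u) i 0 *: d.
  apply/eqP; rewrite -subr_eq0; apply/eqP; apply: (basis_spans bI) => j jI.
  rewrite mulmxBr mxE [X in _ + X]mxE mulmxZ_ent dI //.
  have [->|ne] := eqVneq j i; first by rewrite mulr1 subrr.
  by rewrite mulr0 subr0; apply: u0; rewrite !inE ne jI orbT.
have : (W *m u) k 0 = 0 by apply: u0; rewrite !inE eqxx.
rewrite uE mulmxZ_ent => /eqP; rewrite mulf_eq0 (negPf dk) orbF => /eqP ->.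
by rewrite scale0r.
Qed.

(* The witness minimises [eta] over the feasible bases. *)
Lemma feasible_cover S c y eta : feasibly_simple S c -> spans W S -> sat S c y ->
  in_cone W S eta -> exists2 I, feasible S c I & in_cone W I eta.
Proof.
move=> nd spS sy [nu [nu0 nuS nuE]].
have [I0 fI0] := exists_feasible nd spS sy.
case: (arg_minP (fun I => (eta *m bpoint c I) 0 0) fI0) => I fI Imin.
exists I => //; have /feasibleP[IS bI sI] := fI.
have [mu muI muE] := basis_coord eta bI.
exists mu; split=> // i; rewrite leNgt; apply/negP => mui.
have iI : i \in I by apply: contraLR mui => /muI ->; rewrite ltxx.
(* [d] leaves the basic solution along the edge that relaxes [i] alone; [eta] decreases along it at
   rate [mu 0 i < 0]. *)
have [d dI] := basis_solve (fun j => (j == i)%:R) bI.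
have etad : (eta *m d) 0 0 = mu 0 i.
  rewrite muE row_mulE (bigD1 i) //= dI // eqxx mulr1 big1 ?addr0 // => j ne.
  have [jI|/muI ->] := boolP (j \in I); last by rewrite mul0r.
  by rewrite dI // (negPf ne) mulr0.
have neg : exists2 k, k \in S & (W *m d) k 0 < 0.
  apply: contrapT => /forall2NP h.
  suff : 0 <= (eta *m d) 0 0 by rewrite etad leNgt mui.
  rewrite nuE row_mulE sumr_ge0 // => k _.
  have [/negP kS|/negP] := h k; first by rewrite nuS // mul0r.
  by rewrite -leNgt => ?; apply: mulr_ge0.
have ssI : sat S c (bpoint c I).
  move=> k kS; have [kI|kI] := boolP (k \in I); last exact/ltW/sI.
  by rewrite -/(slack c I k) slack_basis.
have [k [t [kS kd kt t0 st]]] := ratio_test ssI neg.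
have kI : k \notin I by apply: contraL kd => kI; rewrite dI // -leNgt.
(* Nondegeneracy rules out a step of length 0, so the exchanged basis is strictly better than the
   minimiser. *)
have tpos : 0 < t.
  rewrite lt0r t0 andbT; apply: contraTneq (sI k kS kI) => tE.
  by rewrite /slack -kt tE scale0r addr0 ltxx.
have bI' := exchange_basis bI iI kI dI (ltr0_neq0 kd).
set I' := (k |: I :\ i)%SET in bI'.
have I'S : I' \subset S.
  by rewrite finset.subUset finset.sub1set kS (fintype.subset_trans (finset.subsetDl _ _) IS).
have yE : bpoint c I + t *: d = bpoint c I'.
  apply: bpoint_unique => // j; rewrite !inE => /orP[/eqP -> //|/andP[ne jI]].
  by rewrite ellD mulmxZ_ent dI // (negPf ne) mulr0 addr0 -/(slack c I j) slack_basis.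
have fI' : feasible S c I' by apply: nd => //; rewrite -yE.
have := Imin _ fI'; rewrite -yE.
have -> : (eta *m (bpoint c I + t *: d)) 0 0 = (eta *m bpoint c I) 0 0 + t * mu 0 i.
  by rewrite mulmxDr -scalemxAr -etad mxE; congr (_ + _); rewrite mxE.
by rewrite -subr_ge0 addrAC subrr add0r pmulr_rge0 // leNgt mui.
Qed.

End Systems.

(** Induction on the generators. When the separator [z] of the tail is negative at the new generator
    [a], everything is projected along [a] onto the annihilator of [z]. A separator of the
    projections is corrected by a multiple of [z] to vanish at [a]; a combination of the projections
    lifts, and the signs of [z] make the coefficient of [a] nonnegative. *)
Lemma farkas (R : realFieldType) m (s : seq 'rV[R]_m) (b : 'rV[R]_m) :
  (exists2 la : nat -> R, (forall i, 0 <= la i) & b = \sum_(i < size s) la i *: s`_i) \/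
  (exists2 z : 'cV[R]_m, (forall a, a \in s -> 0 <= (a *m z) 0 0) & (b *m z) 0 0 < 0).
Proof.
move: {2}(size s) (erefl (size s)) => n; elim: n s b => [|n IH] s b.
  move/size0nil ->; have [->|bn0] := eqVneq b 0.
    by left; exists (fun=> 0) => //; rewrite big_ord0.
  right; exists (- b^T) => //; rewrite mulmxN mxE oppr_lt0 mxE.
  have /existsP[k bk] : [exists k, b 0 k != 0].
    apply: contra_neqT bn0; rewrite negb_exists => /forallP h.
    by apply/rowP => k; rewrite mxE; apply/eqP; have := h k; rewrite negbK.
  rewrite (bigD1 k) //= ltr_pwDl ?sumr_ge0 // => [|i _]; rewrite mxE -expr2 ?sqr_ge0 //.
  by rewrite exprn_even_gt0.
case: s => // a s [sn].
have [[la la0 ->]|[z sz bz]] := IH s b sn.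
  left; exists (fun i => if i is i'.+1 then la i' else 0); first by case.
  by rewrite /= big_ord_recl /= scale0r add0r; apply: eq_bigr.
have [az|az] := leP 0 ((a *m z) 0 0).
  by right; exists z => // x; rewrite inE => /orP[/eqP -> //|/sz].
have azn : (a *m z) 0 0 != 0 by rewrite lt_eqF.
pose pr (x : 'rV[R]_m) := x - ((x *m z) 0 0 / (a *m z) 0 0) *: a.
have [[la la0 bE]|[z' sz' bz']] := IH (map pr s) (pr b) (etrans (size_map _ _) sn).
  left.
  pose t := (b *m z) 0 0 / (a *m z) 0 0 -
    \sum_(i < size s) la i * ((s`_i *m z) 0 0 / (a *m z) 0 0).
  exists (fun i => if i is i'.+1 then la i' else t).
    case=> // ; rewrite /t subr_ge0; apply: (@le_trans _ _ 0).
      apply: sumr_le0 => i _; rewrite mulr_ge0_le0 // mulr_ge0_le0 ?sz ?mem_nth //.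
      by rewrite invr_le0 ltW.
    by rewrite mulr_le0 // ?invr_le0 ltW.
  rewrite /= big_ord_recl /= -[LHS](subrK (((b *m z) 0 0 / (a *m z) 0 0) *: a)) -/(pr b) bE.
  rewrite size_map /t scalerBl scaler_suml addrC -addrA; congr (_ + _).
  rewrite addrC -sumrN -big_split /=; apply: eq_bigr => i _.
  by rewrite (nth_map 0) // /pr scalerBr scalerA.
right; exists (z' - ((a *m z') 0 0 / (a *m z) 0 0) *: z).
  have prE x : (x *m (z' - ((a *m z') 0 0 / (a *m z) 0 0) *: z)) 0 0 = (pr x *m z') 0 0.
    by rewrite mulmxBr mulmxBl -scalemxAr -scalemxAl !mxE; ring.
  move=> x; rewrite inE => /orP[/eqP ->|xs].
    by rewrite prE /pr divff // scale1r subrr mul0mx mxE.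
  by rewrite prE; apply: sz'; apply: map_f.
suff -> : (b *m (z' - ((a *m z') 0 0 / (a *m z) 0 0) *: z)) 0 0 = (pr b *m z') 0 0 by [].
by rewrite mulmxBr mulmxBl -scalemxAr -scalemxAl !mxE; ring.
Qed.

(** * Triangulations of a simplicial cone *)

(* Endpoints of a segment given by inequalities [0 <= s l + x * al l]; those to
   the left of [0] cancel in sign unless [0] is in the segment. *)
Lemma endpoints_count (R : realFieldType) (I : finType) (X : {set I}) (s al : I -> R)
    (t := fun i => - s i / al i)
    (fs := fun i => (al i != 0) && [forall l in X :\ i, 0 < s l + t i * al l]) :
  (forall l, l \in X -> s l != 0) ->
  (forall i l, i \in X -> l \in X -> l != i -> al i != 0 -> s l + t i * al l != 0) ->
  (exists2 l, l \in X & 0 < al l) ->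
  \sum_(i in X | fs i && (t i < 0)) Num.sg (al i) =
  if [forall l in X, 0 < s l] then 1 else 0.
Proof.
move=> s0 gen [l1 l1X al1].
have fac l x : al l != 0 -> s l + x * al l = al l * (x - t l).
  by move=> al0; rewrite /t; field.
have posP l x : 0 < al l -> (0 < s l + x * al l) = (t l < x).
  by move=> p; rewrite fac ?gt_eqF // pmulr_rgt0 // subr_gt0.
have posN l x : al l < 0 -> (0 < s l + x * al l) = (x < t l).
  by move=> p; rewrite fac ?lt_eqF // nmulr_rgt0 // subr_lt0.
have tne i l : i \in X -> l \in X -> l != i -> al i != 0 -> al l != 0 -> t i != t l.
  move=> iX lX li ai al0; have := gen i l iX lX li ai.
  by rewrite fac // mulf_eq0 (negPf al0) /= subr_eq0.
have fsP i l : fs i -> l \in X -> l != i -> 0 < s l + t i * al l.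
  by case/andP => _ /forall_inP h lX li; apply: h; rewrite !inE li lX.
pose Pp i := (i \in X) && (0 < al i).
have Pl1 : Pp l1 by apply/andP.
(* The largest of the lower bounds [t l], [al l > 0]: the only possible endpoint with positive
   coefficient. *)
case: (arg_maxP t Pl1) => lo /andP[loX allo] lomax0.
have lomax l : l \in X -> 0 < al l -> t l <= t lo by move=> lX al0; apply: lomax0; exact/andP.
have lomax' l : l \in X -> 0 < al l -> l != lo -> t l < t lo.
  move=> lX all lne; rewrite lt_neqAle lomax // andbT.
  by apply: tne; rewrite ?gt_eqF // eq_sym.
have fslo i : i \in X -> fs i -> 0 < al i -> i = lo.
  move=> iX fi ai; apply/eqP; apply: contraT => ne.
  have := fsP i lo fi loX; rewrite eq_sym ne posP // => /(_ isT).
  by rewrite ltNge lomax.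
case: ifP => [/forall_inP spos|/negbT].
  rewrite (big_pred1 lo) ?gtr0_sg // => i; rewrite /= /in_mem /=.
  have tlo : t lo < 0 by rewrite /t mulNr oppr_lt0 divr_gt0 // spos.
  apply/andP/eqP => [[iX /andP[fi ti]]|->].
    apply: fslo => //; rewrite ltNge; apply/negP => ai.
    have ai0 : al i != 0 by case/andP: fi.
    move: ti; rewrite ltNge; apply/negP; rewrite negbK.
    by rewrite /t mulNr oppr_ge0 pmulr_rle0 ?spos // invr_le0.
  split=> //; rewrite tlo andbT /fs gt_eqF //=; apply/forall_inP => l.
  rewrite !inE => /andP[ne lX]; case: (ltP 0 (al l)) => al0.
    by rewrite posP // lomax'.
  by rewrite ltr_wpDr ?spos // mulr_le0 // ltW.
rewrite negb_forall => /existsP[l0]; rewrite negb_imply -leNgt => /andP[l0X sl0].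
have {}sl0 : s l0 < 0 by rewrite lt_neqAle sl0 s0.
(* Now [0] violates the inequality [l0]. If some endpoint lies to the left of [0], then [l0] bounds
   the segment above by a negative number, so both endpoints are counted, with opposite signs. *)
have [->|[i0 i0X /andP[fi0 ti0]]] : 
    \sum_(i in X | fs i && (t i < 0)) Num.sg (al i) = 0 \/
    exists2 i, i \in X & fs i && (t i < 0).
- have [|no] := EM (exists2 i, i \in X & fs i && (t i < 0)); first by right.
  by left; rewrite big1 // => i /andP[iX h]; case: no; exists i.
- by [].
have al0neg : al l0 < 0.
  rewrite ltNge; apply/negP => al0; have [E|ne] := eqVneq l0 i0.
    move: ti0; rewrite -E ltNge /t mulNr oppr_ge0 nmulr_rle0 // invr_ge0 al0 //.
  have := fsP _ _ fi0 l0X ne; rewrite ltNge; apply/negP; rewrite negbK.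
  have := mulr_le0_ge0 (ltW ti0) al0; lra.
pose Pn i := (i \in X) && (al i < 0).
have Pl0 : Pn l0 by apply/andP.
case: (arg_minP t Pl0) => hi /andP[hiX alhi] himin0.
have himin l : l \in X -> al l < 0 -> t hi <= t l by move=> lX al0; apply: himin0; exact/andP.
have himin' l : l \in X -> al l < 0 -> l != hi -> t hi < t l.
  move=> lX all lne; rewrite lt_neqAle himin // andbT.
  by apply: tne; rewrite ?lt_eqF.
have fshi i : i \in X -> fs i -> al i < 0 -> i = hi.
  move=> iX fi ai; apply/eqP; apply: contraT => ne.
  have := fsP i hi fi hiX; rewrite eq_sym ne posN // => /(_ isT).
  by rewrite ltNge himin.
have lohi : lo != hi by apply: contraTneq allo => ->; rewrite -leNgt ltW.
have thi : t hi < 0.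
  apply: (@le_lt_trans _ _ (t l0)); first exact: himin.
  by rewrite /t mulNr oppr_lt0 nmulr_rgt0 // invr_lt0.
have zp l : l \in X -> al l = 0 -> 0 < s l.
  move=> lX all; have := fsP _ _ fi0 lX; rewrite all mulr0 addr0; apply.
  by apply: contraTneq fi0 => <-; rewrite /fs all eqxx.
have tlh : t lo < t hi.
  have [ai|ai|ai] := ltgtP (al i0) 0.
  - by move: (fsP _ lo fi0 loX); rewrite (fshi i0) // posP //; apply.
  - by move: (fsP _ hi fi0 hiX); rewrite (fslo i0) // posN // eq_sym; apply.
  - by case/andP: fi0; rewrite ai eqxx.
have flo : fs lo.
  rewrite /fs gt_eqF //=; apply/forall_inP => l; rewrite !inE => /andP[ne lX].
  case: (ltgtP (al l) 0) => al0; last by rewrite al0 mulr0 addr0 zp.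
    rewrite posN //; apply: lt_le_trans tlh _; exact: himin.
  by rewrite posP // lomax'.
have fhi : fs hi.
  rewrite /fs lt_eqF //=; apply/forall_inP => l; rewrite !inE => /andP[ne lX].
  case: (ltgtP (al l) 0) => al0; last by rewrite al0 mulr0 addr0 zp.
    by rewrite posN // himin'.
  rewrite posP //; apply: le_lt_trans tlh; exact: lomax.
rewrite (eq_bigl (fun i => i \in [set lo; hi]%SET)); last first.
  move=> i; rewrite !inE; apply/andP/orP => [[iX /andP[fi ti]]|[/eqP ->|/eqP ->]].
  - have [ai|ai|ai] := ltgtP (al i) 0.
    + by right; rewrite (fshi i).
    + by left; rewrite (fslo i).
    + by case/andP: fi; rewrite ai eqxx.
  - by rewrite loX flo (lt_trans tlh).
  - by rewrite hiX fhi thi.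
by rewrite big_setU1 ?inE //= big_set1 gtr0_sg // ltr0_sg // subrr.
Qed.

Section SimplicialCone.
Context {R : realFieldType} {N m : nat}.
Variables (W : 'M[R]_(N, m)) (c : 'cV[R]_N).
Implicit Types (I J S : {set 'I_N}).

Definition generic S : Prop := forall I k, I \subset S -> is_basis W I ->
  k \in S -> k \notin I -> slack W c I k != 0.

Lemma genericS S S' : S \subset S' -> generic S' -> generic S.
Proof.
move=> /fintype.subsetP SS' g I k IS bI kS kI; apply: g => //; last exact: SS'.
by apply: fintype.subset_trans IS _; apply/fintype.subsetP.
Qed.

Lemma generic_feasibly_simple S : generic S -> feasibly_simple W S c.
Proof.
move=> g I IS bI sI; apply/feasibleP; split=> // k kS kI.
by rewrite lt0r (g I k) //; exact: (sI _ kS).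
Qed.

Variable D : {set 'I_N} -> 'cV[R]_m.
Hypothesis HD : forall J : {set 'I_N}, #|J|.+1 = m ->
  (forall j, j \in J -> (W *m D J) j 0 = 0) /\
  forall k, k \notin J -> `|col_minor W^T (k |: J)%SET| = `|(W *m D J) k 0|.

(** The identities are wanted at complex points, but also at a real one, where the signs of their
    terms carry information; hence an arbitrary ring [L] under [R]. *)
Variables (L : comNzRingType) (phi : {rmorphism R -> L}) (zv : 'cV[L]_m).
Let z i : L := (map_mx phi W *m zv) i 0.

Lemma coord_row (mu : 'rV[R]_N) k : row k W = mu *m W ->
  z k = \sum_i phi (mu 0 i) * z i.
Proof.
move=> E; rewrite /z.
transitivity ((map_mx phi (row k W) *m zv) 0 0).
  by rewrite !mxE; apply: eq_bigr => i _; rewrite !mxE.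
rewrite E map_mxM -mulmxA mxE; apply: eq_bigr => i _; by rewrite !mxE.
Qed.

(** Row [k] is written on the basis and paired with the edge direction of [I :\ i], which kills
    every row of [I] except [i]. This gives the coefficient of row [i], whose denominator cancels
    against the minor up to sign. *)
Lemma cramer I k : is_basis W I ->
  phi `|col_minor W^T I| * z k = \sum_(i in I)
    phi (Num.sg ((W *m D (I :\ i)%SET) i 0) * (W *m D (I :\ i)%SET) k 0) * z i.
Proof.
move=> bI; have [mu muI muE] := basis_coord (row k W) bI.
rewrite (coord_row muE) mulr_sumr [LHS](bigID (mem I)) /= [X in _ + X]big1 ?addr0; last first.
  by move=> i /muI ->; rewrite rmorph0 mul0r mulr0.
apply: eq_bigr => i iI; rewrite mulrA -rmorphM /=; congr (phi _ * _).
have cJ : #|(I :\ i)%SET|.+1 = m by rewrite -(card_basis bI) (cardsD1 i I) iI.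
have [DJ Dm] := HD cJ.
have := Dm i; rewrite finset.setD1K // !inE eqxx => ->//.
have -> : (W *m D (I :\ i)%SET) k 0 = mu 0 i * (W *m D (I :\ i)%SET) i 0.
  transitivity ((row k W *m D (I :\ i)%SET) 0 0).
    by rewrite !mxE; apply: eq_bigr => a _; rewrite !mxE.
  rewrite muE row_mulE (bigD1 i) //= big1 ?addr0 // => j ne.
  have [jI|/muI ->] := boolP (j \in I); last by rewrite mul0r.
  by rewrite DJ ?mulr0 // !inE ne.
by rewrite normrEsg; ring.
Qed.

(** On the line of the edge [J], oriented so that the inequality [k] increases, the parameter is 0
    at the hyperplane of [k], and the ends with negative slack at [k] are those at negative
    parameters. By [endpoints_count] their signs add up to 1 if the crossing point is feasible and
    to 0 otherwise. *)
Lemma edge_count S J k : J \subset S -> k \notin S -> #|J|.+1 = m ->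
  generic (k |: S)%SET -> in_cone W S (row k W) ->
  (W *m D J) k 0 * \sum_(i in (S :\: J)%SET |
      feasible W S c (i |: J)%SET && (slack W c (i |: J)%SET k < 0))
    Num.sg ((W *m D J) i 0) =
  if feasible W (k |: S)%SET c (k |: J)%SET then `|col_minor W^T (k |: J)%SET| else 0.
Proof.
move=> JS kS cJ gen [mu [mu0 muS muE]].
have [DJ Dm] := HD cJ.
have kJ : k \notin J by apply: contra kS; apply/fintype.subsetP.
have basE i : i \notin J -> is_basis W (i |: J)%SET = ((W *m D J) i 0 != 0).
  by move=> iJ; rewrite /is_basis cardsU1 iJ add1n cJ eqxx -normr_eq0 Dm // normr_eq0.
have [k0|k0] := eqVneq ((W *m D J) k 0) 0.
  by rewrite k0 mul0r; case: ifP => // /feasibleP[_]; rewrite basE // k0 eqxx.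
pose sk := Num.sg ((W *m D J) k 0).
pose D' := sk *: D J.
pose al i := (W *m D') i 0.
have alE i : al i = sk * (W *m D J) i 0 by rewrite /al mulmxZ_ent.
have ak : 0 < al k by rewrite alE /sk -normrEsg normr_gt0.
have sk0 : sk != 0 by apply: contraTneq ak; rewrite alE => ->; rewrite mul0r ltxx.
have al0 i : (al i == 0) = ((W *m D J) i 0 == 0) by rewrite alE mulf_eq0 (negPf sk0).
have bk : is_basis W (k |: J)%SET by rewrite basE.
pose s l := slack W c (k |: J)%SET l.
pose t i := - s i / al i.
have pE i : i \notin J -> al i != 0 ->
    bpoint W c (i |: J)%SET = bpoint W c (k |: J)%SET + t i *: D'.
  move=> iJ ai; apply/esym/bpoint_unique; first by rewrite basE // -al0.
  move=> j; rewrite ellD mulmxZ_ent -/(al j) -/(s j) in_setU1 => /orP[/eqP ->|jJ].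
    by rewrite /t divfK // subrr.
  rewrite -/(slack W c (k |: J)%SET j) slack_basis // ?in_setU1 ?jJ ?orbT // alE DJ //; ring.
have sE i l : i \notin J -> al i != 0 -> slack W c (i |: J)%SET l = s l + t i * al l.
  by move=> iJ ai; rewrite /slack pE // ellD mulmxZ_ent.
have sk_0 : s k = 0 by rewrite /s slack_basis // setU11.
have kJS : (k |: J)%SET \subset (k |: S)%SET by rewrite finset.setUS.
have in_X i : (i \in (S :\: J)%SET) -> i \in S /\ i \notin J by rewrite inE => /andP[].
have iJS i : i \in S -> (i |: J)%SET \subset S.
  by move=> iS; rewrite finset.subUset finset.sub1set iS.
have in_DU i l : (l \in (S :\: J) :\ i)%SET = (l \in S :\: (i |: J))%SET.
  by rewrite !inE negb_or; case: (l == i) => //=; case: (l \in J).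
pose fs i := (al i != 0) && [forall l in ((S :\: J) :\ i)%SET, 0 < s l + t i * al l].
have fsE i : i \in (S :\: J)%SET -> fs i = feasible W S c (i |: J)%SET.
  case/in_X => iS iJ; rewrite /fs /feasible iJS //= basE // -al0.
  have [//|ai] := boolP (al i == 0); apply: eq_forallb => l.
  by rewrite in_DU sE.
have cnt : \sum_(i in (S :\: J)%SET | fs i && (t i < 0)) Num.sg (al i) =
    if [forall l in (S :\: J)%SET, 0 < s l] then 1 else 0.
  apply: endpoints_count.
  - move=> l /in_X[lS lJ]; apply: gen => //; rewrite !inE ?lS ?orbT //.
    by rewrite negb_or lJ andbT; apply: contraTneq lS => ->.
  - move=> i l /in_X[iS iJ] /in_X[lS lJ] li ai; rewrite -sE //; apply: gen.
    + by apply: fintype.subset_trans (finset.subsetUr _ _); exact: iJS.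
    + by rewrite basE // -al0.
    + by rewrite inE lS orbT.
    + by rewrite !inE negb_or li.
  (* If no inequality of [S :\: J] increased along [D'], neither would [k], whose row is a
     nonnegative combination of rows of [S]. *)
  - apply: contrapT => /forall2NP h.
    suff : al k <= 0 by rewrite leNgt ak.
    have -> : al k = (row k W *m D') 0 0.
      by rewrite /al !mxE; apply: eq_bigr => a _; rewrite !mxE.
    rewrite muE row_mulE sumr_le0 // => l _.
    have [lS|/muS ->] := boolP (l \in S); last by rewrite mul0r.
    have [lJ|lJ] := boolP (l \in J).
      by rewrite -/(al l) alE DJ // !mulr0.
    apply: mulr_ge0_le0 => //; have [/negP|/negP] := h l; first by rewrite inE lJ lS.
    by rewrite -leNgt.
have -> : feasible W (k |: S)%SET c (k |: J)%SET = [forall l in (S :\: J)%SET, 0 < s l].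
  rewrite /feasible kJS bk /=; apply: eq_forallb => l; congr (_ ==> _).
  rewrite !inE negb_or; have [->|] := eqVneq l k; first by rewrite (negPf kS) andbF.
  by [].
rewrite Dm // (eq_bigl (fun i => (i \in S :\: J)%SET && (fs i && (t i < 0)))); last first.
  move=> i; case iX: (i \in (S :\: J)%SET) => //=; rewrite -fsE //.
  case fi: (fs i) => //=; have [iS iJ] := in_X _ iX; case/andP: fi => ai _.
  by rewrite sE // sk_0 add0r pmulr_llt0.
have -> : \sum_(i in (S :\: J)%SET | fs i && (t i < 0)) Num.sg ((W *m D J) i 0) =
    sk * \sum_(i in (S :\: J)%SET | fs i && (t i < 0)) Num.sg (al i).
  rewrite mulr_sumr; apply: eq_bigr => i _.
  by rewrite alE sgrM /sk sgr_id mulrA -expr2 sqr_sg k0 mul1r.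
rewrite cnt mulrA [_ * sk]mulrC -normrEsg; case: ifP; by rewrite ?mulr1 ?mulr0.
Qed.

(** Bases with a marked element are the same as edges with a marked end. *)
Lemma big_flag (F : {set 'I_N} -> 'I_N -> L) (P : {set 'I_N} -> bool) :
  \sum_(I | P I) \sum_(i in I) F (I :\ i)%SET i =
  \sum_(J : {set 'I_N}) \sum_(i | (i \notin J) && P (i |: J)%SET) F J i.
Proof.
rewrite (exchange_big_dep predT) //= [RHS](exchange_big_dep predT) //=.
apply: eq_bigr => i _.
rewrite (reindex_onto (fun J => i |: J)%SET (fun I => I :\ i)%SET) /=; last first.
  by move=> I /andP[_ iI]; rewrite finset.setD1K.
apply: eq_big => J.
  rewrite setU11 andbT andbC; congr (_ && _).
  apply/eqP/idP => [<-|iJ]; first by rewrite !inE eqxx.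
  by rewrite finset.setU1K.
by move=> /andP[_ /eqP ->].
Qed.

(** [cramer] expands each removed basis over its edges [J = I :\ i]. The factor [z i] completes the
    product over [S :\: I] to the one over [S :\: J], so a term depends on the end [i] only through
    a sign, and [edge_count] sums these signs. *)
Lemma cut_identity S k : k \notin S -> generic (k |: S)%SET -> in_cone W S (row k W) ->
  z k * \sum_(I | feasible W S c I && (slack W c I k < 0))
    phi `|col_minor W^T I| * \prod_(i in (S :\: I)%SET) z i =
  \sum_(J : {set 'I_N} | (k \notin J) && feasible W (k |: S)%SET c (k |: J)%SET)
    phi `|col_minor W^T (k |: J)%SET| * \prod_(i in (S :\: J)%SET) z i.
Proof.
move=> kS gen ck.
pose F J i := phi (Num.sg ((W *m D J) i 0) * (W *m D J) k 0) *
  \prod_(j in (S :\: J)%SET) z j.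
transitivity (\sum_(I | feasible W S c I && (slack W c I k < 0))
    \sum_(i in I) F (I :\ i)%SET i).
  rewrite mulr_sumr; apply: eq_bigr => I /andP[/feasibleP[IS bI _] _].
  rewrite mulrA [z k * _]mulrC cramer // mulr_suml; apply: eq_bigr => i iI.
  rewrite /F -mulrA; congr (_ * _).
  have iX : i \in (S :\: (I :\ i))%SET by rewrite !inE eqxx (fintype.subsetP IS).
  rewrite [RHS](big_setD1 i iX) /=; congr (_ * _); apply: eq_bigl => j.
  by rewrite !inE; have [->|] := eqVneq j i; rewrite ?iI.
rewrite big_flag.
pose P (J : {set 'I_N}) := (J \subset S) && (#|J|.+1 == m).
rewrite (bigID P) /= [X in _ + X]big1 ?addr0; last first.
  move=> J /negP nP; rewrite big1 // => i /andP[iJ /andP[/feasibleP[iJS bi _] _]].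
  case: nP; apply/andP; split; last by rewrite -(card_basis bi) cardsU1 iJ.
  by apply: fintype.subset_trans iJS; exact: finset.subsetUr.
rewrite [RHS](bigID P) /= [X in _ = _ + X]big1 ?addr0; last first.
  move=> J /andP[/andP[kJ /feasibleP[kJS bk _]] /negP[]].
  apply/andP; split; last by rewrite -(card_basis bk) cardsU1 kJ.
  apply/fintype.subsetP => j jJ; have := fintype.subsetP kJS j.
  rewrite !inE jJ orbT => /(_ isT) /orP[/eqP jk|//].
  by rewrite -jk jJ in kJ.
rewrite [RHS]big_mkcondl /=.
have E J : P J -> k \notin J by case/andP => /fintype.subsetP JS _; apply: contra kS; exact: JS.
rewrite [RHS](eq_bigr (fun J => if feasible W (k |: S)%SET c (k |: J)%SET then
   phi `|col_minor W^T (k |: J)%SET| * \prod_(i in (S :\: J)%SET) z i else 0)); last first.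
  by move=> J /E ->.
apply: eq_bigr => J /andP[JS /eqP cJ].
rewrite /F -mulr_suml -(rmorph_sum phi) -mulr_suml.
have -> : (if feasible W (k |: S)%SET c (k |: J)%SET then
   phi `|col_minor W^T (k |: J)%SET| * \prod_(i in (S :\: J)%SET) z i else 0) =
  phi (if feasible W (k |: S)%SET c (k |: J)%SET then `|col_minor W^T (k |: J)%SET| else 0) *
   \prod_(i in (S :\: J)%SET) z i by case: ifP; rewrite // rmorph0 mul0r.
congr (phi _ * _); rewrite -edge_count // mulrC; congr (_ * _).
apply: eq_bigl => i; rewrite inE; case: (i \in J) => //=.
case fi: (feasible _ _ _ _); rewrite ?andbF //=; case/feasibleP: fi => iJS _ _.
by rewrite (fintype.subsetP iJS) // setU11.
Qed.

Lemma feasible_addU S k I : k \notin S -> generic (k |: S)%SET ->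
  feasible W (k |: S)%SET c I && (k \notin I) =
  feasible W S c I && (0 < slack W c I k).
Proof.
move=> kS gen; apply/andP/andP => [[/feasibleP[IS bI sI] kI]|[/feasibleP[IS bI sI] kp]].
  split; last by apply: sI; rewrite ?setU11.
  apply/feasibleP; split=> // [|l lS lI]; last by apply: sI; rewrite // inE lS orbT.
  apply/fintype.subsetP => l lI; have := fintype.subsetP IS l lI.
  by rewrite !inE => /orP[/eqP lk|//]; rewrite lk (negPf kI) in lI.
split; last by apply: contra kS; exact: (fintype.subsetP IS).
apply/feasibleP; split=> //; first by apply: fintype.subset_trans IS (finset.subsetUr _ _).
by move=> l; rewrite !inE => /orP[/eqP -> //|]; exact: sI.
Qed.

Lemma simplicial_identity I0 S : is_basis W I0 -> I0 \subset S ->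
  (forall k, k \in S -> in_cone W I0 (row k W)) -> generic S ->
  \sum_(I | feasible W S c I) phi `|col_minor W^T I| * \prod_(i in (S :\: I)%SET) z i =
  phi `|col_minor W^T I0| * \prod_(i in (S :\: I0)%SET) z i.
Proof.
move=> bI0; move: {2}(#|S :\: I0|)%N (erefl (#|S :\: I0|)%N) => n.
elim: n S => [|n IH] S.
  move/eqP; rewrite cards_eq0 finset.setD_eq0 => SI I0S _ _.
  have {SI I0S} -> : S = I0 by apply/eqP; rewrite finset.eqEsubset SI.
  apply: big_pred1 => I /=; apply/idP/eqP => [/feasibleP[II0 bI _]|->].
    by apply/eqP; rewrite eqEcard II0 (card_basis bI) (card_basis bI0) leqnn.
  by apply/feasibleP; split=> // k ->.
move=> cS; have /card_gt0P[k] : (0 < #|S :\: I0|)%N by rewrite cS.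
rewrite inE => /andP[kI0 kS] I0S cone gen.
set S' := (S :\ k)%SET.
have SE : S = (k |: S')%SET by rewrite finset.setD1K.
have kS' : k \notin S' by rewrite !inE eqxx.
have I0S' : I0 \subset S' by rewrite subsetD1 I0S.
have genS : generic (k |: S')%SET by rewrite -SE.
have IHS : \sum_(I | feasible W S' c I) phi `|col_minor W^T I| * \prod_(i in (S' :\: I)%SET) z i =
  phi `|col_minor W^T I0| * \prod_(i in (S' :\: I0)%SET) z i.
  apply: IH => //; first last.
  - exact: genericS (finset.subsetUr _ _) genS.
  - by move=> l lS; apply: cone; move: lS; rewrite !inE => /andP[].
  - have := cardsD1 k (S :\: I0)%SET; rewrite cS !inE kI0 kS add1n => -[->].
    by congr #|pred_of_set _|; apply/setP => l; rewrite !inE andbCA.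
have ckS : in_cone W S' (row k W).
  have [mu [mu0 muI muE]] := cone k kS; exists mu; split=> // i iS'; apply: muI.
  by apply: contra iS'; exact: (fintype.subsetP I0S').
have prodk I : k \notin I ->
    \prod_(i in (S :\: I)%SET) z i = z k * \prod_(i in (S' :\: I)%SET) z i.
  move=> kI; rewrite (big_setD1 k) /= ?inE ?kI //; congr (_ * _).
  by apply: eq_bigl => l; rewrite !inE andbCA.
(* The bases avoiding [k] are those of [S'] with positive slack at [k]; the bases using [k] make up,
   by [cut_identity], for those with negative slack. *)
rewrite prodk // mulrCA -IHS (bigID (fun I => k \in I)) /= addrC.
rewrite [X in z k * X](bigID (fun I => 0 < slack W c I k)) /= mulrDr.
congr (_ + _).
  rewrite mulr_sumr SE; apply: eq_big => I; first exact: feasible_addU.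
  by move=> /andP[_ kI]; rewrite -SE prodk // mulrCA.
rewrite [X in _ = z k * X](eq_bigl (fun I => feasible W S' c I && (slack W c I k < 0))); last first.
  move=> I; case fI: (feasible _ _ _ _) => //=; case/feasibleP: fI => IS bI _.
  rewrite -leNgt le_eqVlt (negPf (genS I k _ bI _ _)) ?setU11 //.
    exact: fintype.subset_trans IS (finset.subsetUr _ _).
  by apply: contra kS'; exact: (fintype.subsetP IS).
rewrite cut_identity // -SE.
rewrite (reindex_onto (fun J => k |: J)%SET (fun I => I :\ k)%SET) /=; last first.
  by move=> I /andP[_ iI]; rewrite finset.setD1K.
apply: eq_big => J.
  rewrite setU11 andbT andbC; congr (_ && _).
  apply/eqP/idP => [<-|iJ]; first by rewrite !inE eqxx.
  by rewrite finset.setU1K.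
move=> /andP[_ /eqP E]; congr (_ * _); apply: eq_bigl => l.
have kJ : k \notin J by rewrite -E !inE eqxx.
by rewrite !inE negb_or; have [->|] := eqVneq l k; rewrite // kJ.
Qed.

End SimplicialCone.

(** The products see only [F], so the inequalities of [Z] outside [F] have to be dropped without
    changing the feasible bases. Adding such a [k] back creates no basis, since feasible bases stay
    inside [F]; then [cut_identity] at the real point [p], where every term is positive, leaves no
    basis to be cut off. *)
Lemma simplicial_cone_identity (R : realFieldType) N m (W : 'M[R]_(N, m)) c
    (I0 F Z : {set 'I_N}) (p : 'cV[R]_m) (L : comNzRingType)
    (phi : {rmorphism R -> L}) (zv : 'cV[L]_m) :
  is_basis W I0 -> I0 \subset F -> F \subset Z ->
  (forall k, k \in Z -> in_cone W I0 (row k W)) -> generic W c Z ->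
  (forall k, k \in Z -> 0 < (W *m p) k 0) ->
  (forall I, feasible W Z c I -> I \subset F) ->
  \sum_(I | feasible W Z c I)
    phi `|col_minor W^T I| * \prod_(i in (F :\: I)%SET) (map_mx phi W *m zv) i 0 =
  phi `|col_minor W^T I0| * \prod_(i in (F :\: I0)%SET) (map_mx phi W *m zv) i 0.
Proof.
move=> bI0 I0F FZ cone gen pos sub.
have [D HD] := exists_directions W.
rewrite -(simplicial_identity (c := c) HD) //; last first.
- exact: genericS FZ gen.
- by move=> k /(fintype.subsetP FZ); exact: cone.
suff H : forall n S, (#|Z :\: S| = n)%N -> F \subset S -> S \subset Z ->
    feasible W S c =1 feasible W Z c.
  by apply: eq_bigl => I; rewrite (H _ F erefl).
elim=> [|n IH] S.
  move/eqP; rewrite cards_eq0 finset.setD_eq0 => SI _ ZS.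
  by have -> : S = Z by apply/eqP; rewrite finset.eqEsubset SI ZS.
move=> cS FS SZ; have /card_gt0P[k] : (0 < #|Z :\: S|)%N by rewrite cS.
rewrite inE => /andP[kS kZ].
have kSZ : (k |: S)%SET \subset Z by rewrite finset.subUset finset.sub1set kZ.
have genS : generic W c (k |: S)%SET by apply: genericS gen.
have FkS : F \subset (k |: S)%SET by exact: fintype.subset_trans FS (finset.subsetUr _ _).
have IHk : feasible W (k |: S)%SET c =1 feasible W Z c.
  apply: IH => //; have := cardsD1 k (Z :\: S)%SET; rewrite cS !inE kS kZ add1n => -[->].
  by congr #|pred_of_set _|; apply/setP => l; rewrite !inE negb_or andbA.
have nok I : feasible W (k |: S)%SET c I -> k \notin I.
  rewrite IHk => /sub /fintype.subsetP IF; apply: contra kS => /IF.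
  exact: (fintype.subsetP FS).
have ckS : in_cone W S (row k W).
  have [mu [mu0 muI muE]] := cone k kZ; exists mu; split=> // i iS; apply: muI.
  by apply: contra iS => /(fintype.subsetP I0F); exact: (fintype.subsetP FS).
have mid : map_mx (@idfun R) W = W by apply/matrixP => a b; rewrite mxE.
have posS i : i \in S -> 0 < (map_mx (@idfun R) W *m p) i 0.
  by move=> iS; rewrite mid; apply: pos; exact: (fintype.subsetP SZ).
have := cut_identity (c := c) HD idfun p kS genS ckS.
rewrite [RHS]big1; last by move=> J /andP[_ /nok]; rewrite setU11.
move/eqP; rewrite mulf_eq0 mid gt_eqF ?pos //=.
rewrite psumr_eq0; last first.
  move=> I _; apply: mulr_ge0 => //; apply: prodr_ge0 => i.
  by rewrite inE => /andP[_ /posS]; rewrite mid => /ltW.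
move/allP => noc I.
have nocut : feasible W S c I -> 0 < slack W c I k.
  move=> fI; have /feasibleP[IS bI _] := fI.
  have sn0 : slack W c I k != 0.
    apply: genS bI _ _; rewrite ?setU11 //; last by apply: contra kS; exact: (fintype.subsetP IS).
    exact: fintype.subset_trans IS (finset.subsetUr _ _).
  rewrite lt0r sn0 leNgt; apply/negP => sneg.
  have := noc I (mem_index_enum _); rewrite fI sneg /=; apply/negP.
  rewrite mulf_neq0 ?normr_eq0 //; first by case/andP: bI.
  apply/prodf_neq0 => i; rewrite inE => /andP[_ iS].
  by have := posS i iS; rewrite mid => h; rewrite gt_eqF.
have := feasible_addU (c := c) I kS genS; rewrite -IHk.
case fk : (feasible W (k |: S)%SET c I); case fS : (feasible W S c I) => //=.
  by rewrite (nok _ fk).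
by rewrite nocut.
Qed.

(** * Affine parametrization of the fibers *)

Section KernelBasis.
Context {R : realType} {d m : nat}.
Variables (A : 'M[R]_(d, d + m)) (B : 'M[R]_(d + m, m)).
Hypothesis B_ker : kernel_basis A B.
Local Notation T := (col_mx A B^T).
Local Notation W := (Qnormals A B).
Local Notation Lc := (lsubmx (Qinv A B)).

Lemma mul_kernel_basis : A *m B = 0.
Proof.
have /sub_kermxP : (B^T <= kermx A^T)%MS by case: B_ker => _ ->.
by rewrite -trmx_mul => /(congr1 trmx); rewrite trmxK trmx0.
Qed.

(** Over the reals [ker A] meets its orthogonal complement only in 0: a vector killed by both [A]
    and [B^T] is orthogonal to itself. *)
Lemma col_mx_unit : T \in unitmx.
Proof.
rewrite -unitmx_tr -row_free_unit -kermx_eq0; apply/eqP/row_matrixP => k.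
rewrite row0; set z := row k _.
have : z *m T^T = 0 by rewrite -row_mul mulmx_ker row0.
rewrite tr_col_mx mul_mx_row trmxK => /(congr1 (fun M => (lsubmx M, rsubmx M))).
rewrite row_mxKl row_mxKr !linear0 => -[zA zB].
have : (z <= B^T)%MS by case: B_ker => _ ->; apply/sub_kermxP.
case/submxP => w zE.
have n0 : z *m z^T = 0 by rewrite {2}zE trmx_mul trmxK mulmxA zB mul0mx.
apply/rowP => i; rewrite [RHS]mxE; apply/eqP; rewrite -sqrf_eq0.
have := congr1 (fun M : 'M[R]_1 => M 0 0) n0; rewrite [_ 0 0]mxE [RHS]mxE => /eqP.
have zz j : z 0 j * z^T j 0 = z 0 j ^+ 2 by rewrite [z^T j 0]mxE expr2.
rewrite psumr_eq0 => [/allP/(_ i (mem_index_enum _))|j _]; rewrite zz ?sqr_ge0 //.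
Qed.

Lemma T_mulQinv : [/\ A *m Lc = 1%:M, A *m W = 0, B^T *m Lc = 0 & B^T *m W = 1%:M].
Proof.
have : T *m row_mx Lc W = 1%:M by rewrite hsubmxK mulmxV // col_mx_unit.
rewrite mul_col_row scalar_mx_block => /eq_block_mx[]; by split.
Qed.

Lemma Qinv_mulT : Lc *m A + W *m B^T = 1%:M.
Proof. by rewrite -mul_row_col hsubmxK mulVmx // col_mx_unit. Qed.

Lemma fiber_param (b : 'cV[R]_d) y : A *m (W *m y + Qcst A B b) = b.
Proof.
have [AL AW _ _] := T_mulQinv.
by rewrite mulmxDr !mulmxA AW AL mul0mx mul1mx add0r.
Qed.

Lemma proj_param (b : 'cV[R]_d) y : B^T *m (W *m y + Qcst A B b) = y.
Proof.
have [_ _ BL BW] := T_mulQinv.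
by rewrite mulmxDr !mulmxA BW BL mul0mx mul1mx addr0.
Qed.

Lemma fiberE (x : 'cV[R]_(d + m)) : x = W *m (B^T *m x) + Qcst A B (A *m x).
Proof. by rewrite /Qcst !mulmxA -mulmxDl addrC Qinv_mulT mul1mx. Qed.

Lemma W_inj (y : 'cV[R]_m) : W *m y = 0 -> y = 0.
Proof.
have [_ _ _ BW] := T_mulQinv.
by move=> /(congr1 (mulmx B^T)); rewrite mulmxA BW mul1mx mulmx0.
Qed.

Lemma spans_setT : spans W finset.setT.
Proof. by move=> y y0; apply: W_inj; apply/colP => i; rewrite y0 ?inE // mxE. Qed.

Lemma Qcst_lin (b b' : 'cV[R]_d) t : Qcst A B (b + t *: b') = Qcst A B b + t *: Qcst A B b'.
Proof. by rewrite /Qcst mulmxDr -scalemxAr. Qed.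

(** The matrix [row_mx E W], with [E] the unit columns outside [I], links both minors: multiplied by
    [col_mx A B^T] it becomes block triangular with diagonal blocks [colsub f A] and 1, multiplied
    by the permutation matrix [col_mx E^T G^T] it has diagonal blocks 1 and [rowsub g W]. *)
Lemma jacobi_complementary_minor (I : {set 'I_(d + m)}) : #|I| = m ->
  `|col_minor A (finset.setC I)| = `|\det T| * `|col_minor W^T I|.
Proof.
move=> cI; have cC : #|finset.setC I| = d.
  by apply/eqP; rewrite -(eqn_add2r #|I|) [(_ + #|I|)%N]addnC cardsC card_ord cI.
rewrite (col_minorE _ cC) (col_minorE _ cI).
pose f k := enum_val (cast_ord (esym cC) k).
pose g k := enum_val (cast_ord (esym cI) k).
rewrite -/f -/g.
have fC k : f k \notin I by have := enum_valP (cast_ord (esym cC) k); rewrite inE.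
have gI k : g k \in I by exact: enum_valP.
have fI : injective f by move=> k l /enum_val_inj/cast_ord_inj.
have gJ : injective g by move=> k l /enum_val_inj/cast_ord_inj.
pose E : 'M[R]_(d + m, d) := colsub f 1%:M.
pose G : 'M[R]_(d + m, m) := colsub g 1%:M.
have EE : E^T *m E = 1%:M.
  rewrite /E mulmx_colsub mulmx1; apply/matrixP => i j; rewrite !mxE.
  by rewrite (inj_eq fI) eq_sym.
have GG : G^T *m G = 1%:M.
  rewrite /G mulmx_colsub mulmx1; apply/matrixP => i j; rewrite !mxE.
  by rewrite (inj_eq gJ) eq_sym.
have EG : E^T *m G = 0.
  rewrite /G mulmx_colsub mulmx1; apply/matrixP => i j; rewrite !mxE.
  by case: eqP => // fg; have := fC i; rewrite -fg gI.
have GE : G^T *m E = 0 by rewrite -[LHS]trmxK trmx_mul trmxK EG trmx0.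
have mul_colsub1 n k (M : 'M[R]_(n, k)) r (h : 'I_r -> 'I_k) :
    M *m colsub h 1%:M = colsub h M.
  by rewrite mulmx_colsub mulmx1.
have d1 : \det T * \det (row_mx E W) = \det (colsub f A).
  have [_ AW _ BW] := T_mulQinv.
  by rewrite -det_mulmx mul_col_row AW BW det_lblock det1 mulr1 mul_colsub1.
have d2 : \det (col_mx E^T G^T) * \det (row_mx E W) = \det (rowsub g W).
  rewrite -det_mulmx mul_col_row EE GE det_ublock det1 mul1r; congr (\det _).
  by rewrite -[LHS]trmxK trmx_mul trmxK mul_colsub1; apply/matrixP => i j; rewrite !mxE.
have d3 : \det (col_mx E^T G^T) ^+ 2 = 1.
  rewrite expr2 -{2}det_tr -det_mulmx tr_col_mx !trmxK mul_col_row EE EG GE GG.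
  by rewrite -scalar_mx_block det1.
have d4 : `|\det (col_mx E^T G^T)| = 1.
  by apply/eqP; rewrite -sqrp_eq1 // -normrX d3 normr1.
have -> : \det (colsub g W^T) = \det (rowsub g W).
  by rewrite -det_tr; congr (\det _); apply/matrixP => i j; rewrite !mxE.
by rewrite -d1 -d2 !normrM d4 mul1r.
Qed.

Lemma det_neq0 : \det T != 0.
Proof. by have := col_mx_unit; rewrite unitmxE unitfE. Qed.

(** Membership of [b] in the cone of the columns [s], read in the fiber: the point [W y + c b] is
    nonnegative and supported on [s]. *)
Definition face_point b (s : {set 'I_(d + m)}) (y : 'cV[R]_m) : Prop :=
  (forall k, 0 <= ell W (Qcst A B b) y k) /\
  forall k, k \notin s -> ell W (Qcst A B b) y k = 0.

Lemma cone_col_submx b s : cone (col_submx A s) b <-> exists y, face_point b s y.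
Proof.
split=> [[t /= t0 tE]|[y [y0 ys]]].
  pose f (k : 'I_#|s|) : 'I_(d + m) := enum_val k.
  pose x := colsub f 1%:M *m t.
  have Ax : A *m x = b by rewrite mulmxA mulmx_colsub mulmx1.
  have xE : W *m (B^T *m x) + Qcst A B b = x by rewrite [RHS]fiberE Ax.
  exists (B^T *m x); split=> k; rewrite /ell xE mxE.
    by apply: sumr_ge0 => i _; rewrite !mxE mulr_ge0.
  move=> ks; rewrite big1 // => i _; rewrite !mxE; case: eqP => [kE|_]; last by rewrite mul0r.
  by case/negP: ks; rewrite kE enum_valP.
set x := W *m y + Qcst A B b in y0 ys.
exists (\col_k x (enum_val k) 0) => [i|]; first by rewrite mxE y0.
rewrite -[RHS](fiber_param b y) -/x; apply/colP => i; rewrite !mxE.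
rewrite [RHS](bigID (mem s)) /= [X in _ = _ + X]big1 ?addr0; last first.
  by move=> j js; rewrite [x j 0](ys j js) mulr0.
rewrite [RHS]big_enum_val; apply: eq_bigr => k _; by rewrite !mxE.
Qed.

Lemma basis_slack_row (I : {set 'I_(d + m)}) k : is_basis W I ->
  exists r : 'rV[R]_d, forall b, slack W (Qcst A B b) I k = (r *m b) 0 0.
Proof.
move=> bI; have [mu muI muE] := basis_coord (row k W) bI.
exists ((delta_mx 0 k - mu) *m Lc) => b.
rewrite -mulmxA -/(Qcst A B b) mulmxBl mxE [X in _ = _ + X]mxE.
rewrite -rowE mxE /slack ellE addrC; congr (_ + _).
transitivity ((row k W *m bpoint W (Qcst A B b) I) 0 0).
  by rewrite !mxE; apply: eq_bigr => a _; rewrite !mxE.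
rewrite muE row_mulE [in RHS]mxE -sumrN; apply: eq_bigr => i _.
have [iI|/muI ->] := boolP (i \in I); last by rewrite !mul0r oppr0.
have := slack_basis (Qcst A B b) bI iI; rewrite /slack ellE => /eqP.
by rewrite addr_eq0 => /eqP ->; rewrite mulrN.
Qed.

(** Over the right-hand side [col k A] the fiber contains the unit vector at [k], which vanishes on
    [I]. So moving [b] along column [k] changes the slack at [k] at unit speed, for every basis
    avoiding [k]. *)
Lemma slack_col (I : {set 'I_(d + m)}) k : is_basis W I -> k \notin I ->
  slack W (Qcst A B (col k A)) I k = 1.
Proof.
move=> bI kI; pose e : 'cV[R]_(d + m) := delta_mx k 0.
have xE : e = W *m (B^T *m e) + Qcst A B (col k A) by rewrite colE [LHS]fiberE.
rewrite /slack -(@bpoint_unique _ _ _ _ _ _ (B^T *m e)) // /ell -xE.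
  by rewrite mxE !eqxx.
by move=> i iI; rewrite mxE andbT; case: eqP => // ik; rewrite -ik iI in kI.
Qed.

Lemma slack_shift (I : {set 'I_(d + m)}) k b t : is_basis W I -> k \notin I ->
  slack W (Qcst A B (b + t *: col k A)) I k = slack W (Qcst A B b) I k + t.
Proof. by move=> bI kI; rewrite Qcst_lin slack_lin // slack_col // mulr1. Qed.

End KernelBasis.

(** * Cells of the chamber complex *)

Lemma small_step (R : realFieldType) (T : finType) (p q : T -> R) :
  (forall i, 0 < p i) -> exists t, [/\ 0 < t, t < 1 & forall i, 0 < p i + t * q i].
Proof.
(* The sum dominates each ratio of [q i] to [p i]; the summand 2 makes this strict and gives
   [t < 1]. *)
move=> p0; pose K := 2 + \sum_i `|q i| / p i.
have S0 : 0 <= \sum_i `|q i| / p i by apply: sumr_ge0 => i _; rewrite divr_ge0 // ltW.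
have K0 : 0 < K by rewrite /K; lra.
exists K^-1; split; first by rewrite invr_gt0.
  by rewrite invf_lt1 // /K; lra.
move=> i; have : `|q i| / p i < K.
  rewrite /K (bigD1 i) //=; set s := \sum_(j | _) _.
  have : 0 <= s by apply: sumr_ge0 => j _; rewrite divr_ge0 // ltW.
  lra.
rewrite ltr_pdivrMr // mulrC -ltr_pdivrMr // => h.
have : - (`|q i| / K) <= K^-1 * q i.
  by rewrite [K^-1 * _]mulrC -mulNr ler_pM2r ?invr_gt0 // lerNl -normrN ler_norm.
lra.
Qed.

Lemma ray_cvg (R : realType) p (b a : 'cV[R]_p) :
  (fun t : R => b - t *: a) @ (0 : R)^'+ --> b.
Proof.
apply: cvg_at_right_filter; rewrite -[X in _ --> X]subr0 -(scale0r a).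
by apply: cvgB; [exact: cvg_cst|apply: cvgZr_tmp; exact: cvg_id].
Qed.

Lemma linear_form_continuous (R : realType) p (r : 'rV[R]_p) :
  continuous (fun z : 'cV[R]_p => (r *m z) 0 0).
Proof.
move=> z.
have -> : (fun z : 'cV[R]_p => (r *m z) 0 0) = (fun z => \sum_j r 0 j * z j 0).
  by apply/funext => x; rewrite mxE.
have -> : (fun z : 'cV[R]_p => \sum_j r 0 j * z j 0) =
    \sum_j (fun z : 'cV[R]_p => r 0 j * z j 0).
  by apply/funext => x; rewrite fct_sumE.
elim/big_ind: _ => [|f g fc gc|j _]; first exact: cst_continuous.
  exact: (@cvgD _ _ _ _ _ f g (f z) (g z) fc gc).
by have h := @coord_continuous R p 1 j 0 z; exact: cvgMl_tmp h.
Qed.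

Lemma has_dim_sub_cone (R : realType) d n (A : 'M[R]_(d, n)) (s : {set 'I_n})
    (X : set 'cV[R]_d) k :
  has_dim X k -> X `<=` cone (col_submx A s) -> (k <= #|s|)%N.
Proof.
case=> -[x Xx xI] _ XA; have /choice[t tE] : forall i, exists t, x i = col_submx A s *m t.
  by move=> i; have [t _ <-] := XA _ (Xx i); exists t.
move: xI; rewrite /aff_independent /row_free.
set M := (X in \rank X) => /eqP <-.
have -> : M = (\matrix_i (t (lift ord0 i) - t ord0)^T) *m (col_submx A s)^T.
  apply/row_matrixP => i; rewrite row_mul !rowK !tE -mulmxBr trmx_mul //.
exact: mulmx_max_rank.
Qed.

Lemma cone_col_submx_sub (R : realType) d n (A : 'M[R]_(d, n)) (s : {set 'I_n}) b :
  cone (col_submx A s) b -> cone A b.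
Proof.
move=> [t /= t0 <-]; exists (colsub (fun k : 'I_#|s| => enum_val k) 1%:M *m t).
  by move=> i /=; rewrite mxE; apply: sumr_ge0 => k _; rewrite !mxE mulr_ge0.
by rewrite mulmxA mulmx_colsub mulmx1.
Qed.

(** A cell presented as the chamber of 0 lies in all the cones of nonempty column sets, so any
    nonzero point of it has the same chamber. The base point is wanted nonzero because the cone of
    the empty column set, which is 0, does not take part in the intersection defining [chamber]. *)
Lemma chamber_base_point (R : realType) d n (A : 'M[R]_(d, n)) (C : set 'cV[R]_d) :
  (d <= n)%N -> is_cell A C ->
  exists b, [/\ C = chamber A b, cone A b & (0 < d)%N -> b != 0].
Proof.
move=> dn [[b Ab bE] Cd].
have [b0|bn0] := eqVneq b 0; last by exists b.
case: (posnP d) => d0; first by exists b; split=> // d1; move: (d1); rewrite lt0n d0.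
have c0 s : cone (col_submx A s) 0 by exists 0; rewrite ?mulmx0 // => i; rewrite mxE.
have [b' Cb' b'0] : exists2 b', C b' & b' != 0.
  case: Cd => -[x Cx xI] _; apply: contrapT => /forall2NP h.
  have x0 i : x i = 0.
    by have [/(_ (Cx i)) //|/negP] := h (x i); rewrite negbK => /eqP.
  move: xI; rewrite /aff_independent /row_free (_ : (\matrix_i _) = 0).
    by rewrite mxrank0 eq_sym -leqn0 leqNgt d0.
  by apply/row_matrixP => i; rewrite rowK !x0 subrr row0 trmx0.
have cb' s : s != finset.set0 -> cone (col_submx A s) b'.
  by move=> s0; move: Cb'; rewrite -bE => /(_ s s0); apply; rewrite b0.
exists b'; split=> //.
  rewrite -bE b0; apply/seteqP; split=> z zP s s0 _; first exact: zP (c0 s).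
  exact: zP (cb' s s0).
apply: (@cone_col_submx_sub _ _ _ _ finset.setT); apply: cb'.
by apply/set0Pn; exists (Ordinal (leq_trans d0 dn)); rewrite inE.
Qed.

Section Chamber.
Context {R : realType} {d m : nat}.
Variables (A : 'M[R]_(d, d + m)) (B : 'M[R]_(d + m, m)).
Hypothesis B_ker : kernel_basis A B.
Local Notation W := (Qnormals A B).
Local Notation c := (Qcst A B).
Variables (C : set 'cV[R]_d) (b1 : 'cV[R]_d).
Hypothesis C_E : C = chamber A b1.
Hypothesis C_dim : has_dim C d.
Hypothesis b1_cone : cone A b1.
Hypothesis b1_neq0 : (0 < d)%N -> b1 != 0.
Implicit Types (b : 'cV[R]_d) (I : {set 'I_(d + m)}).

(** These turn out to be the sets [I(v)] that make up [V_C] ([cell_verticesE]). *)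
Definition cell_basis I : bool := feasible W finset.setT (c b1) I.

(** Finitely many strict inequalities that stand in for the interior of [C]: interior points satisfy
    them ([interior_slack_pos]), and they put [b] in [C] ([slack_pos_cell]). In this form [b] can be
    perturbed by [small_step]. *)
Definition cell_slack_pos b : Prop :=
  forall I k, cell_basis I -> k \notin I -> 0 < slack W (c b) I k.

Lemma cell_basisP I : reflect
  (is_basis W I /\ forall k, k \notin I -> 0 < slack W (c b1) I k) (cell_basis I).
Proof.
apply: (iffP (feasibleP _ _ _ _)) => [[_ bI sI]|[bI sI]]; split=> //.
  by move=> k kI; apply: sI; rewrite ?inE.
by move=> k _; apply: sI.
Qed.

Lemma cell_basis_is_basis I : cell_basis I -> is_basis W I.
Proof. by case/cell_basisP. Qed.

Lemma base_slack_pos : cell_slack_pos b1.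
Proof. by move=> I k /cell_basisP[_]; apply. Qed.

Lemma base_sat : exists y, sat W finset.setT (c b1) y.
Proof.
have [t /= t0 tE] := b1_cone; exists (B^T *m t) => i _.
by rewrite /ell -tE -fiberE.
Qed.

Lemma card_setC_basis I : is_basis W I -> #|finset.setC I| = d.
Proof.
move/card_basis => cI; apply/eqP.
by rewrite -(eqn_add2r #|I|) [(_ + #|I|)%N]addnC cardsC card_ord cI.
Qed.

(** A further tight inequality would put [b1] in a cone generated by [d - 1] columns. If these are
    nonempty, that cone contains [C], which has dimension [d]; if there are none, [b1] would be
    0. *)
Lemma base_feasibly_simple : feasibly_simple W finset.setT (c b1).
Proof.
move=> I _ bI sI; apply/feasibleP; split=> [|//|k _ kI].
  by apply/fintype.subsetP => i; rewrite inE.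
rewrite lt_neqAle; apply/andP; split; last by exact: (sI k (finset.in_setT _)).
apply/eqP => sk.
pose s := finset.setC (k |: I)%SET.
have fp : face_point A B b1 s (bpoint W (c b1) I).
  split=> i; first exact: (sI i (finset.in_setT _)).
  by rewrite inE negbK !inE => /orP[/eqP -> //|iI]; exact: slack_basis.
have cs : (#|s|.+1 = d)%N.
  have := cardsD1 k (finset.setC I); rewrite (card_setC_basis bI) inE kI add1n => e.
  apply: etrans (esym e); congr (#|pred_of_set _|.+1).
  by apply/setP => i; rewrite !inE negb_or.
have cC : cone (col_submx A s) b1 by apply/(cone_col_submx B_ker); exists (bpoint W (c b1) I).
have d0 : (0 < d)%N by rewrite -cs.
have [s0|sn0] := eqVneq s finset.set0.
  move: (b1_neq0 d0); rewrite -(fiber_param B_ker b1 (bpoint W (c b1) I)).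
  rewrite (_ : W *m _ + _ = 0) ?mulmx0 ?eqxx //; apply/colP => i; rewrite [RHS]mxE.
  by apply: fp.2; rewrite s0 inE.
suff h : (d <= #|s|)%N by move: h; rewrite leqNgt -[X in (_ < X)%N]cs ltnSn.
by apply: (has_dim_sub_cone (A := A) C_dim); rewrite C_E => z /(_ s sn0); apply.
Qed.

(* The witness minimises, over the fiber of [b1], the sum of the coordinates
   outside [s]; that sum is 0 at the given point of the fiber of [b]. *)
Lemma cell_face_basis b s y : cell_slack_pos b -> face_point A B b s y ->
  exists2 I, cell_basis I & finset.setC I \subset s.
Proof.
move=> bpos [y0 ys]; have [y1 sy1] := base_sat.
pose nu : 'rV[R]_(d + m) := \row_i (i \notin s)%:R.
have nuc : in_cone W finset.setT (nu *m W).
  by exists nu; split=> // i; rewrite ?inE // mxE ler0n.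
have [I fI [mu [mu0 muI muE]]] :=
  feasible_cover base_feasibly_simple (spans_setT B_ker) sy1 nuc.
have bI := cell_basis_is_basis fI.
exists I => //; apply/fintype.subsetP => i; rewrite inE => iI.
pose y' := bpoint W (c b) I.
(* The multipliers [mu] do not depend on the right-hand side, so the basic solution of [I] minimises
   the same sum over the fiber of [b]; the minimum is then at most 0, which forbids positive slacks
   outside [s]. *)
have e1 : (nu *m W *m (y - y')) 0 0 = - \sum_(k | k \notin s) slack W (c b) I k.
  rewrite row_mulE -sumrN [RHS]big_mkcond /=; apply: eq_bigr => k _.
  rewrite mxE; case: ifP => ks; last by rewrite mul0r.
  rewrite mul1r mulmxBr !mxE -/y'; have := ys k ks; rewrite /slack !ellE !mxE -/y'.
  move=> h; lra.
have e2 : 0 <= (nu *m W *m (y - y')) 0 0.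
  rewrite muE row_mulE; apply: sumr_ge0 => k _.
  have [kI|/muI ->] := boolP (k \in I); last by rewrite mul0r.
  apply: mulr_ge0 => //; have := y0 k; have := slack_basis (c b) bI kI.
  rewrite /slack !ellE mulmxBr !mxE -/y' => *; lra.
have sl0 k : 0 <= slack W (c b) I k.
  have [kI|kI] := boolP (k \in I); first by rewrite slack_basis.
  exact/ltW/bpos.
apply: contraTT iI => isn; rewrite negbK; apply: contraT => iI.
move: e2; rewrite e1 oppr_ge0 leNgt (bigD1 i) //= ltr_wpDr ?bpos //.
exact: sumr_ge0.
Qed.

(** The basic solution of [I] over [b1] puts [b1] in the cone of the columns outside [I]. That cone
    is therefore one of those intersected in [C], and a point of the fiber of [b] supported there
    can only be the basic solution of [I]. *)
Lemma cell_slack_ge0 b : C b -> forall I k, cell_basis I -> 0 <= slack W (c b) I k.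
Proof.
rewrite C_E => Cb I k cI; have bI := cell_basis_is_basis cI.
have [kI|kI] := boolP (k \in I); first by rewrite slack_basis.
have s0 : finset.setC I != finset.set0 by apply/set0Pn; exists k; rewrite inE.
have : cone (col_submx A (finset.setC I)) b.
  apply: Cb => //; apply/(cone_col_submx B_ker); exists (bpoint W (c b1) I); split=> i.
    have [iI|iI] := boolP (i \in I); last by apply/ltW/base_slack_pos.
    by rewrite [ell _ _ _ _](slack_basis (c b1) bI iI).
  by rewrite inE negbK => iI; exact: slack_basis.
case/(cone_col_submx B_ker) => y [y0 ys].
by rewrite /slack -(@bpoint_unique _ _ _ _ _ _ y) // => i iI; apply: ys; rewrite inE negbK.
Qed.

(** A small step back along column [k] stays in [C] and lowers the slack at [k], which is still
    nonnegative there. *)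
Lemma interior_slack_pos b : C° b -> cell_slack_pos b.
Proof.
move=> Cb I k cI kI; have bI := cell_basis_is_basis cI.
have : \forall t \near (0 : R)^'+, C (b - t *: col k A) := ray_cvg (col k A) Cb.
move=> H; have [t [t0 Ct]] : exists t : R, 0 < t /\ C (b - t *: col k A).
  near (0 : R)^'+ => t; exists t; split=> //; by near: t.
have := cell_slack_ge0 Ct k cI; rewrite -scaleNr slack_shift // => h; lra.
Unshelve. all: by end_near. Qed.

(** Any cone of columns containing [b1] contains, by [cell_face_basis], the cone of the columns
    outside some cell basis; feasibility of that basis over [b] puts [b] in it. *)
Lemma slack_pos_cell b : cell_slack_pos b -> C b.
Proof.
move=> bpos; rewrite C_E => s s0 /(cone_col_submx B_ker)[y fy].
have [I cI Is] := cell_face_basis base_slack_pos fy.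
have bI := cell_basis_is_basis cI.
apply/(cone_col_submx B_ker); exists (bpoint W (c b) I); split=> k.
  have [kI|kI] := boolP (k \in I); last by apply/ltW/bpos.
  by rewrite [ell _ _ _ _](slack_basis (c b) bI kI).
move=> ks; apply: slack_basis => //; apply: contraNT ks => kI.
by apply: (fintype.subsetP Is); rewrite inE.
Qed.

Lemma base_interior : C° b1.
Proof.
have H : \forall b \near b1, forall p : {set 'I_(d + m)} * 'I_(d + m),
    cell_basis p.1 -> p.2 \notin p.1 -> 0 < slack W (c b) p.1 p.2.
  apply: (@filter_forall _ _ (fun p b => cell_basis p.1 -> p.2 \notin p.1 ->
    0 < slack W (c b) p.1 p.2) (nbhs b1)) => -[I k] /=.
  have [cI|ncI] := boolP (cell_basis I); last by apply: nearW.
  have [kI|kI] := boolP (k \in I); first by apply: nearW.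
  have [r rE] := basis_slack_row k (cell_basis_is_basis cI).
  have : 0 < (r *m b1) 0 0 by rewrite -rE; apply: base_slack_pos.
  move=> /(cvgr_gt _ (@linear_form_continuous R d r b1)); apply: filterS => b h _ _.
  by rewrite rE.
by apply: filterS H => b h; apply: slack_pos_cell => I k; apply: (h (I, k)).
Qed.

Lemma exists_generic : exists2 b, cell_slack_pos b & generic W (c b) finset.setT.
Proof.
suff [b bpos gb] : exists2 b, cell_slack_pos b & forall p, p \in enum predT ->
    is_basis W p.1 -> p.2 \notin p.1 -> slack W (c b) p.1 p.2 != 0.
  by exists b => // I k _ bI _ kI; apply: (gb (I, k)); rewrite ?mem_enum.
elim: (enum _) => [|[I k] l [b bpos gb]]; first by exists b1 => //; exact: base_slack_pos.
have [bI|nbI] := boolP (is_basis W I && (k \notin I)); last first.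
  exists b => // p; rewrite inE => /orP[/eqP -> /= bI kI|]; last exact: gb.
  by rewrite bI kI in nbI.
case/andP: bI => bI kI.
have [s0|sn0] := eqVneq (slack W (c b) I k) 0; last first.
  by exists b => // p; rewrite inE => /orP[/eqP ->|/gb].
pose v p := slack W (c b) p.1 p.2.
pose g p := slack W (c (col k A)) p.1 p.2.
(* Two families of conditions must survive the step: positivity of the slacks of cell bases, and
   [v * (v + t * g) > 0] for the slacks already nonzero, which keeps them nonzero. *)
pose P (p : bool * ({set 'I_(d + m)} * 'I_(d + m))) :=
  if p.1 then (if cell_basis p.2.1 && (p.2.2 \notin p.2.1) then v p.2 else 1)
  else if v p.2 == 0 then 1 else v p.2 ^+ 2.
pose Q (p : bool * ({set 'I_(d + m)} * 'I_(d + m))) :=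
  if p.1 then (if cell_basis p.2.1 && (p.2.2 \notin p.2.1) then g p.2 else 0)
  else if v p.2 == 0 then 0 else v p.2 * g p.2.
have P0 p : 0 < P p.
  rewrite /P; case: (p.1); case: ifP => //; first by case/andP; exact: bpos.
  by move/negbT => v0; rewrite exprn_even_gt0.
have [t [t0 _ H]] := small_step Q P0.
have vE p : is_basis W p.1 -> slack W (c (b + t *: col k A)) p.1 p.2 = v p + t * g p.
  by move=> bp; rewrite Qcst_lin slack_lin.
exists (b + t *: col k A).
  move=> J l0 cJ lJ; rewrite (vE (J, l0)) ?(cell_basis_is_basis cJ) //.
  by have := H (true, (J, l0)); rewrite /P /Q /= cJ lJ.
move=> p; rewrite inE => /orP[/eqP -> /= _ _|pl bp np].
  by rewrite slack_shift // s0 add0r gt_eqF.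
rewrite vE //; have := H (false, p); rewrite /P /Q /= (negPf (gb p pl bp np)).
rewrite expr2 mulrCA -mulrDr; apply: contraTneq => ->.
by rewrite mulr0 ltxx.
Qed.

End Chamber.

(** * Faces of the fibers over a cell *)

Lemma aff_independent_le (R : realType) p k (x : 'I_k.+1 -> 'cV[R]_p) :
  aff_independent x -> (k <= p)%N.
Proof. by rewrite /aff_independent /row_free => /eqP <-; exact: rank_leq_col. Qed.

Lemma aff_independent_mul (R : realType) p q (L : 'M[R]_(q, p)) (L' : 'M[R]_(p, q))
    (c : 'cV[R]_q) k (x : 'I_k.+1 -> 'cV[R]_p) : L' *m L = 1%:M ->
  aff_independent (fun i => L *m x i + c) = aff_independent x.
Proof.
move=> LL; rewrite /aff_independent.
set M := \matrix_i (x _ - _)^T.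
have -> : (\matrix_i (L *m x (lift ord0 i) + c - (L *m x ord0 + c))^T) = M *m L^T.
  apply/row_matrixP => i; rewrite row_mul !rowK -trmx_mul mulmxBr; congr (_^T).
  by rewrite opprD addrACA subrr addr0.
have Lf : row_free L^T by apply/row_freeP; exists L'^T; rewrite -trmx_mul LL trmx1.
by rewrite /row_free mxrankMfree.
Qed.

Lemma has_dim_affine_image (R : realType) p q (L : 'M[R]_(q, p)) (L' : 'M[R]_(p, q))
    (c : 'cV[R]_q) (X : set 'cV[R]_p) k : L' *m L = 1%:M ->
  has_dim ((fun y => L *m y + c) @` X) k <-> has_dim X k.
Proof.
move=> LL.
have E n : (exists2 x : 'I_n.+1 -> 'cV[R]_q,
      forall i, ((fun y => L *m y + c) @` X) (x i) & aff_independent x) <->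
    (exists2 x : 'I_n.+1 -> 'cV[R]_p, forall i, X (x i) & aff_independent x).
  split=> [[x Xx xI]|[x Xx xI]].
    have /choice[y yP] : forall i, exists y, X y /\ L *m y + c = x i.
      by move=> i; have [y Xy yE] := Xx i; exists y.
    exists y => [i|]; first by case: (yP i).
    rewrite -(aff_independent_mul c y LL).
    by rewrite (_ : (fun i => _) = x) //; apply/funext => i; case: (yP i).
  exists (fun i => L *m x i + c) => [i|]; first by exists (x i).
  by rewrite (aff_independent_mul c x LL).
by split=> -[/E h1 h2]; split=> //; move=> /E.
Qed.

Lemma aff_independent_widen (R : realType) p k l (le : (k.+1 <= l.+1)%N)
    (x : 'I_l.+1 -> 'cV[R]_p) :
  aff_independent x -> aff_independent (fun i => x (widen_ord le i)).
Proof.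
rewrite /aff_independent; set M := \matrix_i _; set M' := \matrix_(i < k) _.
pose f : 'I_k -> 'I_l := widen_ord (le : (k <= l)%N).
have -> : M' = rowsub f M.
  apply/row_matrixP => i; rewrite row_rowsub !rowK.
  by congr ((x _ - x _)^T); apply: val_inj.
move=> /row_freeP[N MN]; rewrite -kermx_eq0; apply/eqP/row_matrixP => i.
rewrite row0; set z := row i _.
have zM : z *m rowsub f M = 0 by rewrite -row_mul mulmx_ker row0.
have : z *m rowsub f 1%:M = 0.
  by rewrite -MN -mul_rowsub_mx mulmxA zM mul0mx.
move=> /rowP z0; apply/rowP => j; have := z0 (f j); rewrite mxE (bigD1 j) //= big1 => [|a ne].
  by rewrite !mxE eqxx mulr1 addr0.
by rewrite [rowsub _ _ _ _]mxE [(1%:M) _ _]mxE (_ : (f a == f j) = false) ?mulr0 //; apply/negbTE.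
Qed.

Lemma has_dim_uniq (R : realType) p (X : set 'cV[R]_p) k l :
  has_dim X k -> has_dim X l -> k = l.
Proof.
suff H a b : has_dim X a -> has_dim X b -> (b <= a)%N.
  by move=> *; apply/eqP; rewrite eqn_leq !H.
move=> [_ h] [[x Xx xI] _]; rewrite leqNgt; apply/negP => ab; apply: h.
have le : (a.+2 <= b.+1)%N by [].
by exists (fun i => x (widen_ord le i)) => //; exact: aff_independent_widen.
Qed.

Section Polyhedron.
Context {R : realType} {N m : nat}.
Variables (W : 'M[R]_(N, m)) (c : 'cV[R]_N) (Q : set 'cV[R]_m).
Hypothesis QE : forall y, Q y <-> forall k, 0 <= ell W c y k.
Implicit Types (y p q v : 'cV[R]_m).

Lemma polyhedron_has_dim p : (forall k, 0 < ell W c p k) -> has_dim Q m.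
Proof.
move=> p0; split; last by case=> x _ /aff_independent_le; rewrite ltnn.
pose e (j : 'I_m) : 'cV[R]_m := delta_mx j 0.
have [t [t0 _ H]] := small_step (fun kj : 'I_N * 'I_m => (W *m e kj.2) kj.1 0)
  (fun kj => p0 kj.1).
exists (fun i => if unlift ord0 i is Some j then p + t *: e j else p).
  move=> i; apply/QE => k; case: unliftP => [j _|_]; last exact: ltW.
  by rewrite ellD mulmxZ_ent; apply/ltW/(H (k, j)).
rewrite /aff_independent (_ : (\matrix_i _) = t *: 1%:M).
  by rewrite row_free_unit unitmxZ ?unitmx1 // unitfE gt_eqF.
apply/row_matrixP => i; rewrite rowK liftK unlift_none addrAC subrr add0r.
by apply/rowP => j; rewrite !mxE eqxx andbT eq_sym.
Qed.

(** Only inequalities proportional to the [i]-th are tight at [q], and these do not change along its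
    hyperplane, so a small simplex at [q] inside the hyperplane stays in [Q]. Proportional rows have
    to be allowed because several inequalities may define the same face. *)
Lemma polyhedron_facet i p q : (forall k, 0 < ell W c p k) -> ell W c q i = 0 ->
  (forall k, 0 < ell W c q k \/
     ell W c q k = 0 /\ exists la : R, row k W = la *: row i W) ->
  (0 < m)%N /\ has_dim (Q `&` [set y | ell W c y i = 0]) m.-1.
Proof.
move=> p0 qi qk.
have rowE k y : (row k W *m y) 0 0 = (W *m y) k 0 by rewrite -row_mul mxE.
have wE := rowE i.
have wn0 : row i W != 0.
  apply: contraTneq (p0 i) => w0; have E y : ell W c y i = c i 0.
    rewrite ellE (_ : (W *m y) i 0 = 0) ?add0r //.
    by rewrite -wE w0 mul0mx mxE.
  by rewrite E -(E q) qi ltxx.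
have m0 : (0 < m)%N.
  rewrite lt0n; apply: contra wn0 => /eqP m0; apply/eqP/rowP => j.
  by have := ltn_ord j; rewrite {2}m0.
split=> //; set K := kermx (row i W)^T.
have rK : \rank K = m.-1 by rewrite mxrank_ker mxrank_tr rank_rV wn0 subn1.
rewrite -rK; split; last first.
  case=> x Fx; rewrite /aff_independent /row_free.
  set M := (X in \rank X) => /eqP rM.
  suff : (M <= K)%MS by move/mxrankS; rewrite rM ltnn.
  apply/sub_kermxP/row_matrixP => j; rewrite row_mul rowK row0 -trmx_mul mulmxBr.
  apply/eqP; rewrite trmx_eq0 subr_eq0; apply/eqP/matrixP => a b.
  rewrite !ord1 !wE; have [_ /= h1] := Fx (lift ord0 j); have [_ /= h2] := Fx ord0.
  by move: h1 h2; rewrite !ellE; set u := c i 0; move=> *; lra.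
pose G := row_base K; pose g j : 'cV[R]_m := (row j G)^T.
have wg j : (W *m g j) i 0 = 0.
  have /sub_kermxP GK : (G <= K)%MS by rewrite eq_row_base.
  rewrite -wE /g -[row i W]trmxK -trmx_mul -row_mul GK row0 trmx0.
  by rewrite mxE.
(* The value 1 is a dummy for the inequalities tight at [q], which are constant along every
   [g j]. *)
pose P0 (kj : 'I_N * 'I_(\rank K)) := if 0 < ell W c q kj.1 then ell W c q kj.1 else 1.
have P00 kj : 0 < P0 kj by rewrite /P0; case: ifP.
have [t [t0 _ H]] := small_step (fun kj => (W *m g kj.2) kj.1 0) P00.
exists (fun i => if unlift ord0 i is Some j then q + t *: g j else q).
  have q0 k : 0 <= ell W c q k by have [/ltW|[->]] := qk k.
  move=> a; case: unliftP => [j _|_]; split=> //=;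
    rewrite ?ellD ?mulmxZ_ent ?wg ?qi ?mulr0 ?addr0 //.
    apply/QE => k; rewrite ellD mulmxZ_ent.
    have [qp|[-> [la rE]]] := qk k; first by have := H (k, j); rewrite /P0 /= qp => /ltW.
    by rewrite -rowE rE -scalemxAl mxE wE wg !mulr0 addr0.
  exact/QE.
rewrite /aff_independent (_ : (\matrix_i _) = t *: G).
  have /eqP rG : row_free G := row_base_free K.
  by rewrite /row_free (mxrank_scale_nz _ (lt0r_neq0 t0)) rG.
apply/row_matrixP => j; rewrite rowK liftK unlift_none addrAC subrr add0r.
by rewrite linearZ /= trmxK linearZ.
Qed.

Lemma polyhedron_is_facet i p q : (forall k, 0 < ell W c p k) -> ell W c q i = 0 ->
  (forall k, 0 < ell W c q k \/
     ell W c q k = 0 /\ exists la : R, row k W = la *: row i W) ->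
  is_facet Q (Q `&` [set y | ell W c y i = 0]).
Proof.
move=> p0 qi qk; have [m0 dF] := polyhedron_facet p0 qi qk; split; last first.
  by exists m.-1 => //; rewrite prednK //; exact: polyhedron_has_dim p0.
exists (row i W)^T, (c i 0).
have E x : dotv (row i W)^T x + c i 0 = ell W c x i.
  by rewrite /dotv trmxK ellE -row_mul [row _ _ _ _]mxE.
split=> [x /QE|]; first by rewrite E.
by apply/seteqP; split=> x /= [Qx h]; split=> //; move: h; rewrite /= E.
Qed.

(** The sum of the inequalities in [I] is a supporting functional that vanishes on [Q] only at the
    basic solution. *)
Lemma bpoint_vertex I : is_basis W I -> Q (bpoint W c I) -> vertices Q (bpoint W c I).
Proof.
move=> bI Qy; exists (\sum_(i in I) row i W)^T, (\sum_(i in I) c i 0).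
have E x : dotv (\sum_(i in I) row i W)^T x + \sum_(i in I) c i 0 =
    \sum_(i in I) ell W c x i.
  rewrite /dotv trmxK mulmx_suml summxE -big_split /=; apply: eq_bigr => i _.
  by rewrite ellE -row_mul [row _ _ _ _]mxE.
split=> [x /QE x0|]; first by rewrite E sumr_ge0.
apply/seteqP; split=> x /=.
  move=> ->; split=> //=; rewrite E big1 // => i iI; exact: slack_basis.
move=> [/QE x0 /=]; rewrite E => /eqP; rewrite psumr_eq0 // => /allP h.
by apply: bpoint_unique => // i iI; apply/eqP; have := h i (mem_index_enum _); rewrite iI.
Qed.

Lemma vertex_in v : vertices Q v -> Q v.
Proof. by move=> [w [a [_ /seteqP[/(_ v erefl)[]]]]]. Qed.

(** The segment from [y] to [v] extends slightly beyond [v] inside [Q]. The functional exposing [v]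
    is nonnegative at both ends and 0 at [v], hence 0 at [y]. *)
Lemma vertex_unique v y : vertices Q v -> Q y ->
  (forall k, ell W c v k = 0 -> ell W c y k = 0) -> y = v.
Proof.
move=> vv Qy vy; have /QE Qv := vertex_in vv.
have [w [a [w0 fE]]] := vv.
pose P0 k := if ell W c v k == 0 then 1 else ell W c v k.
have P00 k : 0 < P0 k by rewrite /P0; case: ifPn => // n0; rewrite lt0r n0 Qv.
have [t [t0 _ H]] := small_step (fun k => ell W c v k - ell W c y k) P00.
have Qz : Q (v + t *: (v - y)).
  apply/QE => k; have : ell W c (v + t *: (v - y)) k =
      ell W c v k + t * (ell W c v k - ell W c y k).
    by rewrite ellD mulmxZ_ent mulmxBr !ellE !mxE; ring.
  move=> ->; have := H k; rewrite /P0; case: ifPn => [/eqP v0 _|_ /ltW //].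
  by rewrite v0 (vy k v0) subrr mulr0 addr0.
have [_ fv] : (Q `&` [set x | dotv w x + a = 0]) v by rewrite -fE.
have fz := w0 _ Qz; have fy := w0 _ Qy.
have dE : dotv w (v + t *: (v - y)) + a = (1 + t) * (dotv w v + a) - t * (dotv w y + a).
  rewrite /dotv mulmxDr -scalemxAr mulmxBr !mxE; ring.
have fy0 : dotv w y + a = 0.
  apply/eqP; rewrite eq_le fy andbT -(pmulr_rle0 _ t0).
  by move: fz; rewrite dE /= fv mulr0 add0r oppr_ge0.
by have : (Q `&` [set x | dotv w x + a = 0]) y by []; rewrite -fE.
Qed.

Lemma vertex_spans v : vertices Q v -> spans W [set k | ell W c v k == 0]%SET.
Proof.
move=> vv z z0; have /QE Qv := vertex_in vv.
pose P0 k := if ell W c v k == 0 then 1 else ell W c v k.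
have P00 k : 0 < P0 k by rewrite /P0; case: ifPn => // n0; rewrite lt0r n0 Qv.
have [t [t0 _ H]] := small_step (fun k => (W *m z) k 0) P00.
have E k : ell W c v k = 0 -> ell W c (v + t *: z) k = 0.
  by move=> v0; rewrite ellD mulmxZ_ent v0 z0 ?inE ?v0 // mulr0 addr0.
have : v + t *: z = v.
  apply: vertex_unique => //; apply/QE => k; have := H k; rewrite /P0.
  by case: ifPn => [/eqP/E -> //|_ /ltW]; rewrite ellD mulmxZ_ent.
move/eqP; rewrite -subr_eq0 addrAC subrr add0r scaler_eq0 gt_eqF //=.
by move/eqP.
Qed.

End Polyhedron.

Section CellData.
Context {R : realType} {d m : nat}.
Variables (A : 'M[R]_(d, d + m)) (B : 'M[R]_(d + m, m)).
Hypothesis B_ker : kernel_basis A B.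
Local Notation W := (Qnormals A B).
Local Notation c := (Qcst A B).

Lemma QpolyE b y : Qpoly A B b y <-> forall k, 0 <= ell W (c b) y k.
Proof.
split=> [[x [x0 Ax] <-] k|y0]; first by rewrite /ell -Ax -fiberE.
exists (W *m y + c b); last exact: proj_param.
by split; [exact: y0|exact: fiber_param].
Qed.

Lemma Ppoly_image b : Ppoly A b = (fun y => W *m y + c b) @` Qpoly A B b.
Proof.
apply/seteqP; split=> [x [x0 Ax]|_ [y /QpolyE y0 <-]].
  exists (B^T *m x); last by rewrite -Ax -fiberE.
  by exists x.
by split; [exact: y0|exact: fiber_param].
Qed.

Lemma Pfacet_image b i : Ppoly A b `&` [set x : 'cV[R]_(d + m) | x i 0 = 0] =
  (fun y => W *m y + c b) @` (Qpoly A B b `&` [set y | ell W (c b) y i = 0]).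
Proof.
rewrite Ppoly_image; apply/seteqP; split=> [_ [[y Qy <-] /= h]|_ [y [Qy h] <-]].
  by exists y.
by split=> //; exists y.
Qed.

Lemma Pfacet b i : is_facet (Qpoly A B b) (Qpoly A B b `&` [set y | ell W (c b) y i = 0]) ->
  i \in facet_ix A b.
Proof.
move=> [_ [k dQ dF]]; rewrite inE; apply/asboolP; split.
  exists (delta_mx i 0), 0.
  have E (x : 'cV[R]_(d + m)) : dotv (delta_mx i 0) x + 0 = x i 0.
    by rewrite addr0 /dotv trmx_delta -rowE mxE.
  split=> [x [x0 _]|]; first by rewrite E.
  by apply/seteqP; split=> x [Px /= h]; split=> //; move: h; rewrite /= E.
have [_ _ _ BW] := T_mulQinv B_ker.
exists k; first by rewrite Ppoly_image; apply/(has_dim_affine_image _ _ _ BW).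
by rewrite Pfacet_image; apply/(has_dim_affine_image _ _ _ BW).
Qed.

Lemma Pvertex_proj b x : vertices (Ppoly A b) x -> vertices (Qpoly A B b) (B^T *m x).
Proof.
move=> [w [a [w0 fE]]].
have E y : dotv (W^T *m w) y + (dotv w (c b) + a) = dotv w (W *m y + c b) + a.
  by rewrite addrA /dotv trmx_mul trmxK mulmxDr mulmxA [in RHS]mxE.
have PQ y : Qpoly A B b y -> Ppoly A b (W *m y + c b).
  by move=> Qy; rewrite Ppoly_image; exists y.
have [[x0 Ax] wx] : (Ppoly A b `&` [set x | dotv w x + a = 0]) x by rewrite -fE.
exists (W^T *m w), (dotv w (c b) + a); split=> [y Qy|]; first by rewrite E; apply/w0/PQ.
apply/seteqP; split=> y /=.
  move=> ->; split; first by exists x.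
  by rewrite /= E -Ax -fiberE.
case=> Qy /=; rewrite E => wy.
have : (Ppoly A b `&` [set x | dotv w x + a = 0]) (W *m y + c b) by split=> //; exact: PQ.
by rewrite -fE /= => <-; rewrite proj_param.
Qed.

Lemma Qvertex_lift b y : vertices (Qpoly A B b) y -> vertices (Ppoly A b) (W *m y + c b).
Proof.
move=> [w [a [w0 fE]]].
have E x : dotv (B *m w) x + a = dotv w (B^T *m x) + a.
  by rewrite /dotv trmx_mul mulmxA.
have [Qy wy] : (Qpoly A B b `&` [set x | dotv w x + a = 0]) y by rewrite -fE.
exists (B *m w), a; split=> [x Px|]; first by rewrite E; apply: w0; exists x.
apply/seteqP; split=> x /=.
  move=> ->; split; first by rewrite Ppoly_image; exists y.
  by rewrite /= E proj_param.
case=> Px /=; rewrite E => wx.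
have : (Qpoly A B b `&` [set x | dotv w x + a = 0]) (B^T *m x) by split=> //; exists x.
by rewrite -fE /= => <-; case: Px => _ <-; rewrite -fiberE.
Qed.

Variables (C : set 'cV[R]_d) (b1 : 'cV[R]_d).
Hypothesis C_E : C = chamber A b1.
Hypothesis C_dim : has_dim C d.
Hypothesis b1_cone : cone A b1.
Hypothesis b1_neq0 : (0 < d)%N -> b1 != 0.
Local Notation cell_basis := (cell_basis A B b1).
Local Notation cell_slack_pos := (cell_slack_pos A B b1).

Lemma cell_basis_facet b I i : cell_slack_pos b -> cell_basis I -> i \in I ->
  is_facet (Qpoly A B b) (Qpoly A B b `&` [set y | ell W (c b) y i = 0]).
Proof.
move=> bpos cI iI; have bI := cell_basis_is_basis cI.
pose v := bpoint W (c b) I.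
have v0 k : k \in I -> ell W (c b) v k = 0 by exact: slack_basis.
(* From the vertex, [z1] points into the interior of the polytope and [z2] into the relative
   interior of its face [i]. *)
have [z1 Hz1] := basis_solve (fun=> 1) bI.
have [z2 Hz2] := basis_solve (fun k => (k != i)%:R) bI.
pose P0 (k : bool * 'I_(d + m)) := if k.2 \in I then 1 else slack W (c b) I k.2.
have P00 k : 0 < P0 k by rewrite /P0; case: ifPn => // kI; exact: bpos.
have [t [t0 _ H]] := small_step (fun k => (W *m (if k.1 then z1 else z2)) k.2 0) P00.
apply: (polyhedron_is_facet (QpolyE b) (p := v + t *: z1) (q := v + t *: z2)).
- move=> k; rewrite ellD mulmxZ_ent; have [kI|kI] := boolP (k \in I).
    by rewrite v0 // Hz1 // mulr1 add0r.
  by have := H (true, k); rewrite /P0 /= (negPf kI).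
- by rewrite ellD mulmxZ_ent v0 // Hz2 // eqxx mulr0 addr0.
- move=> k; rewrite ellD mulmxZ_ent; have [kI|kI] := boolP (k \in I).
    rewrite v0 // Hz2 // add0r; have [->|_] := eqVneq k i; last by left; rewrite mulr1.
    by right; split; [rewrite mulr0|exists 1; rewrite scale1r].
  by left; have := H (false, k); rewrite /P0 /= (negPf kI).
Qed.

(** A point of an interior fiber with [x i = 0] is supported away from [i], so [cell_face_basis]
    gives a cell basis containing [i]. Conversely, each inequality of a cell basis defines a facet
    at its nondegenerate vertex. *)
Lemma cell_facetsE i : (i \in cell_facets A C) = [exists I, cell_basis I && (i \in I)].
Proof.
apply/idP/existsP => [|[I /andP[cI iI]]]; rewrite inE.
  move/asboolP => [b Cb]; rewrite inE => /asboolP[_ [k _ [[x Fx _] _]]].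
  have [[x0 Ax] /= xi] := Fx ord0.
  have bpos := interior_slack_pos B_ker C_E Cb.
  have fp : face_point A B b (finset.setC [set i]%SET) (B^T *m x ord0).
    split=> l; rewrite /ell -Ax -fiberE //.
    by rewrite !inE negbK => /eqP ->.
  have [I cI] := cell_face_basis B_ker C_E C_dim b1_cone b1_neq0 bpos fp.
  rewrite finset.setCS finset.sub1set => iI.
  by exists I; rewrite cI.
have b1i := base_interior B_ker C_E C_dim b1_cone b1_neq0.
apply/asboolP; exists b1; first by [].
by apply: Pfacet; exact: cell_basis_facet (@base_slack_pos _ _ _ A B b1) cI iI.
Qed.

Lemma cell_basis_sub_facets I : cell_basis I -> I \subset cell_facets A C.
Proof.
move=> cI; apply/fintype.subsetP => i iI; rewrite cell_facetsE.
by apply/existsP; exists I; rewrite cI.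
Qed.

Lemma cell_basis_facet_ix b I : cell_slack_pos b -> cell_basis I ->
  [set i in facet_ix A b | (W *m bpoint W (c b) I + c b) i 0 == 0]%SET = I.
Proof.
move=> bpos cI; apply/setP => i; rewrite inE.
apply/andP/idP => [[_ /eqP s0]|iI].
  apply: contraT => iI; have := bpos I i cI iI.
  by rewrite /slack /ell s0 ltxx.
split; first by apply: Pfacet; exact: cell_basis_facet cI iI.
by apply/eqP; exact: (slack_basis (c b) (cell_basis_is_basis cI) iI).
Qed.

Lemma bpoint_Qpoly b I : (forall k, 0 <= slack W (c b) I k) -> Qpoly A B b (bpoint W (c b) I).
Proof. by move=> h; apply/QpolyE. Qed.

Lemma slack_pos_ge0 b I : cell_slack_pos b -> cell_basis I ->
  forall k, 0 <= slack W (c b) I k.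
Proof.
move=> bpos cI k; have [kI|kI] := boolP (k \in I); last exact/ltW/bpos.
by rewrite slack_basis // (cell_basis_is_basis cI).
Qed.

(** The support of a vertex over an interior [b] contains the complement of a cell basis [J]. So [J]
    contains all zeros of the vertex, which [vertex_unique] identifies with the basic solution of
    [J]. For the converse the fiber over [b1] itself serves. *)
Lemma cell_verticesE I : (I \in cell_vertices A C) = cell_basis I.
Proof.
apply/idP/idP => [|cI]; rewrite inE.
  move/asboolP => [b [v [Cb vv ->]]].
  have bpos := interior_slack_pos B_ker C_E Cb.
  have vy := Pvertex_proj vv.
  have [x0 Ax] : Ppoly A b v by case: vv => w [a [_ /seteqP[/(_ v erefl)[]]]].
  have vE : W *m (B^T *m v) + c b = v by rewrite -Ax -fiberE.
  have fp : face_point A B b [set k | v k 0 != 0]%SET (B^T *m v).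
    by split=> k; rewrite /ell vE // inE negbK => /eqP.
  have [J cJ Js] := cell_face_basis B_ker C_E C_dim b1_cone b1_neq0 bpos fp.
  have yE : bpoint W (c b) J = B^T *m v.
    apply: (vertex_unique (QpolyE b) vy); first exact/bpoint_Qpoly/slack_pos_ge0.
    move=> k; rewrite {1}/ell vE => vk; apply: slack_basis; first exact: cell_basis_is_basis cJ.
    apply: contraT => kJ; have := fintype.subsetP Js k.
    by rewrite !inE kJ vk eqxx => /(_ isT).
  by have := cell_basis_facet_ix bpos cJ; rewrite yE vE => ->.
apply/asboolP; exists b1, (W *m bpoint W (c b1) I + c b1); split.
- have b1i := base_interior B_ker C_E C_dim b1_cone b1_neq0.
  exact: b1i.
- apply/Qvertex_lift/(bpoint_vertex (QpolyE b1)); first exact: cell_basis_is_basis cI.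
  apply: bpoint_Qpoly => k.
  exact: (slack_pos_ge0 (@base_slack_pos _ _ _ A B b1) cI).
- by rewrite (cell_basis_facet_ix (@base_slack_pos _ _ _ A B b1) cI).
Qed.

Lemma interior_no_redundant b : C° b -> redundant_hyperplanes A B C b = set0.
Proof.
move=> Cb; have bpos := interior_slack_pos B_ker C_E Cb.
apply/seteqP; split=> // y [i iD _]; move: iD; rewrite inE => /andP[iQ iF]; case/negP: iQ.
rewrite inE iF /=; apply/asboolP; move: iF; rewrite cell_facetsE.
by case/existsP => I /andP[cI iI]; exact: cell_basis_facet cI iI.
Qed.

End CellData.

(** * The adjoint polynomials of a cell and of a fiber *)

Section Cones.
Context {R : realFieldType} {N m : nat}.
Variable W : 'M[R]_(N, m).
Implicit Types (S G : {set 'I_N}) (eta : 'rV[R]_m).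

Lemma in_cone_row S k : k \in S -> in_cone W S (row k W).
Proof.
move=> kS; exists (delta_mx 0 k); split=> [i|i iS|]; last by rewrite -rowE.
  by rewrite mxE ler0n.
by rewrite mxE eqxx /=; case: eqP => // ik; rewrite ik kS in iS.
Qed.

Lemma ellB c (p q : 'cV[R]_m) i : (W *m (p - q)) i 0 = ell W c p i - ell W c q i.
Proof. by rewrite !ellE mulmxBr !mxE; ring. Qed.

Lemma in_coneS S S' eta : S \subset S' -> in_cone W S eta -> in_cone W S' eta.
Proof.
move=> /fintype.subsetP SS [mu [mu0 muS E]]; exists mu; split=> // i iS'.
by apply: muS; apply: contra iS'; exact: SS.
Qed.

Lemma in_cone_trans S S' eta : (forall j, j \in S -> in_cone W S' (row j W)) ->
  in_cone W S eta -> in_cone W S' eta.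
Proof.
move=> SS [mu [mu0 muS ->]].
have /choice[nu nuP] : forall j, exists nu : 'rV[R]_N, j \in S ->
    [/\ forall i, 0 <= nu 0 i, forall i, i \notin S' -> nu 0 i = 0 & row j W = nu *m W].
  by move=> j; have [/SS[nu H]|_] := boolP (j \in S); [exists nu|exists 0].
exists (\sum_(j in S) mu 0 j *: nu j); split=> [i|i iS'|].
- rewrite summxE; apply: sumr_ge0 => j jS; rewrite mxE mulr_ge0 //.
  by have [] := nuP j jS.
- rewrite summxE big1 // => j jS; rewrite mxE.
  by have [_ -> // _] := nuP j jS; rewrite mulr0.
rewrite mulmx_sum_row mulmx_suml (bigID (mem S)) /= [X in _ + X]big1 ?addr0.
  by apply: eq_bigr => j jS; have [_ _ ->] := nuP j jS; rewrite scalemxAl.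
by move=> j /muS ->; rewrite scale0r.
Qed.

Lemma in_cone_eval S eta (y : 'cV[R]_m) (mu : 'rV[R]_N) :
  (forall i, i \notin S -> mu 0 i = 0) -> eta = mu *m W ->
  (eta *m y) 0 0 = \sum_(i in S) mu 0 i * (W *m y) i 0.
Proof.
move=> muS ->; rewrite row_mulE (bigID (mem S)) /= [X in _ + X]big1 ?addr0 //.
by move=> j /muS ->; rewrite mul0r.
Qed.

Lemma in_cone_farkas S eta : in_cone W S eta \/
  exists2 z : 'cV[R]_m, (forall k, k \in S -> 0 <= (W *m z) k 0) & (eta *m z) 0 0 < 0.
Proof.
have [[la la0 E]|[z zS ez]] := farkas [seq row j W | j <- enum S] eta; last first.
  right; exists z => // k kS; have := zS (row k W).
  by rewrite -row_mul mxE; apply; apply: map_f; rewrite mem_enum.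
left; rewrite E; have [S0|[k0 k0S]] := set_0Vmem S.
  exists 0; split=> [i|i _|]; rewrite ?mxE // mul0mx S0 enum_set0 /= big_ord0 //.
pose f (i : 'I_(size [seq row j W | j <- enum S])) := nth k0 (enum S) i.
have fS i : f i \in S.
  by rewrite -mem_enum mem_nth //; have := ltn_ord i; rewrite {2}size_map.
exists (\sum_(i < size [seq row j W | j <- enum S]) la i *: delta_mx 0 (f i)); split=> [i|i iS|].
- by rewrite summxE; apply: sumr_ge0 => j _; rewrite !mxE mulr_ge0 // ler0n.
- rewrite summxE big1 // => j _; rewrite !mxE eqxx /=.
  by case: eqP => [ij|_]; [rewrite ij fS in iS|rewrite mulr0].
rewrite mulmx_suml; apply: eq_bigr => i _; rewrite -scalemxAl -rowE.
by rewrite (nth_map k0) //; have := ltn_ord i; rewrite {2}size_map.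
Qed.

End Cones.

Section Boundary.
Context {R : realType} {d m : nat}.
Variables (A : 'M[R]_(d, d + m)) (B : 'M[R]_(d + m, m)).
Hypothesis B_ker : kernel_basis A B.
Local Notation W := (Qnormals A B).
Local Notation c := (Qcst A B).
Variables (C : set 'cV[R]_d) (b1 : 'cV[R]_d).
Hypothesis C_E : C = chamber A b1.
Hypothesis C_dim : has_dim C d.
Hypothesis b1_cone : cone A b1.
Hypothesis b1_neq0 : (0 < d)%N -> b1 != 0.
Local Notation cell_basis := (cell_basis A B b1).
Local Notation cell_slack_pos := (cell_slack_pos A B b1).
Variable b0 : 'cV[R]_d.
Hypothesis Cb0 : C b0.
Hypothesis b0_pos : pos A b0.
Hypothesis Q_simple : is_simple (Qpoly A B b0) m.
Local Notation F := (cell_facets A C).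
Local Notation QF := (Qfacets A B C b0).
Local Notation Q := (Qpoly A B b0).
Local Notation Z v := [set k | ell W (c b0) v k == 0]%SET.
Let QE := QpolyE B_ker b0.

Lemma exists_interior_point : exists p, forall k, 0 < ell W (c b0) p k.
Proof.
have [x /= x0 xE] := b0_pos; exists (B^T *m x) => k.
by rewrite /ell -xE -fiberE.
Qed.

Lemma exists_cell_basis : exists I, cell_basis I.
Proof.
have [y sy] := base_sat B_ker b1_cone.
have fp : face_point A B b1 finset.setT y.
  by split=> k; [exact: (sy k (finset.in_setT _))|rewrite inE].
have [I cI _] := cell_face_basis B_ker C_E C_dim b1_cone b1_neq0 (@base_slack_pos _ _ _ A B b1) fp.
by exists I.
Qed.

Lemma Qfacets_sub : QF \subset F.
Proof. by apply/fintype.subsetP => i; rewrite inE => /andP[]. Qed.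

(** The facets are compared over [b0], but their equality makes rows [i] and [j] positively
    proportional, hence the inequalities parallel over every right-hand side. Over [b1] each is
    tight at a cell basis, which forces [j] into a basis containing [i], against independence. *)
Lemma Qfacet_inj i j : i \in QF -> j \in QF ->
  Q `&` [set y | ell W (c b0) y i = 0] = Q `&` [set y | ell W (c b0) y j = 0] -> i = j.
Proof.
move=> iQ jQ FE; apply/eqP; apply: contraT => ij.
have [p p0] := exists_interior_point.
move: (iQ); rewrite inE => /andP[iF /asboolP[_ [k dQ [[x Fx xI] _]]]].
have km : k.+1 = m by apply: has_dim_uniq dQ _; case: Q_simple.
have rowE l (y : 'cV[R]_m) : (row l W *m y) 0 0 = (W *m y) l 0 by rewrite -row_mul mxE.
have xi a : ell W (c b0) (x a) i = 0 by case: (Fx a).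
have xj a : ell W (c b0) (x a) j = 0 by have := Fx a; rewrite FE => -[].
move: xI; rewrite /aff_independent /row_free.
set M := (X in \rank X) => /eqP rM.
pose K := kermx M^T.
have sub l : (forall a, ell W (c b0) (x a) l = 0) -> (row l W <= K)%MS.
  move=> x0; apply/sub_kermxP; rewrite -[row l W]trmxK -trmx_mul.
  rewrite (_ : M *m _ = 0) ?trmx0 //; apply/row_matrixP => a.
  rewrite row_mul rowK row0 -trmx_mul mulmxBr; apply/eqP; rewrite trmx_eq0 subr_eq0.
  apply/eqP/matrixP => u w; rewrite !ord1 !rowE.
  have := x0 (lift ord0 a); have := x0 ord0; rewrite !ellE; set t := c b0 l 0.
  by move=> *; lra.
have rK : \rank K = 1%N by rewrite mxrank_ker mxrank_tr rM -km subSnn.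
have pos_diff l : (forall a, ell W (c b0) (x a) l = 0) -> 0 < (W *m (p - x ord0)) l 0.
  by move=> x0; rewrite (ellB _ (c b0)) x0 subr0.
have pi := pos_diff i xi; have pj := pos_diff j xj.
have wj : row j W != 0.
  by apply: contraTneq pj => w0; rewrite -rowE w0 mul0mx mxE ltxx.
have /sub_rVP[la wE] : (row i W <= row j W)%MS.
  apply: submx_trans (sub i xi) _.
  have [_ <-] := mxrank_leqif_sup (sub j xj).
  by rewrite rK rank_rV wj.
have WE (y : 'cV[R]_m) : (W *m y) i 0 = la * (W *m y) j 0 by rewrite -!rowE wE -scalemxAl mxE.
have la0 : 0 < la by move: pi; rewrite WE pmulr_lgt0.
have jF : j \in F by apply: (fintype.subsetP Qfacets_sub).
have HF := cell_facetsE B_ker C_E C_dim b1_cone b1_neq0.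
move: iF jF; rewrite !HF => /existsP[I /andP[cI iI]] /existsP[J /andP[cJ jJ]].
have bI := cell_basis_is_basis cI; have bJ := cell_basis_is_basis cJ.
have bp := @base_slack_pos _ _ _ A B b1.
have sij := slack_pos_ge0 bp cI j; have sji := slack_pos_ge0 bp cJ i.
have sii := slack_basis (c b1) bI iI; have sjj := slack_basis (c b1) bJ jJ.
have jI : j \in I.
  apply: contraT => jI; have := bp I j cI jI.
  have : la * slack W (c b1) I j <= 0.
    move: sji sii sjj; rewrite /slack !ellE !WE.
    set a1 := (W *m bpoint W (c b1) I) j 0; set a2 := (W *m bpoint W (c b1) J) j 0.
    set e1 := c b1 i 0; set e2 := c b1 j 0 => h1 h2 h3.
    have -> : la * (a1 + e2) = (la * a1 + e1) - (la * a2 + e1) + la * (a2 + e2) by ring.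
    by rewrite h2 h3 mulr0 addr0 sub0r oppr_le0.
  by rewrite pmulr_rle0 // leNgt => /negP.
have [z Hz] := basis_solve (fun l => (l == i)%:R) bI.
have := WE z; rewrite !Hz // eqxx [j == i]eq_sym (negPf ij) mulr0 => /eqP.
by rewrite oner_eq0.
Qed.

Section Vertex.
Variable v : 'cV[R]_m.
Hypothesis vv : vertices Q v.

Let vQ : forall k, 0 <= ell W (c b0) v k.
Proof. by apply/QE; exact: vertex_in vv. Qed.

Lemma vertex_cell_basis I : cell_basis I -> I \subset Z v -> v = bpoint W (c b0) I.
Proof.
move=> cI /fintype.subsetP IZ; apply: bpoint_unique (cell_basis_is_basis cI) _ => i /IZ.
by rewrite inE => /eqP.
Qed.

(** Over [b2], a short step from [b0] towards [b], the inequalities not tight at [v] stay slack at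
    the basic solution of [I], so local feasibility becomes global. As all cell bases are feasible
    over [b2], [cell_face_basis] yields a cell basis containing [I], hence equal to it. *)
Lemma local_feasible b I : cell_slack_pos b ->
  feasible W (Z v) (c b) I = cell_basis I && (I \subset Z v).
Proof.
move=> bpos; apply/idP/andP => [/feasibleP[IZ bI sI]|[cI IZ]]; last first.
  by apply/feasibleP; split=> // [|k _]; [exact: cell_basis_is_basis cI|exact: bpos].
split=> //.
have vE : v = bpoint W (c b0) I.
  by apply: bpoint_unique => // i /(fintype.subsetP IZ); rewrite inE => /eqP.
pose P0 k := if ell W (c b0) v k == 0 then 1 else ell W (c b0) v k.
have P00 k : 0 < P0 k by rewrite /P0; case: ifPn => // n0; rewrite lt0r n0 vQ.
have [t [t0 t1 H]] := small_step (fun k => slack W (c b) I k - slack W (c b0) I k) P00.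
pose b2 := b0 + t *: (b - b0).
have lin J k : is_basis W J ->
    slack W (c b2) J k = slack W (c b0) J k + t * (slack W (c b) J k - slack W (c b0) J k).
  move=> bJ; rewrite Qcst_lin slack_lin // -scaleN1r addrC Qcst_lin addrC.
  by congr (_ + _ * _); rewrite slack_lin // mulN1r.
have b2pos : cell_slack_pos b2.
  move=> J k cJ kJ; rewrite lin ?(cell_basis_is_basis cJ) //.
  have h1 := cell_slack_ge0 B_ker C_E Cb0 k cJ; have h2 := bpos J k cJ kJ.
  have -> : slack W (c b0) J k + t * (slack W (c b) J k - slack W (c b0) J k) =
    (1 - t) * slack W (c b0) J k + t * slack W (c b) J k by ring.
  by rewrite ltr_wpDl ?mulr_gt0 // mulr_ge0 // subr_ge0 ltW.
have sl k : k \notin I -> 0 < slack W (c b2) I k.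
  move=> kI; rewrite lin //; have := H k; rewrite /P0.
  have sE : ell W (c b0) v k = slack W (c b0) I k by rewrite /slack -vE.
  case: ifPn => [/eqP v0 _|_]; last by rewrite sE.
  by rewrite -sE v0 subr0 add0r mulr_gt0 // sI // inE v0.
have fp : face_point A B b2 (finset.setC I) (bpoint W (c b2) I).
  split=> k; last by rewrite inE negbK; exact: slack_basis.
  have [kI|kI] := boolP (k \in I); last exact/ltW/sl.
  by rewrite [ell _ _ _ _](slack_basis (c b2) bI kI).
have [J cJ] := cell_face_basis B_ker C_E C_dim b1_cone b1_neq0 b2pos fp.
rewrite finset.setCS => IJ.
suff -> : I = J by [].
by apply/eqP; rewrite eqEcard IJ (card_basis bI) (card_basis (cell_basis_is_basis cJ)) leqnn.
Qed.

Lemma local_cover b eta : cell_slack_pos b -> generic W (c b) finset.setT ->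
  in_cone W (Z v) eta -> exists I, [/\ cell_basis I, I \subset Z v & in_cone W I eta].
Proof.
move=> bpos gen ce; have [J cJ] := exists_cell_basis.
have gZ : generic W (c b) (Z v) by apply: genericS gen; exact: finset.subsetT.
have sZ : sat W (Z v) (c b) (bpoint W (c b) J) by move=> k _; exact: (slack_pos_ge0 bpos cJ k).
have [I] := feasible_cover (generic_feasibly_simple gZ) (vertex_spans QE vv) sZ ce.
by rewrite local_feasible // => /andP[cI IZ] Ie; exists I.
Qed.

(** A minimal [G] inside [F :&: Z v] generating the cone of all rows in [Z v] consists of facet
    indices, so it lies in [I0]. It spans, hence has at least [m] elements, while simplicity and
    [Qfacet_inj] allow at most [m] in [I0]; so [G = I0] is a basis. *)
Lemma Qvert_ixP : let I0 := Qvert_ix A B C b0 v in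
  [/\ is_basis W I0, I0 \subset F :&: Z v & forall k, k \in Z v -> in_cone W I0 (row k W)].
Proof.
move=> I0.
have I0E i : (i \in I0) = (i \in QF) && (i \in Z v) by rewrite !inE.
have [b bpos gen] := exists_generic B_ker b1.
have [p p0] := exists_interior_point.
have rowE l (y : 'cV[R]_m) : (row l W *m y) 0 0 = (W *m y) l 0 by rewrite -row_mul mxE.
pose P (G : {set 'I_(d + m)}) := `[< forall k, k \in Z v -> in_cone W G (row k W) >].
have PF : P (F :&: Z v)%SET.
  apply/asboolP => k kZ; have [I [cI IZ Ik]] := local_cover bpos gen (in_cone_row W kZ).
  apply: in_coneS Ik; rewrite finset.subsetI IZ andbT.
  exact: (cell_basis_sub_facets B_ker C_E C_dim b1_cone b1_neq0 cI).
have [G] := minset_exists PF; case/minsetP => /asboolP coneG Gmin GFZ.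
have GI0 : G \subset I0.
  apply/fintype.subsetP => i iG; have := fintype.subsetP GFZ i iG.
  rewrite finset.in_setI => /andP[iF iZ]; rewrite I0E iZ andbT inE iF /=; apply/asboolP.
  (* By minimality row [i] is not in the cone of the others, and Farkas gives a separating [z].
     Adding a multiple of [p - v], which is positive on all of [Z v], turns it into a direction [q]
     along the hyperplane [i] and strictly inside the other inequalities of [G]. *)
  have [ci|[z zG zi]] := in_cone_farkas W (G :\ i)%SET (row i W).
    have PG : P (G :\ i)%SET.
      apply/asboolP => k /coneG; apply: in_cone_trans => j jG.
      have [->//|ji] := eqVneq j i; apply: in_cone_row; by rewrite !inE ji.
    have := Gmin _ PG (finset.subsetDl _ _) => /setP/(_ i).
    by rewrite !inE eqxx iG.
  have pZ k : k \in Z v -> 0 < (W *m (p - v)) k 0.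
    by rewrite inE (ellB _ (c b0)) => /eqP ->; rewrite subr0.
  rewrite rowE in zi.
  pose s := - (W *m z) i 0 / (W *m (p - v)) i 0.
  have s0 : 0 < s by apply: divr_gt0; [rewrite oppr_gt0|exact: pZ].
  pose q := z + s *: (p - v).
  have qE k : (W *m q) k 0 = (W *m z) k 0 + s * (W *m (p - v)) k 0.
    by rewrite /q mulmxDr mxE -scalemxAr [X in _ + X]mxE.
  have qi : (W *m q) i 0 = 0 by rewrite qE /s divfK ?subrr // gt_eqF // pZ.
  have GZ j : j \in G -> j \in Z v by move/(fintype.subsetP GFZ); rewrite finset.in_setI => /andP[].
  have qG j : j \in G -> j != i -> 0 < (W *m q) j 0.
    move=> jG ji; rewrite qE; apply: ltr_wpDl; first by apply: zG; rewrite !inE ji.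
    exact: mulr_gt0 s0 (pZ _ (GZ _ jG)).
  pose P0 k := if ell W (c b0) v k == 0 then 1 else ell W (c b0) v k.
  have P00 k : 0 < P0 k by rewrite /P0; case: ifPn => // n0; rewrite lt0r n0 vQ.
  have [t [t0 _ H]] := small_step (fun k => (W *m q) k 0) P00.
  apply: (polyhedron_is_facet QE (p := p) (q := v + t *: q)) => //.
    by rewrite ellD mulmxZ_ent qi mulr0 addr0; move: iZ; rewrite inE => /eqP.
  move=> k; rewrite ellD mulmxZ_ent; have [kZ|kZ] := boolP (k \in Z v); last first.
    by left; have := H k; rewrite /P0; move: kZ; rewrite inE => /negPf ->.
  have [mu [mu0 muG muE]] := coneG k kZ.
  have wq : (W *m q) k 0 = \sum_(j in G) mu 0 j * (W *m q) j 0.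
    by rewrite -rowE; exact: in_cone_eval muG muE.
  have ge j : j \in G -> 0 <= mu 0 j * (W *m q) j 0.
    move=> jG; apply: mulr_ge0 => //; have [->|ji] := eqVneq j i; first by rewrite qi.
    exact/ltW/qG.
  move: kZ; rewrite inE => /eqP ->; rewrite add0r.
  have : 0 <= (W *m q) k 0 by rewrite wq sumr_ge0.
  rewrite le_eqVlt => /orP[/eqP wq0|wq0]; last by left; rewrite mulr_gt0.
  right; split; first by rewrite -wq0 mulr0.
  exists (mu 0 i); rewrite muE mulmx_sum_row (bigD1 i) //= big1 ?addr0 // => j ji.
  have [jG|/muG ->] := boolP (j \in G); last by rewrite scale0r.
  move: wq0; rewrite wq => /esym/eqP; rewrite psumr_eq0 // => /allP/(_ j (mem_index_enum _)).
  by rewrite jG /= mulf_eq0 [(W *m q) j 0 == 0]gt_eqF ?qG // orbF => /eqP ->; rewrite scale0r.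
have spG : spans W G.
  move=> y y0; apply: (vertex_spans QE vv) => k kZ; have [mu [_ muG muE]] := coneG k kZ.
  rewrite -rowE (in_cone_eval y muG muE) big1 // => j jG; by rewrite y0 // mulr0.
have cI0 : (#|I0| <= m)%N.
  pose f (k : 'I_#|I0|) := Q `&` [set y | ell W (c b0) y (enum_val k) = 0].
  have fI : {in setT &, injective f}.
    move=> k l _ _ /Qfacet_inj H; apply: enum_val_inj; apply: H.
      by have := enum_valP k; rewrite I0E => /andP[].
    by have := enum_valP l; rewrite I0E => /andP[].
  have [_ /(_ v vv) simp] := Q_simple.
  rewrite -card_le_II; apply: (@card_le_trans _ _ _ [set: 'I_#|I0|]).
    by have := @card_II #|I0|; rewrite card_eqPle => -[].
  apply: (@card_le_trans _ _ _ (f @` setT)).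
    by have := inj_card_eq fI; rewrite card_eqPle => -[].
  apply: (@card_le_trans _ _ _ [set F | is_facet Q F /\ F v]); last first.
    by move: simp; rewrite card_eqPle => -[].
  apply: subset_card_le => _ [k _ <-].
  have := enum_valP k; rewrite I0E => /andP[kQ kZ]; move: kQ; rewrite inE => /andP[_ /asboolP fk].
  split=> //; split; first by apply/QE.
  by move: kZ; rewrite inE => /eqP.
have GE : G = I0.
  by apply/eqP; rewrite eqEcard GI0 (leq_trans cI0) // (spans_card spG).
split; [|by rewrite -GE|by rewrite -GE].
rewrite -GE; apply: spans_basis (spG); apply/eqP.
by rewrite eqn_leq {1}GE cI0 (spans_card spG).
Qed.

Lemma vertex_identity (y : 'cV[R[i]]_m) :
  \sum_(I | cell_basis I && (I \subset Z v))
    (`|col_minor W^T I|%:C)%C * \prod_(i in (F :\: I)%SET) ellC W (c b0) y i =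
  (`|col_minor W^T (Qvert_ix A B C b0 v)|%:C)%C *
    \prod_(i in (F :\: Qvert_ix A B C b0 v)%SET) ellC W (c b0) y i.
Proof.
have [bI0 I0F cone0] := Qvert_ixP; set I0 := Qvert_ix A B C b0 v in bI0 I0F cone0 *.
have [b bpos gen] := exists_generic B_ker b1.
have [p p0] := exists_interior_point.
have pZ k : k \in Z v -> 0 < (W *m (p - v)) k 0.
  by rewrite inE (ellB _ (c b0)) => /eqP ->; rewrite subr0.
have subF I : feasible W (Z v) (c b) I -> I \subset (F :&: Z v)%SET.
  rewrite local_feasible // => /andP[cI IZ]; rewrite finset.subsetI IZ andbT.
  exact: (cell_basis_sub_facets B_ker C_E C_dim b1_cone b1_neq0 cI).
have gZ : generic W (c b) (Z v) by apply: genericS gen; exact: finset.subsetT.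
have := simplicial_cone_identity (real_complex R) (y - cplx v) bI0 I0F (finset.subsetIr _ _)
  cone0 gZ pZ subF.
have zE k : k \in Z v -> (map_mx (real_complex R) W *m (y - cplx v)) k 0 = ellC W (c b0) y k.
  rewrite inE ellE addr_eq0 => /eqP v0; rewrite mulmxBr /cplx -map_mxM /ellC /ell mxE [RHS]mxE.
  by congr (_ + _); rewrite mxE [X in - X]mxE v0 rmorphN opprK [RHS]mxE.
(* Inequalities of [F] not tight at [v] lie outside every [I] of the sum and factor out; the tight
   ones are linear in [y - v]. *)
have split_prod (I : {set 'I_(d + m)}) : I \subset Z v ->
    \prod_(i in (F :\: I)%SET) ellC W (c b0) y i =
    \prod_(i in (F :\: Z v)%SET) ellC W (c b0) y i *
    \prod_(i in ((F :&: Z v) :\: I)%SET) (map_mx (real_complex R) W *m (y - cplx v)) i 0.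
  move=> /fintype.subsetP IZ; rewrite (bigID (mem (Z v))) mulrC /=; congr (_ * _).
    rewrite [RHS](eq_bigr (fun k => ellC W (c b0) y k)).
      by apply: eq_bigl => k; rewrite !finset.in_setD finset.in_setI -andbA.
    by move=> k; rewrite finset.in_setD finset.in_setI => /andP[_ /andP[_ kZ]]; exact: zE.
  apply: eq_bigl => k; rewrite !finset.in_setD.
  have [kZ|kZ] := boolP (k \in Z v); first by rewrite andbF.
  rewrite andbT; have [/IZ kZ'|//] := boolP (k \in I); by rewrite kZ' in kZ.
move=> E; rewrite split_prod; last by move: I0F; rewrite finset.subsetI => /andP[].
rewrite mulrCA -E mulr_sumr; apply: eq_big => [I|I /andP[_ IZ]].
  by rewrite local_feasible.
by rewrite split_prod // mulrCA.
Qed.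

End Vertex.

Lemma vertices_image : vertices Q = bpoint W (c b0) @` [set` cell_basis].
Proof.
apply/seteqP; split=> [v vv|_ [I cI <-]].
  have [b bpos gen] := exists_generic B_ker b1.
  (* The zero functional lies in every cone; covering it produces some cell basis tight at [v]. *)
  have c0 : in_cone W (Z v) 0.
    by exists 0; split=> [i|i _|]; rewrite ?mxE // mul0mx.
  have [I [cI IZ _]] := local_cover vv bpos gen c0.
  by exists I => //; rewrite -(vertex_cell_basis cI IZ).
apply: (bpoint_vertex QE (cell_basis_is_basis cI)); apply/QE => k.
exact: (cell_slack_ge0 B_ker C_E Cb0 k cI).
Qed.

Lemma finite_vertices : finite_set (vertices Q).
Proof. by rewrite vertices_image; apply: finite_image; exact: finite_finset. Qed.

Lemma alphaC_param (y : 'cV[R[i]]_m) :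
  alphaC A C (cplx W *m y + cplx (c b0)) =
  (`|\det (col_mx A B^T)|%:C)%C * \prod_(i in (F :\: QF)%SET) ellC W (c b0) y i *
  alphaQ W (c b0) QF Q y.
Proof.
have fv := finite_vertices.
have memv v : (v \in finmap.enum_fset (fset_set (vertices Q))) = (v \in vertices Q).
  exact: in_fset_set.
have CV := cell_verticesE B_ker C_E C_dim b1_cone b1_neq0.
pose G I := (`|col_minor W^T I|%:C)%C * \prod_(i in (F :\: I)%SET) ellC W (c b0) y i.
transitivity ((`|\det (col_mx A B^T)|%:C)%C * \sum_(I | cell_basis I) G I).
  rewrite mulr_sumr; apply: eq_big => I.
    exact: CV.
  rewrite CV => cI.
  rewrite (jacobi_complementary_minor B_ker) ?(card_basis (cell_basis_is_basis cI)) //.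
  by rewrite rmorphM /= -mulrA.
rewrite -mulrA; congr (_ * _); rewrite /alphaQ fsbig_finite //= mulr_sumr.
(* Cell bases are grouped by the vertex to which they collapse over [b0]; [vertex_identity] reduces
   each group to the single term of that vertex. *)
transitivity (\sum_(v <- finmap.enum_fset (fset_set (vertices Q)))
    \sum_(I | cell_basis I && (bpoint W (c b0) I == v)) G I).
  rewrite (exchange_big_dep cell_basis) /=; last by move=> ? ? _ /andP[].
  apply: eq_bigr => I cI; rewrite (eq_bigl (fun v => v == bpoint W (c b0) I)); last first.
    by move=> v; rewrite cI eq_sym.
  rewrite -big_filter filter_pred1_uniq ?finmap.fset_uniq ?big_seq1 //.
  by rewrite memv vertices_image inE; exists I.
rewrite big_seq [RHS]big_seq; apply: eq_bigr => v; rewrite memv inE => vv.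
rewrite /wachs_num mulrCA -/(Qvert_ix A B C b0 v).
have [_ I0F _] := Qvert_ixP vv; have := vertex_identity vv y.
set I0 := Qvert_ix A B C b0 v in I0F *.
have I0QF : I0 \subset QF by apply/fintype.subsetP => i; rewrite inE => /andP[].
have -> : \prod_(i in (F :\: I0)%SET) ellC W (c b0) y i =
   \prod_(i in (F :\: QF)%SET) ellC W (c b0) y i * \prod_(i in (QF :\: I0)%SET) ellC W (c b0) y i.
  rewrite (bigID (mem QF)) mulrC /=; congr (_ * _); apply: eq_bigl => k; rewrite !finset.in_setD.
    have [kQ|kQ] := boolP (k \in QF); rewrite ?andbF ?andbT //.
    by rewrite (fintype.subsetP Qfacets_sub) ?andbT.
  have [kQ|kQ] := boolP (k \in QF); rewrite ?andbF ?andbT //.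
  by rewrite (contraNN (fintype.subsetP I0QF k) kQ).
move <-; apply: eq_bigl => I; case cI: (cell_basis I) => //=.
apply/eqP/idP => [<-|IZ]; last by rewrite -(vertex_cell_basis cI IZ).
apply/fintype.subsetP => k kI; rewrite inE; apply/eqP.
exact: slack_basis (cell_basis_is_basis cI) kI.
Qed.

End Boundary.

(** * Gradients *)

Section Gradient.
Context {K : numFieldType} {p : nat}.
Implicit Types (f h : 'cV[K]_p -> K) (x v : 'cV[K]_p) (g r : 'rV[K]_p).

(** All directional derivatives at once, linear in the direction; partial derivatives alone would
    not pass through an affine change of variables ([gradient_comp]). *)
Definition is_gradient f x g : Prop :=
  forall v, is_derive x v (f : 'cV[K]_p -> K^o) ((g *m v) 0 0 : K^o).

Lemma gradient_unique f x g g' : is_gradient f x g -> is_gradient f x g' -> g = g'.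
Proof.
move=> fg fg'; apply/rowP => j.
have [_ e] := fg (delta_mx j 0); have [_] := fg' (delta_mx j 0).
by rewrite e -!colE !mxE.
Qed.

Lemma gradient_affine r (a : K) x : is_gradient (fun z => (r *m z) 0 0 + a) x r.
Proof.
move=> v.
have E : (fun h : K => h^-1 *: ((((fun z : 'cV[K]_p => (r *m z) 0 0 + a) : 'cV[K]_p -> K^o)
    \o shift x) (h *: v) - ((r *m x) 0 0 + a))) @ (0 : K)^' --> ((r *m v) 0 0 : K^o).
  apply: cvg_near_cst; near=> h.
  have h0 : h != 0 by near: h; exact: nbhs_dnbhs_neq.
  have E1 : (r *m (h *: v + x)) 0 0 = h * (r *m v) 0 0 + (r *m x) 0 0.
    by rewrite mulmxDr -scalemxAr mxE; congr (_ + _); rewrite mxE.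
  have E2 : (r *m (h *: v + x)) 0 0 + a - ((r *m x) 0 0 + a) = h * (r *m v) 0 0 :> K.
    by rewrite E1; ring.
  transitivity (h^-1 * (h * (r *m v) 0 0)); last by rewrite mulKf.
  by congr (_ * _); exact: E2.
apply: DeriveDef; first by apply/cvg_ex; eexists; exact: E.
exact: cvg_lim E.
Unshelve. all: by end_near. Qed.

Lemma gradient_cst (a : K) x : is_gradient (fun=> a) x 0.
Proof.
have E : (fun z : 'cV[K]_p => ((0 : 'rV[K]_p) *m z) 0 0 + a) = (fun=> a).
  by apply/funext => z; rewrite mul0mx mxE add0r.
by have := gradient_affine (0 : 'rV[K]_p) a x; rewrite E.
Qed.

Lemma gradientD f h x g r : is_gradient f x g -> is_gradient h x r ->
  is_gradient (fun z => f z + h z) x (g + r).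
Proof.
by move=> fg hr v; rewrite mulmxDl mxE; exact: is_deriveD (fg v) (hr v).
Qed.

Lemma gradientM f h x g r : is_gradient f x g -> is_gradient h x r ->
  is_gradient (fun z => f z * h z) x (f x *: r + h x *: g).
Proof.
move=> fg hr v; rewrite mulmxDl -!scalemxAl mxE [X in X + _]mxE [X in _ + X]mxE.
exact: is_deriveM (fg v) (hr v).
Qed.

Lemma gradientZ (a : K) f x g : is_gradient f x g ->
  is_gradient (fun z => a * f z) x (a *: g).
Proof. by move=> /(gradientM (gradient_cst a x)); rewrite scaler0 addr0. Qed.

Lemma gradient_coord i x : is_gradient (fun z => z i 0) x (delta_mx 0 i).
Proof.
have E : (fun z : 'cV[K]_p => ((delta_mx 0 i : 'rV[K]_p) *m z) 0 0 + 0) = (fun z => z i 0).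
  by apply/funext => z; rewrite addr0 -rowE mxE.
by have := gradient_affine (delta_mx 0 i : 'rV[K]_p) 0 x; rewrite E.
Qed.

Lemma gradientV f x g : f x != 0 -> is_gradient f x g ->
  is_gradient (fun z => (f z)^-1) x (- (f x) ^- 2 *: g).
Proof.
move=> f0 fg v; rewrite -scalemxAl mxE; have [d e] := fg v.
apply: DeriveDef; first exact: derivableV.
by rewrite deriveV // e.
Qed.

Lemma gradient_sum (I : Type) (s : seq I) (P : pred I) (F : I -> 'cV[K]_p -> K)
    (G : I -> 'rV[K]_p) x :
  (forall i, P i -> is_gradient (F i) x (G i)) ->
  is_gradient (fun z => \sum_(i <- s | P i) F i z) x (\sum_(i <- s | P i) G i).
Proof.
move=> FG; elim: s => [|i s IH].
  rewrite big_nil (_ : (fun z => _) = (fun=> 0)); first exact: gradient_cst.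
  by apply/funext => z; rewrite big_nil.
rewrite big_cons; case: ifP => Pi.
  rewrite (_ : (fun z => _) = (fun z => F i z + \sum_(j <- s | P j) F j z)).
    by apply: gradientD => //; exact: FG.
  by apply/funext => z; rewrite big_cons Pi.
rewrite (_ : (fun z => _) = (fun z => \sum_(j <- s | P j) F j z)) //.
by apply/funext => z; rewrite big_cons Pi.
Qed.

Lemma gradient_prod (I : Type) (s : seq I) (P : pred I) (F : I -> 'cV[K]_p -> K)
    (G : I -> 'rV[K]_p) x :
  (forall i, P i -> is_gradient (F i) x (G i)) -> (forall i, P i -> F i x != 0) ->
  is_gradient (fun z => \prod_(i <- s | P i) F i z) x
    (\prod_(i <- s | P i) F i x *: \sum_(i <- s | P i) (F i x)^-1 *: G i).
Proof.
move=> FG F0; elim: s => [|i s IH].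
  rewrite !big_nil scaler0 (_ : (fun z => _) = (fun=> 1)); first exact: gradient_cst.
  by apply/funext => z; rewrite big_nil.
rewrite !big_cons; case: ifP => Pi; last first.
  rewrite (_ : (fun z => _) = (fun z => \prod_(j <- s | P j) F j z)) //.
  by apply/funext => z; rewrite big_cons Pi.
rewrite (_ : (fun z => _) = (fun z => F i z * \prod_(j <- s | P j) F j z)); last first.
  by apply/funext => z; rewrite big_cons Pi.
have := gradientM (FG i Pi) IH.
set A := \prod_(j <- s | P j) F j x; set S := \sum_(j <- s | P j) _.
suff -> : F i x *: (A *: S) + A *: G i = (F i x * A) *: ((F i x)^-1 *: G i + S) by [].
rewrite scalerDr !scalerA addrC; congr (_ *: _ + _).
by rewrite mulrC mulKf // F0.
Qed.

End Gradient.

(** The difference quotient of the composite along [v] is literally that of [f] along [L *m v]. *)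
Lemma gradient_comp (K : numFieldType) p q (L : 'M[K]_(q, p)) (a : 'cV[K]_q)
    (f : 'cV[K]_q -> K) (y : 'cV[K]_p) (g : 'rV[K]_q) :
  is_gradient f (L *m y + a) g ->
  is_gradient (fun z => f (L *m z + a)) y (g *m L).
Proof.
move=> fg v; rewrite -mulmxA; have [d e] := fg (L *m v).
have E : (fun h : K => h^-1 *: ((((fun z => f (L *m z + a)) : 'cV[K]_p -> K^o)
    \o shift y) (h *: v) - (f (L *m y + a) : K^o))) =
  (fun h : K => h^-1 *: (((f : 'cV[K]_q -> K^o) \o shift (L *m y + a)) (h *: (L *m v))
    - (f (L *m y + a) : K^o))).
  apply/funext => h /=; congr (_ *: (f _ - _)).
  by rewrite mulmxDr -scalemxAr addrA.
apply: DeriveDef; first by rewrite /derivable E.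
by rewrite /derive E.
Qed.

Lemma partial_gradient (R : realType) p (f : 'cV[R[i]]_p -> R[i]) x g j :
  is_gradient f x g -> partial f j x = g 0 j.
Proof. by move=> /(_ (delta_mx j 0))[_]; rewrite -colE mxE. Qed.

(** * Critical points *)

(** Vanishing on [ker A] is tested on any [M] generating it: [W] gives the critical equations in
    [y], [B] those that define [XC]. *)
Lemma kernel_orthogonal (L : comNzRingType) d n p (A : 'M[L]_(d, n)) (M : 'M[L]_(n, p))
    (D : 'I_n -> L) :
  A *m M = 0 -> (forall t : 'cV_n, A *m t = 0 -> exists s : 'cV_p, t = M *m s) ->
  (forall t : 'cV_n, A *m t = 0 -> \sum_i t i 0 * D i = 0) <->
  (forall j, \sum_i M i j * D i = 0).
Proof.
move=> AM kerA; split=> [h j|h t /kerA[s ->]].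
  have e : A *m col j M = 0 by rewrite colE mulmxA AM mul0mx.
  by rewrite -[RHS](h _ e); apply: eq_bigr => i _; congr (_ * _); rewrite [RHS]mxE.
under eq_bigr => i _ do rewrite mxE mulr_suml.
rewrite exchange_big big1 // => j _.
transitivity (s j 0 * \sum_i M i j * D i); last by rewrite h mulr0.
by rewrite mulr_sumr; apply: eq_bigr => i _; ring.
Qed.

Section CriticalPoints.
Context {R : realType} {d m : nat}.
Variables (A : 'M[R]_(d, d + m)) (B : 'M[R]_(d + m, m)).
Hypothesis B_ker : kernel_basis A B.
Local Notation K := R[i].
Local Notation W := (Qnormals A B).
Local Notation c := (Qcst A B).
Local Notation cW := (cplx W).
Variables (C : set 'cV[R]_d) (b1 b0 : 'cV[R]_d).
Hypothesis C_E : C = chamber A b1.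
Hypothesis C_dim : has_dim C d.
Hypothesis b1_cone : cone A b1.
Hypothesis b1_neq0 : (0 < d)%N -> b1 != 0.
Hypothesis Cb0 : C b0.
Hypothesis b0_pos : pos A b0.
Hypothesis Q_simple : is_simple (Qpoly A B b0) m.
Variable u : 'cV[R]_m -> K.
Local Notation F := (cell_facets A C).
Local Notation QF := (Qfacets A B C b0).
Local Notation Q := (Qpoly A B b0).
Local Notation u0 := (u'0 A B b0 u).
Local Notation u1 := (u'1 A B C b0 u).
Local Notation phi y := (cW *m y + cplx (c b0)).
Local Notation l y i := (ellC W (c b0) y i).
Local Notation vs := (finmap.enum_fset (fset_set (vertices Q))).
Local Notation num := (wachs_num W (c b0) QF).
Local Notation aQ := (alphaQ W (c b0) QF Q).
Local Notation kap := ((`|\det (col_mx A B^T)|%:C)%C : K).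
Implicit Types (y : 'cV[K]_m) (x t : 'cV[K]_(d + m)).

Let vs_fin := finite_vertices B_ker C_E C_dim b1_cone b1_neq0 Cb0.
Let alphaC_E := alphaC_param B_ker C_E C_dim b1_cone b1_neq0 Cb0 b0_pos Q_simple.

Lemma mem_vs v : (v \in vs) = (v \in vertices Q).
Proof. exact: in_fset_set. Qed.

Lemma real_complex_neq0 (r : R) : r != 0 -> ((r%:C)%C : K) != 0.
Proof. by move=> r0; rewrite fmorph_eq0. Qed.

Lemma cplx_T : [/\ cplx A *m cW = 0, (cplx B)^T *m cW = 1%:M,
  (cplx B)^T *m cplx (c b0) = 0 & cplx A *m cplx (c b0) = cplx b0].
Proof.
have [AL AW BL BW] := T_mulQinv B_ker; have TE : (cplx B)^T = cplx B^T by rewrite /cplx map_trmx.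
rewrite TE /cplx -!map_mxM AW BW map_mx0 map_mx1 /Qcst !mulmxA AL BL mul0mx mul1mx map_mx0.
by split.
Qed.

Lemma phi_fiber y : affine_fiber A b0 (phi y).
Proof.
have [AW _ _ Ac] := cplx_T; rewrite /affine_fiber /= mulmxDr mulmxA AW mul0mx add0r.
exact: Ac.
Qed.

Lemma proj_phi y : (cplx B)^T *m phi y = y.
Proof.
have [_ BW Bc _] := cplx_T.
by rewrite mulmxDr mulmxA BW Bc mul1mx addr0.
Qed.

Lemma cplx_param t : t = cplx (lsubmx (Qinv A B)) *m (cplx A *m t) + cW *m ((cplx B)^T *m t).
Proof.
have TE : (cplx B)^T = cplx B^T by rewrite /cplx map_trmx.
rewrite !mulmxA -mulmxDl TE /cplx -!map_mxM -map_mxD.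
by rewrite (Qinv_mulT B_ker) map_mx1 mul1mx.
Qed.

Lemma fiber_phi x : affine_fiber A b0 x -> x = phi ((cplx B)^T *m x).
Proof.
rewrite /affine_fiber /= => xE; rewrite {1}[x]cplx_param xE addrC; congr (_ + _).
by rewrite /cplx -map_mxM.
Qed.

Lemma Qvert_minor_neq0 v : vertices Q v ->
  ((`|col_minor W^T (Qvert_ix A B C b0 v)|%:C)%C : K) != 0.
Proof.
move=> vv; have [bI _ _] := Qvert_ixP B_ker C_E C_dim b1_cone b1_neq0 Cb0 b0_pos Q_simple vv.
by apply: real_complex_neq0; rewrite normr_eq0; case/andP: bI.
Qed.

Lemma cell_locus_phi y : cell_locus A C (phi y) <->
  ~ DQ W (c b0) QF Q y /\ ~ redundant_hyperplanes A B C b0 y.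
Proof.
rewrite /cell_locus /= alphaC_E !mulf_eq0 !negb_or; split.
  move=> /andP[/andP[/andP[_ _] aQ0] /prodf_neq0 F0]; split.
    case=> [a0|[i iQ li]]; first by rewrite a0 eqxx in aQ0.
    by have /eqP := F0 i (fintype.subsetP (Qfacets_sub _ _ _ _) i iQ); apply; exact: li.
  case=> i; rewrite finset.in_setD => /andP[_ iF] li.
  by have /eqP := F0 i iF; apply; exact: li.
case=> nD nE.
have QF0 i : i \in QF -> l y i != 0.
  by move=> iQ; apply/eqP => li; apply: nD; right; exists i.
have E0 i : i \in (F :\: QF)%SET -> l y i != 0.
  by move=> iQ; apply/eqP => li; apply: nE; exists i.
apply/andP; split; last first.
  apply/prodf_neq0 => i iF; have [/QF0 //|iQ] := boolP (i \in QF).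
  by apply: E0; rewrite finset.in_setD iQ.
rewrite real_complex_neq0 ?normr_eq0 ?(det_neq0 B_ker) //=; apply/andP; split.
  exact/prodf_neq0.
by apply/eqP => a0; apply: nD; left.
Qed.

(** [alphaC] involves only the coordinates in [F]; the vanishing of [G] elsewhere reduces sums over
    all coordinates to the rows of [B] kept in [XC]. *)
Lemma gradient_alphaC x : (forall i, i \in F -> x i 0 != 0) ->
  exists2 G, is_gradient (alphaC A C) x G & forall i, i \notin F -> G 0 i = 0.
Proof.
move=> x0; eexists.
  apply: gradient_sum => I _; apply: gradientZ; apply: gradient_prod => i.
    by move=> _; exact: gradient_coord.
  by rewrite finset.in_setD => /andP[_]; exact: x0.
move=> i iF; rewrite summxE big1 // => I _; rewrite [LHS]mxE [X in _ * X]mxE summxE.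
rewrite [X in _ * (_ * X)]big1 ?mulr0 // => k.
rewrite finset.in_setD => /andP[_ kF]; rewrite !mxE eqxx /=.
by case: eqP => [ik|_]; [rewrite ik kF in iF|rewrite mulr0].
Qed.

Lemma gradient_ellC i y : is_gradient (fun y => l y i) y (row i cW).
Proof.
have E : (fun z : 'cV[K]_m => (row i cW *m z) 0 0 + cplx (c b0) i 0) = (fun z => l z i).
  by apply/funext => z; rewrite -row_mul mxE /ellC /ell [in RHS]mxE.
by have := gradient_affine (row i cW) (cplx (c b0) i 0) y; rewrite E.
Qed.

Definition log_gradient (S : {set 'I_(d + m)}) y : 'rV[K]_m :=
  \sum_(i in S) (l y i)^-1 *: row i cW.

Lemma log_gradientE S y j : log_gradient S y 0 j = \sum_(i in S) cW i j / l y i.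
Proof. by rewrite summxE; apply: eq_bigr => i _; rewrite !mxE mulrC. Qed.

Lemma gradient_num v y : (forall i, i \in QF -> l y i != 0) ->
  is_gradient (num v) y (num v y *: log_gradient (QF :\: Qvert_ix A B C b0 v)%SET y).
Proof.
move=> y0; rewrite -scalerA; apply: gradientZ; apply: gradient_prod => i.
  by move=> _; exact: gradient_ellC.
by rewrite finset.in_setD => /andP[_]; exact: y0.
Qed.

Lemma gradient_alphaQ y : (forall i, i \in QF -> l y i != 0) ->
  exists H, is_gradient aQ y H.
Proof.
move=> y0; have E : aQ = (fun y => \sum_(v <- vs) num v y).
  by apply/funext => z; rewrite /alphaQ fsbig_finite.
by rewrite E; eexists; apply: gradient_sum => v _; exact: gradient_num.
Qed.

Lemma dlog_wachs_coord v y H j : vertices Q v -> (forall i, i \in QF -> l y i != 0) ->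
  aQ y != 0 -> is_gradient aQ y H ->
  partial (wachs_coord W (c b0) QF Q v) j y / wachs_coord W (c b0) QF Q v y =
  \sum_(i in (QF :\: Qvert_ix A B C b0 v)%SET) cW i j / l y i - H 0 j / aQ y.
Proof.
move=> vv y0 a0 gH; have gN := gradient_num v y0.
rewrite -log_gradientE; set S := log_gradient _ y in gN *.
rewrite (partial_gradient j (gradientM gN (gradientV a0 gH))).
have n0 : num v y != 0.
  rewrite mulf_neq0 ?Qvert_minor_neq0 //; apply/prodf_neq0 => i.
  by rewrite finset.in_setD => /andP[_]; exact: y0.
rewrite /wachs_coord !mxE; field; by rewrite n0 a0.
Qed.

Lemma sum_dlog_wachs y j : cell_locus A C (phi y) ->
  \sum_(v \in vertices Q)
     u v * (partial (wachs_coord W (c b0) QF Q v) j y / wachs_coord W (c b0) QF Q v y) =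
  \sum_i cW i j * dlogV A C u0 u1 i (phi y).
Proof.
move=> loc; have [nD nE] := (cell_locus_phi y).1 loc.
have QF0 i : i \in QF -> l y i != 0.
  by move=> iQ; apply/eqP => li; apply: nD; right; exists i.
have E0 i : i \in (F :\: QF)%SET -> l y i != 0.
  by move=> iQ; apply/eqP => li; apply: nE; exists i.
have F0 i : i \in F -> (phi y) i 0 != 0.
  move=> iF; have [/QF0 //|iQ] := boolP (i \in QF).
  by apply: E0; rewrite finset.in_setD iQ.
have a0 : aQ y != 0 by apply/eqP => aE; apply: nD; left.
have [H gH] := gradient_alphaQ QF0.
have [G gG _] := gradient_alphaC F0.
pose red := \prod_(i in (F :\: QF)%SET) l y i.
have red0 : red != 0 by exact/prodf_neq0.
have k0 : kap != 0 by rewrite real_complex_neq0 // normr_eq0 (det_neq0 B_ker).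
(* The identity [alphaC_param] differentiated in two ways: by the chain rule along the fiber, and as
   a product in [y]. *)
have GW : (G *m cW) 0 j / alphaC A C (phi y) =
    H 0 j / aQ y + \sum_(i in (F :\: QF)%SET) cW i j / l y i.
  have g1 := gradient_comp gG.
  have gr : is_gradient (fun y => \prod_(i in (F :\: QF)%SET) l y i) y
      (red *: log_gradient (F :\: QF)%SET y).
    by apply: gradient_prod => // i _; exact: gradient_ellC.
  have := gradientM (gradientZ kap gr) gH.
  rewrite (_ : (fun z => _) = (fun z => alphaC A C (phi z))); last first.
    by apply/funext => z; rewrite alphaC_E.
  move/(gradient_unique g1) ->; rewrite -log_gradientE alphaC_E -/red !mxE.
  by field; rewrite k0 red0 a0.
have dV i : dlogV A C u0 u1 i (phi y) = u0 * (G 0 i / alphaC A C (phi y)) -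
    (if i \in F then u1 i / l y i else 0).
  rewrite /dlogV /dlog (partial_gradient i gG); congr (_ - _).
  have -> : \sum_(k in F) u1 k *
        (partial (fun z : 'cV[K]_(d + m) => z k 0) i (phi y) / (phi y) k 0) =
      \sum_(k in F) (if k == i then u1 k / l y k else 0).
    apply: eq_bigr => k _; rewrite (partial_gradient i (gradient_coord k (phi y))) mxE eqxx /=.
    by rewrite eq_sym; case: eqP => _; rewrite ?mul1r // mul0r mulr0.
  case: ifP => iF.
    by rewrite (bigD1 i) //= eqxx big1 ?addr0 // => k /andP[_ /negPf ->].
  by rewrite big1 // => k kF; case: eqP => // ki; rewrite -ki kF in iF.
transitivity (u0 * ((G *m cW) 0 j / alphaC A C (phi y)) - \sum_(i in F) u1 i * (cW i j / l y i));
    last first.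
  rewrite [in LHS]mxE mulr_suml mulr_sumr [X in _ - X]big_mkcond /= -sumrB.
  apply: eq_bigr => i _; rewrite dV mulrBr; congr (_ - _); first by ring.
  by case: ifP => _; [ring|rewrite mulr0].
rewrite GW fsbig_finite // big_seq.
rewrite (eq_bigr (fun v => \sum_(i in QF | i \notin Qvert_ix A B C b0 v) u v * (cW i j / l y i)
   - u v * (H 0 j / aQ y))); last first.
  move=> v; rewrite mem_vs inE => vv; rewrite (dlog_wachs_coord j vv QF0 a0 gH) mulrBr mulr_sumr.
  congr (_ - _); apply: eq_bigl => i; rewrite finset.in_setD; exact: andbC.
rewrite -big_seq sumrB -mulr_suml.
have u0E : \sum_(v <- vs) u v = - u0 by rewrite /u'0 opprK fsbig_finite.
rewrite u0E (exchange_big_dep (mem QF)) /=; last by move=> ? ? _ /andP[].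
have u1Q i : i \in QF ->
    \sum_(v <- vs | i \notin Qvert_ix A B C b0 v) u v = - u1 i.
  move=> iQ; rewrite /u'1 opprK fsbig_mkcondr fsbig_finite // big_mkcond /=.
  apply: eq_bigr => v _; case: ifPn => h; first by rewrite ifT // inE.
  rewrite ifF //; apply/negbTE; rewrite notin_setE /=; apply/negP; rewrite negbK.
  by move: h; rewrite negbK.
(* No [Qvert_ix] contains an index outside [QF], so its exponent is [u0]; this cancels the
   logarithmic derivative of the extra product in [alphaC_param]. *)
have u1E i : i \notin QF -> u1 i = u0.
  move=> iQ; rewrite /u'1 /u'0; congr (- _); congr (\sum_(v \in _) u v).
  apply/seteqP; split=> [v []//|v vv]; split=> //=.
  by apply: contra iQ; rewrite inE => /andP[].
rewrite [X in _ = _ - X](bigID (mem QF)) /=.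
rewrite (eq_bigr (fun i => - (u1 i * (cW i j / l y i)))); last first.
  move=> i iQ; rewrite (eq_bigl (fun v => i \notin Qvert_ix A B C b0 v)); last first.
    by move=> v; rewrite iQ.
  by rewrite -mulr_suml u1Q // mulNr.
have -> : \sum_(i in F | i \in QF) u1 i * (cW i j / l y i) = \sum_(i in QF) u1 i * (cW i j / l y i).
  apply: eq_bigl => i; have [iQ|] := boolP (i \in QF); rewrite ?andbF ?andbT //.
  exact: (fintype.subsetP (Qfacets_sub _ _ _ _) i iQ).
have -> : \sum_(i in F | i \notin QF) u1 i * (cW i j / l y i) =
    u0 * \sum_(i in (F :\: QF)%SET) cW i j / l y i.
  rewrite mulr_sumr; apply: eq_big => [i|i /andP[_ iQ]]; last by rewrite u1E.
  by rewrite finset.in_setD andbC.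
by rewrite sumrN; ring.
Qed.

Lemma cplx_kernel t : cplx A *m t = 0 -> t = cW *m ((cplx B)^T *m t).
Proof. by move=> At; rewrite {1}[t]cplx_param At mulmx0 add0r. Qed.

Lemma kernel_cW (D : 'I_(d + m) -> K) :
  (forall t, cplx A *m t = 0 -> \sum_i t i 0 * D i = 0) <->
  (forall j, \sum_i cW i j * D i = 0).
Proof.
apply: kernel_orthogonal; first by case: cplx_T.
by move=> t /cplx_kernel E; eexists; exact: E.
Qed.

Lemma kernel_cB (D : 'I_(d + m) -> K) :
  (forall t, cplx A *m t = 0 -> \sum_i t i 0 * D i = 0) <->
  (forall j, \sum_i cplx B i j * D i = 0).
Proof.
apply: kernel_orthogonal; first by rewrite /cplx -map_mxM (mul_kernel_basis B_ker) map_mx0.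
move=> t /cplx_kernel tE.
have [N NE] : exists N : 'M[R]_m, W = B *m N.
  have : (W^T <= B^T)%MS.
    case: B_ker => _ ->; apply/sub_kermxP; rewrite -trmx_mul.
    by have [_ -> _ _] := T_mulQinv B_ker; rewrite trmx0.
  by case/submxP => M ME; exists M^T; rewrite -[LHS]trmxK ME trmx_mul trmxK.
by exists (cplx N *m ((cplx B)^T *m t)); rewrite {1}tE NE /cplx map_mxM !mulmxA.
Qed.

Lemma critV_phi y : critV A C b0 u0 u1 (phi y) <->
  (critLQ A B C b0 u `\` redundant_hyperplanes A B C b0) y.
Proof.
split=> [[loc _ /kernel_cW h]|[[nD h] nE]].
  have [nD nE] := (cell_locus_phi y).1 loc; split=> //; split=> // j.
  by rewrite sum_dlog_wachs.
have loc : cell_locus A C (phi y) by apply/cell_locus_phi.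
split=> //; first exact: phi_fiber.
by apply/kernel_cW => j; rewrite -sum_dlog_wachs.
Qed.

Lemma critV_XC : critV A C b0 u0 u1 = XC A B C u0 u1 `&` affine_fiber A b0.
Proof.
have eqD x : cell_locus A C x -> forall j,
    ((cplx (row_submx B F))^T *m (\col_(k < #|F|) let i := enum_val k in
      u0 * partial (alphaC A C) i x / alphaC A C x - u1 i / x i 0)) j 0 =
    \sum_i cplx B i j * dlogV A C u0 u1 i x.
  rewrite /cell_locus /= mulf_eq0 negb_or => /andP[_ /prodf_neq0 F0] j.
  have [G gG GF] := gradient_alphaC F0.
  rewrite mxE [RHS](bigID (mem F)) /= [X in _ = _ + X]big1 ?addr0 => [|i iF]; last first.
    rewrite /dlogV /dlog (partial_gradient i gG) GF // mul0r mulr0 sub0r.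
    rewrite big1 ?oppr0 ?mulr0 // => k kF.
    rewrite (partial_gradient i (gradient_coord k x)) mxE eqxx /=.
    by case: eqP => [ik|_]; [rewrite ik kF in iF|rewrite mul0r mulr0].
  rewrite [RHS]big_enum_val; apply: eq_bigr => k _; rewrite !mxE; congr (_ * _).
  rewrite /dlogV /dlog mulrA; congr (_ - _).
  set i := enum_val k; have iF : i \in F := enum_valP k.
  rewrite (bigD1 i) //= big1 ?addr0 => [|a /andP[_ ai]].
    by rewrite (partial_gradient i (gradient_coord i x)) mxE !eqxx /= mul1r.
  rewrite (partial_gradient i (gradient_coord a x)) mxE eqxx /=.
  by rewrite eq_sym (negPf ai) mul0r mulr0.
apply/seteqP; split=> x.
  move=> [loc fx /kernel_cB h]; split=> //; split=> //.
  by apply/colP => j; rewrite eqD // h mxE.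
move=> [[loc h] fx]; split=> //; apply/kernel_cB => j.
by rewrite -eqD // h mxE.
Qed.

End CriticalPoints.

Theorem theorem5p3 (R : realType) (d m : nat)
  (A : 'M[R]_(d, d + m)) (B : 'M[R]_(d + m, m))
  (A_ge0 : forall i j, 0 <= A i j)
  (A_rank : \rank A = d)
  (A_col : forall j, col j A != 0)
  (B_ker : kernel_basis A B)
  (C : set 'cV[R]_d) (C_cell : is_cell A C)
  (b0 : 'cV[R]_d) (Cb0 : C b0) (b0_pos : pos A b0)
  (Q_simple : is_simple (Qpoly A B b0) m)
  (u : 'cV[R]_m -> R[i]) :
  let u0 := u'0 A B b0 u in
  let u1 := u'1 A B C b0 u in
  let E := redundant_hyperplanes A B C b0 in
  let piB := fun x : 'cV[R[i]]_(d + m) => (cplx B)^T *m x in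
  [/\ set_bij (critV A C b0 u0 u1) (critLQ A B C b0 u `\` E) piB,
      critLQ A B C b0 u `\` E =
        piB @` (XC A B C u0 u1 `&` affine_fiber A b0)
    & C° b0 -> E = set0].
Proof.
move=> u0 u1 E piB; have [_ C_dim] := C_cell.
have [b1 [C_E b1_cone b1_neq0]] := chamber_base_point (leq_addr m d) C_cell.
have critE y := critV_phi B_ker C_E C_dim b1_cone b1_neq0 Cb0 b0_pos Q_simple u y.
have V_phi x : critV A C b0 u0 u1 x -> x = cplx (Qnormals A B) *m piB x + cplx (Qcst A B b0).
  by case=> _ fx _; exact: fiber_phi B_ker _ _ fx.
have im : piB @` critV A C b0 u0 u1 = critLQ A B C b0 u `\` E.
  apply/seteqP; split=> [_ [x Vx <-]|y Sy].
    by apply/critE; rewrite -V_phi.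
  exists (cplx (Qnormals A B) *m y + cplx (Qcst A B b0)); first exact/critE.
  exact: proj_phi.
split.
- split; [by rewrite -im => x Vx; exists x| |by rewrite -im].
  by move=> x x'; rewrite !inE => /V_phi -> /V_phi ->; rewrite /piB !proj_phi // => ->.
- by rewrite -im (critV_XC B_ker).
- move=> Cb; exact: (interior_no_redundant B_ker C_E C_dim b1_cone b1_neq0 Cb).
Qed.
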